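(* Let $\theta\in[0,1)$ be either $\theta=0$ or an irrational number with finite Diophantine approximation exponent $\gamma$; if $\theta=0$ set $\gamma=1$. Let $\psi:\mathbb{N}\to(0,\infty)$ be a positive decreasing function such that the limit $\tau=\lambda(\psi)$ exists and \[\tau>\frac{2+\gamma^2+\sqrt{(2+\gamma^2)^2-4}}{2}.\] Put $\beta:=\gamma^{-2}(\tau-1)^2$ (the hypothesis implies $\beta>\tau$). Then $\dim_F \mathrm{Exact}(\psi,\theta)>0$; more precisely \[\dim_F \mathrm{Exact}(\psi,\theta)\ \ge\ \frac{2(\beta-\tau)}{\tau(\beta-1)}.\]
   Context: For a function $\psi:\mathbb{N}\to(0,\infty)$, $\lambda(\psi):=-\lim_{q\to\infty}\frac{\log\psi(q)}{\log q}$ (assumed to exist). The Diophantine approximation exponent of an irrational $\theta$ is the infimum of all $\gamma$ such that $|\theta-p/q|\le q^{-\gamma}$ has only finitely many integer solutions $(p,q)$. For $\theta\in[0,1)$, $\mathrm{Exact}(\psi,\theta)$ is the set of real $x$ such that (i) $|x-\frac{r-\theta}{q}|\le\psi(q)$ for infinitely many pairs $(r,q)$ of relatively prime integers, and (ii) for every $c>0$, $|x-\frac{r-\theta}{q}|\le\psi(q)-c\psi(q)$ holds for only finitely many pairs $(r,q)$ of relatively prime integers. Fourier transform: $\hat\mu(\xi)=\int e^{-2\pi i x\xi}\,d\mu(x)$. For $E\subset\mathbb{R}$, the Fourier dimension $\dim_F E$ is the supremum of $s\in[0,1]$ such that there exists a nonzero finite positive Borel measure $\mu$ with compact support contained in $E$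 and a constant $C$ with $|\hat\mu(\xi)|\le C(1+|\xi|)^{-s/2}$ for all $\xi\in\mathbb{R}$. *)

(* Defs.v *)
From HB Require Import structures.
From mathcomp Require Import all_boot all_order all_algebra.
From mathcomp Require Import all_classical all_reals all_analysis.
Set Implicit Arguments. Unset Strict Implicit. Unset Printing Implicit Defensive.
Import Order.TTheory GRing.Theory Num.Theory.
Import numFieldNormedType.Exports.
Local Open Scope classical_set_scope.
Local Open Scope ring_scope.

Definition dio_good_exponents {R : realType} (theta : R) : set R :=
  [set g | finite_set [set pq : int * nat | (0 < pq.2)%N /\
      `|theta - pq.1%:~R / pq.2%:R| <= (pq.2%:R : R) `^ (- g)]].

(* Diophantine approximation exponent (in the extended reals; +oo if no such gamma) *)
Definition dio_exponent {R : realType} (theta : R) : \bar R :=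
  ereal_inf [set g%:E | g in dio_good_exponents theta].

Definition approx_pairs {R : realType} (psi : nat -> R) (theta : R) (eps : R) (x : R)
  : set (int * nat) :=
  [set rq | (0 < rq.2)%N /\ coprime `|rq.1|%N rq.2 /\
     `|x - (rq.1%:~R - theta) / rq.2%:R| <= eps * psi rq.2].

Definition Exact {R : realType} (psi : nat -> R) (theta : R) : set R :=
  [set x | infinite_set (approx_pairs psi theta 1 x) /\
     forall c : R, 0 < c -> finite_set (approx_pairs psi theta (1 - c) x)].

(* real and imaginary parts of the Fourier transform
   hat mu (xi) = \int e^{-2 pi i x xi} d mu(x) = FTre - i FTim *)
Definition FTre {R : realType} (mu : {measure set (measurableTypeR R) -> \bar R}) (xi : R) : R :=
  (\int[mu]_(x in setT) cos (2 * pi * (x : R) * xi))%R.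
Definition FTim {R : realType} (mu : {measure set (measurableTypeR R) -> \bar R}) (xi : R) : R :=
  (\int[mu]_(x in setT) sin (2 * pi * (x : R) * xi))%R.
Definition FTabs {R : realType} (mu : {measure set (measurableTypeR R) -> \bar R}) (xi : R) : R :=
  Num.sqrt (FTre mu xi ^+ 2 + FTim mu xi ^+ 2).

Definition fourier_exponents {R : realType} (E : set R) : set R :=
  [set s | 0 <= s <= 1 /\
    exists (mu : {measure set (measurableTypeR R) -> \bar R}),
      (0 < mu setT)%E /\ (mu setT < +oo)%E /\
      (exists K : set R, compact K /\ K `<=` E /\ mu (~` K) = 0%E) /\
      exists C : R, forall xi : R, FTabs mu xi <= C * (1 + `|xi|) `^ (- (s / 2))].

Definition fourier_dim {R : realType} (E : set R) : R := sup (fourier_exponents E).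

(* Main.v *)
(* The measure is a limit of finite atomic measures [nu k], built along scales
   [Y k.+1 = Y k `^ b] with [tau < b < beta]. Smooth [nu k] into a density [f] of width about
   [Y k `^ (- tau)]; [nu k.+1] puts mass proportional to [f ((r - theta) / q)] at
   [(r - theta) / q + (1 - o(1)) psi q], for all primes [q] in [(Y `^ (1 - e), Y]], where
   [Y = Y k.+1], and all [0 <= r < q].
   - Decay: for a single [q] the atoms see the frequencies of [f] modulo [q], so the error is a sum
     over nonzero multiples of [q]; since an integer below a power of [Y] has boundedly many prime
     divisors above [Y `^ (1 - e)], averaging over [q] gains a factor [Y `^ (1 - e)]. This beats
     the loss [(1 + |xi|) `^ sg] exactly when [sg < (b - tau) / (tau (b - 1))].
   - Exactness: a point of the limit set lies in [(1 - 2 Y `^ (- e)) psi q <= x - (r - theta) / q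
     <= psi q] for a prime [q] at each scale. Distinct shifted fractions repel each other, by the
     Diophantine exponent of [theta], and [b < beta] makes the ranges of denominators excluded in
     this way at successive scales overlap; so no other denominator can approximate [x] better. *)
Require Import Defs.
From HB Require Import structures.
From mathcomp Require Import all_boot all_order all_algebra.
From mathcomp Require Import all_classical all_reals all_analysis.
From mathcomp Require Import ring lra zify.
Set Implicit Arguments. Unset Strict Implicit. Unset Printing Implicit Defensive.
Import Order.TTheory GRing.Theory Num.Theory.
Import numFieldNormedType.Exports.
Local Open Scope classical_set_scope.
Local Open Scope ring_scope.

(** The value of [beta] comes from the exclusion argument. If a prime [q] near [y] approximates [x]
    to within [psi q], separation rules out the other denominators from [y ^ (gamma / (tau - 1))] to
    [y ^ ((tau - 1) / gamma)], up to small losses; [beta] is the quotient of these two exponents.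
    The decay, on the other hand, wants [b] large: after the step from [y] to [Y = y ^ b] the
    Poisson error is about [y ^ (tau (1 - sg) - b)], while the decay demanded at the highest
    frequency [Y ^ tau] is [y ^ (- b tau sg)]. The resulting bound on [sg] increases with [b], so
    [b] is pushed towards [beta]; a decay exponent [sg] counts as [2 sg] in the dimension. Errors
    from infinitely many scales must not spoil the constant in the decay: each step keeps a spare
    factor [y ^ (- e)], summable along the scales. The Poisson series is never summed absolutely.
    Its Fejer means converge for a continuous bump, and the decay of the bump serves only to
    estimate the error. *)

(** * Integrals of continuous functions over segments *)

Section SegmentIntegral.
Context {R : realType}.
Implicit Types (f g F : R -> R) (a b : R).
Local Notation mu := (@lebesgue_measure R).

Definition itg a b f : R := \int[mu]_(x in `[a, b]) f x.

Lemma continuous_integrable f a b : continuous f ->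
  mu.-integrable `[a, b] (EFin \o f).
Proof.
move=> cf; apply: continuous_compact_integrable; first exact: segment_compact.
exact: continuous_subspaceT.
Qed.

Lemma eq_itg f g a b : (forall x, a <= x <= b -> f x = g x) -> itg a b f = itg a b g.
Proof.
move=> fg; apply: eq_Rintegral => x; rewrite inE /= in_itv /=; exact: fg.
Qed.

Lemma itgD f g a b : continuous f -> continuous g ->
  itg a b (fun x => f x + g x) = itg a b f + itg a b g.
Proof. by move=> cf cg; apply: RintegralD => //; exact: continuous_integrable. Qed.

Lemma itgZ r f a b : continuous f -> itg a b (fun x => r * f x) = r * itg a b f.
Proof. by move=> cf; apply: RintegralZl => //; exact: continuous_integrable. Qed.

Lemma itg0 a b : itg a b (fun=> 0) = 0.
Proof. by rewrite /itg Rintegral_cst//= mul0r. Qed.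

Lemma itg_cst r a b : a <= b -> itg a b (fun=> r) = r * (b - a).
Proof.
move=> ab; rewrite /itg Rintegral_cst//= lebesgue_measure_itv/=; case: ifPn => //=.
by rewrite lte_fin -leNgt => ba; have -> : a = b by [apply/le_anti; rewrite ab ba]; rewrite subrr.
Qed.

Lemma continuous_bigsum (I : Type) (r : seq I) (F : I -> R -> R) :
  (forall i, continuous (F i)) -> continuous (fun x => \sum_(i <- r) F i x).
Proof.
move=> cF; elim: r => [|i r IH] x.
  by under eq_fun do rewrite big_nil; exact: cst_continuous.
under eq_fun do rewrite big_cons.
by apply: continuousD; [exact: cF|exact: IH].
Qed.

Lemma itg_sum (I : Type) (r : seq I) (F : I -> R -> R) a b :
  (forall i, continuous (F i)) ->
  itg a b (fun x => \sum_(i <- r) F i x) = \sum_(i <- r) itg a b (F i).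
Proof.
move=> cF; elim: r => [|i r IH].
  by rewrite big_nil -[RHS](itg0 a b); apply: eq_itg => x _; rewrite big_nil.
rewrite big_cons -IH -itgD//; last exact: continuous_bigsum.
by apply: eq_itg => x _; rewrite big_cons.
Qed.

Lemma le_itg f g a b : continuous f -> continuous g ->
  (forall x, a <= x <= b -> f x <= g x) -> itg a b f <= itg a b g.
Proof.
move=> cf cg fg; apply: le_Rintegral => //; try exact: continuous_integrable.
Qed.

Lemma ler_norm_itg f a b : continuous f -> `|itg a b f| <= itg a b (fun x => `|f x|).
Proof. by move=> cf; apply: le_normr_Rintegral => //; exact: continuous_integrable. Qed.

Lemma itg_derive F f a b : a < b -> continuous f ->
  (forall x : R, is_derive x (1 : R) F (f x)) -> itg a b f = F b - F a.
Proof.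
move=> ab cf dF.
have dF' x : derivable F x 1 by have := dF x; case.
have cF : continuous F by move=> x; exact/differentiable_continuous/derivable1_diffP.
rewrite /itg /Rintegral (@continuous_FTC2 _ f F)//.
- exact: continuous_subspaceT.
- split => //; [exact/cvg_at_right_filter/cF|exact/cvg_at_left_filter/cF].
- by move=> x _; rewrite derive1E; exact: derive_val.
Qed.

Lemma itg_support f g a b c d : a <= c -> d <= b ->
  (forall x, c <= x <= d -> f x = g x) ->
  (forall x, ~~ (c <= x <= d) -> f x = 0) ->
  itg a b f = itg c d g.
Proof.
move=> ac db fg f0; rewrite -(eq_itg fg) /itg Rintegral_mkcond [RHS]Rintegral_mkcond.
apply: eq_Rintegral => x _; rewrite /patch !mem_setE !in_itv /=.
case: (boolP (c <= x <= d)) => [/andP[cx xd]|/f0 ->]; last by case: ifP.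
by rewrite (le_trans ac cx) (le_trans xd db).
Qed.

End SegmentIntegral.

(** * The bump [(1 + cos t) ^ N] and its Fourier transform *)

Section CosineBump.
Context {R : realType}.
Implicit Types (w a b t s u A B C : R) (N M : nat).

Lemma is_derive_continuous (F f : R -> R) :
  (forall x : R, is_derive x (1 : R) F (f x)) -> continuous F.
Proof.
move=> dF x; apply/differentiable_continuous/derivable1_diffP.
by have := dF x; case.
Qed.

#[local] Instance is_derive_expn n (f : R -> R) (x df : R) :
  is_derive x (1 : R) f df ->
  is_derive x (1 : R) (fun t => f t ^+ n) (n%:R * f x ^+ n.-1 * df).
Proof.
move=> dfx; elim: n => [|n IH].
  by under eq_fun do rewrite expr0; apply: is_derive_eq; rewrite !mul0r.
under eq_fun do rewrite exprS.
apply: is_derive_eq; rewrite /GRing.scale /= -natr1.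
by case: n {IH} => [|n]; rewrite ?expr0 /= ?exprS; ring.
Qed.

(** The free phase [a] carries the real and the imaginary part of a Fourier integral at once, so
    that no complex numbers are needed. *)
Definition osc N w a t : R := (1 + cos t) ^+ N * cos (w * t + a).

Lemma is_derive_osc N w a t : is_derive t (1 : R) (osc N w a)
  (- N%:R * sin t * (1 + cos t) ^+ N.-1 * cos (w * t + a)
   - w * (1 + cos t) ^+ N * sin (w * t + a)).
Proof.
rewrite /osc; apply: is_derive_eq; rewrite /GRing.scale /=.
by ring.
Qed.

Lemma continuous_osc N w a : continuous (osc N w a).
Proof. exact: is_derive_continuous (is_derive_osc N w a). Qed.

Lemma continuous_cos_affine w a : continuous (fun t => cos (w * t + a)).
Proof.
have := @continuous_osc 0 w a; rewrite /osc.
by under eq_fun do rewrite expr0 mul1r.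
Qed.

Definition oscI N w a : R := itg (- pi) pi (osc N w a).

(** The antiderivative [F] combines both integrands, and it vanishes at both ends because [sin t]
    and [1 + cos t] do. Each use trades one power of the bump for a factor of order [w ^ (- 2)], in
    place of repeated integration by parts. *)
Lemma oscI_rec N w a :
  (w ^+ 2 - N.+1%:R ^+ 2) * oscI N.+1 w a =
  - (N.+1%:R * (2 * N%:R + 1)) * oscI N w a.
Proof.
pose F t : R := - N.+1%:R * sin t * (1 + cos t) ^+ N * cos (w * t + a)
  + w * (1 + cos t) ^+ N.+1 * sin (w * t + a).
pose f t : R := (w ^+ 2 - N.+1%:R ^+ 2) * osc N.+1 w a t
  + (N.+1%:R * (2 * N%:R + 1)) * osc N w a t.
have dF t : is_derive t (1 : R) F (f t).
  rewrite /F /f /osc; apply: is_derive_eq; rewrite /GRing.scale /=.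
  have key : N%:R * (1 + cos t) ^+ N.-1 * sin t ^+ 2 =
             N%:R * (1 + cos t) ^+ N * (1 - cos t).
    rewrite sin2cos2; case: N {F f} => [|N] /=; first by rewrite !mul0r.
    by rewrite [_ ^+ N.+1]exprS; ring.
  apply: subr0_eq; transitivity (- N.+1%:R * cos (w * t + a) *
    (N%:R * (1 + cos t) ^+ N * (1 - cos t)
     - N%:R * (1 + cos t) ^+ N.-1 * sin t ^+ 2)); last by rewrite key subrr mulr0.
  by rewrite -natr1 ![(1 + cos t) ^+ N.+1]exprS; ring.
have cZ N' (c : R) : continuous (fun t => c * osc N' w a t).
  by move=> x; apply: continuousM; [exact: cst_continuous|exact: continuous_osc].
have cf : continuous f by move=> x; exact: (continuousD (cZ _ _ x) (cZ _ _ x)).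
have : itg (- pi) pi f = 0.
  rewrite (itg_derive _ cf dF); last by rewrite gtrN// pi_gt0.
  by rewrite /F !sinN !cosN !sinpi !cospi !subrr !expr0n /=; ring.
rewrite /f itgD; [|exact: cZ..].
rewrite !itgZ; [|exact: continuous_osc..].
by move=> /eqP; rewrite addr_eq0 => /eqP ->; rewrite mulNr.
Qed.

Lemma pi_itv : - pi <= pi :> R.
Proof. by have := pi_ge0 R; lra. Qed.

Lemma oscI_bound0 N w a : `|oscI N w a| <= 2 ^+ N * (2 * pi).
Proof.
apply: le_trans (ler_norm_itg _ _ (@continuous_osc N w a)) _.
have -> : 2 ^+ N * (2 * pi) = itg (- pi) pi (fun=> 2 ^+ N : R).
  by rewrite itg_cst ?pi_itv//; ring.
apply: le_itg => [x||x _].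
- exact: (continuous_comp (@continuous_osc N w a x) (@norm_continuous _ _ _)).
- by move=> x; exact: cst_continuous.
- rewrite /osc normrM -[leRHS]mulr1 ler_pM//; last exact: cos_max.
  rewrite normrX lerXn2r ?nnegrE// ger0_norm.
    by have := cos_le1 x; lra.
  by have := cos_geN1 x; lra.
Qed.

(** The recurrence divides by [w ^ 2 - N ^ 2]; the assumption [2 N <= |w|] keeps this above
    [w ^ 2 / 2]. *)
Lemma oscI_decay N : exists2 C : R, 0 < C &
  forall w a, 2 * N%:R <= `|w| -> `|oscI N w a| * (w ^+ 2) ^+ N <= C.
Proof.
elim: N => [|N [C C0 IH]].
  exists (2 * pi) => [|w a _]; first by rewrite mulr_gt0 ?pi_gt0.
  by rewrite expr0 mulr1; have := oscI_bound0 0 w a; rewrite expr0 mul1r.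
exists (2 * (N.+1%:R * (2 * N%:R + 1)) * C).
  by rewrite !mulr_gt0// addr_gt0// ltr_wpDl.
move=> w a Nw; set K : R := N.+1%:R * (2 * N%:R + 1).
have K0 : 0 <= K by rewrite mulr_ge0.
have w2 : 4 * N.+1%:R ^+ 2 <= w ^+ 2.
  rewrite -[leRHS]real_normK ?num_real//.
  have -> : 4 * N.+1%:R ^+ 2 = (2 * N.+1%:R) ^+ 2 :> R by ring.
  by rewrite ler_pXn2r ?nnegrE// mulr_ge0.
have N2 : 0 <= N.+1%:R ^+ 2 :> R by rewrite exprn_ge0.
have := congr1 Num.norm (oscI_rec N w a).
rewrite !normrM normrN (ger0_norm K0) ger0_norm; last by lra.
move=> e; rewrite exprS mulrA.
have h : `|oscI N.+1 w a| * w ^+ 2 <= 2 * K * `|oscI N w a|.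
  have : `|oscI N.+1 w a| * w ^+ 2 <= 2 * ((w ^+ 2 - N.+1%:R ^+ 2) * `|oscI N.+1 w a|).
    by rewrite mulrC mulrA ler_wpM2r//; lra.
  by move=> /le_trans; apply; rewrite e; lra.
apply: le_trans (ler_wpM2r _ h) _; first by rewrite exprn_ge0// sqr_ge0.
rewrite (_ : _ * _ * _ * _ = 2 * K * (`|oscI N w a| * (w ^+ 2) ^+ N)); last by ring.
rewrite ler_wpM2l ?mulr_ge0//.
by apply: IH; apply: le_trans Nw; rewrite ler_pM2l// ler_nat.
Qed.

Definition oscW N : R := oscI N 0 0.

Lemma oscW_gt0 N : 0 < oscW N.
Proof.
rewrite /oscW; elim: N => [|N IH].
  rewrite /oscI (@eq_itg _ _ (fun=> 1)) => [|x _].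
    by rewrite itg_cst ?pi_itv// mul1r opprK addr_gt0 ?pi_gt0.
  by rewrite /osc expr0 mul1r mul0r addr0 cos0.
have := oscI_rec N 0 0; rewrite expr0n /= sub0r !mulNr => /oppr_inj e.
have : 0 < N.+1%:R ^+ 2 * oscI N.+1 0 0.
  by rewrite e !mulr_gt0// ltr_wpDl.
by rewrite pmulr_rgt0// exprn_gt0.
Qed.

Lemma oscI_addr N w a b :
  oscI N w (a + b) = cos b * oscI N w a + sin b * oscI N w (a + pi / 2).
Proof.
rewrite -!itgZ; [|exact: continuous_osc..]; rewrite -itgD.
- apply: eq_itg => t _; rewrite /osc addrA cosD [in RHS]addrA cosDpihalf; ring.
- by move=> x; apply: continuousM; [exact: cst_continuous|exact: continuous_osc].
- by move=> x; apply: continuousM; [exact: cst_continuous|exact: continuous_osc].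
Qed.

(** At a fixed [t] the integrand is the trigonometric sum of [L] with a moved phase, and the weight
    [(1 + cos t) ^ N] is nonnegative with integral [oscW N]: smoothing never increases the
    transform. *)
Lemma oscI_sum_le (L : seq (R * R)) N A s w a :
  (forall b, `|\sum_(p <- L) p.1 * cos (w * p.2 + b)| <= A) ->
  `|\sum_(p <- L) p.1 * oscI N s (w * p.2 + a)| <= A * oscW N.
Proof.
move=> hA.
have cZ c s' b : continuous (fun t => c * osc N s' b t).
  by move=> x; apply: continuousM; [exact: cst_continuous|exact: continuous_osc].
have cS : continuous (fun t => \sum_(p <- L) p.1 * osc N s (w * p.2 + a) t).
  by apply: continuous_bigsum => p; exact: cZ.
have -> : \sum_(p <- L) p.1 * oscI N s (w * p.2 + a) =
    itg (- pi) pi (fun t => \sum_(p <- L) p.1 * osc N s (w * p.2 + a) t).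
  rewrite itg_sum => [|p]; last exact: cZ.
  by apply: eq_bigr => p _; rewrite itgZ//; exact: continuous_osc.
apply: le_trans (ler_norm_itg _ _ cS) _.
rewrite /oscW /oscI -itgZ; last exact: continuous_osc.
apply: le_itg => [x|x|t _].
- exact: (continuous_comp (cS x) (@norm_continuous _ _ _)).
- exact: (cZ _ _ _ x).
- rewrite /osc; under eq_bigr do rewrite mulrCA.
  rewrite -mulr_sumr normrM mulrC.
  have c0 : 0 <= (1 + cos t) ^+ N by rewrite exprn_ge0//; have := cos_geN1 t; lra.
  rewrite (ger0_norm c0) mul0r addr0 cos0 mulr1 ler_wpM2r//.
  have := hA (s * t + a); congr (`|_| <= _); apply: eq_bigr => p _.
  by congr (_ * cos _); ring.
Qed.

End CosineBump.

(** * Fejer kernels *)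

Section Fejer.
Context {R : realType}.
Implicit Types (w a b t s u A B C : R) (N M : nat).

(** Clamping extends the bump by zero outside [[- pi, pi]]; the exponent [N.+1] ensures that it
    vanishes at the end points, hence is continuous, even for [N = 0]. *)
Definition cosbump N t : R := (1 + cos (Num.max (- pi) (Num.min pi t))) ^+ N.+1.

Lemma cosbump_in N t : - pi <= t <= pi -> cosbump N t = (1 + cos t) ^+ N.+1.
Proof. by case/andP => t1 t2; rewrite /cosbump min_r// max_r. Qed.

Lemma cosbump_out N t : ~~ (- pi <= t <= pi) -> cosbump N t = 0.
Proof.
have pp := @pi_itv R.
rewrite negb_and -!ltNge /cosbump => /orP[t1|t1].
  by rewrite min_r ?max_l ?cosN ?cospi ?subrr ?expr0n ?ltW// (lt_le_trans t1).
by rewrite min_l ?max_r ?cospi ?subrr ?expr0n// ltW.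
Qed.

Lemma cosbump_ge0 N t : 0 <= cosbump N t.
Proof.
by rewrite exprn_ge0//; have := cos_geN1 (Num.max (- pi) (Num.min pi t)); lra.
Qed.

Lemma cosbump_le N t : cosbump N t <= 2 ^+ N.+1.
Proof.
have := cos_geN1 (Num.max (- pi) (Num.min pi t)).
have := cos_le1 (Num.max (- pi) (Num.min pi t)) => h1 h2.
by rewrite /cosbump lerXn2r ?nnegrE//; lra.
Qed.

Lemma continuous_cosbump N : continuous (@cosbump N).
Proof.
have cc : continuous (fun t : R => Num.max (- pi) (Num.min pi t)).
  move=> x; apply: (@continuous_max _ _ (fun=> - pi) (fun t : R => Num.min pi t)).
    exact: cst_continuous.
  by apply: (@continuous_min _ _ (fun=> pi) id); [exact: cst_continuous|exact: id].
have cX n : continuous (fun t : R => (1 + cos (Num.max (- pi) (Num.min pi t))) ^+ n).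
  elim: n => [|n IH] x.
    by under eq_fun do rewrite expr0; exact: cst_continuous.
  under eq_fun do rewrite exprS.
  have c1 : {for x, continuous (fun=> 1 : R)} by exact: cst_continuous.
  have c2 := continuous_comp (cc x) (@continuous_cos R _).
  exact: (continuousM (continuousD c1 c2) (IH x)).
exact: cX.
Qed.

(** For [A = 0] this is [M] times the Fejer kernel at [B]; by [fejerE] a phase [A] only multiplies
    it by [cos A]. *)
Definition fejer M A B : R := \sum_(i < M) \sum_(j < M) cos (A + (i%:R - j%:R) * B).

Lemma fejerE M A B : fejer M A B = cos A *
  ((\sum_(i < M) cos (i%:R * B)) ^+ 2 + (\sum_(i < M) sin (i%:R * B)) ^+ 2).
Proof.
set P := \sum_(i < M) cos _; set S := \sum_(i < M) sin _.
have E (i : 'I_M) : \sum_(j < M) cos (A + (i%:R - j%:R) * B) =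
    cos A * (cos (i%:R * B) * P + sin (i%:R * B) * S)
    - sin A * (sin (i%:R * B) * P - cos (i%:R * B) * S).
  rewrite !mulr_sumr -!sumrN -!big_split /= !mulr_sumr -sumrB.
  by apply: eq_bigr => j _; rewrite mulrBl cosD cosB sinB; ring.
rewrite /fejer (eq_bigr _ (fun i _ => E i)) sumrB -!mulr_sumr sumrB big_split /=.
by rewrite -!mulr_suml -/P -/S; ring.
Qed.

Lemma sin_natpi n : sin (n%:R * pi) = 0 :> R.
Proof.
elim: n => [|n IH]; first by rewrite mul0r sin0.
by rewrite -natr1 mulrDl mul1r sinDpi IH oppr0.
Qed.

Lemma itg_cos_period s a (i j : nat) : 0 < s ->
  itg (- (pi / s)) (pi / s) (fun t => cos ((i%:R - j%:R) * s * t + a))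
  = if i == j then 2 * pi / s * cos a else 0.
Proof.
move=> s0; have ps0 : 0 < pi / s by rewrite divr_gt0 ?pi_gt0.
case: eqP => [->|/eqP ij].
  rewrite (@eq_itg _ _ (fun=> cos a)) => [|t _]; last by congr cos; ring.
  by rewrite itg_cst; [ring|lra].
set k : R := (i%:R - j%:R) * s.
have k0 : k != 0 by rewrite mulf_neq0 ?subr_eq0 ?eqr_nat// gt_eqF.
have dk t : is_derive t (1 : R) (fun t => k^-1 * sin (k * t + a)) (cos (k * t + a)).
  by apply: is_derive_eq; rewrite /GRing.scale /= mulr1 addr0; field.
have ck := @continuous_cos_affine R k a.
have ps2 : - (pi / s) < pi / s by lra.
rewrite (itg_derive ps2 ck dk).
have -> : k * (pi / s) = i%:R * pi - j%:R * pi by rewrite /k; field; rewrite gt_eqF.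
have -> : k * - (pi / s) = j%:R * pi - i%:R * pi by rewrite /k; field; rewrite gt_eqF.
by rewrite !sinD !cosD !sinN !cosN !sin_natpi; ring.
Qed.

End Fejer.

(** * Pointwise convergence of Fejer means *)

Section FejerConvergence.
Context {R : realType}.
Implicit Types (b c t : R) (M : nat).
Variables (N : nat) (w a s u : R).
Hypotheses (s0 : 0 < s) (s4 : s <= 4^-1) (su : s * (`|u| + pi) <= 7 / 4 * pi).

Let h (t : R) := cosbump N t * cos (w * t + a).
Let L : R := pi / s.

Let continuous_h : continuous h.
Proof. by move=> x; exact: (continuousM (@continuous_cosbump R N x) (@continuous_cos_affine R w a x)). Qed.

Let h_le t : `|h t| <= 2 ^+ N.+1.
Proof.
rewrite normrM -[leRHS]mulr1 ler_pM//; last exact: cos_max.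
by rewrite ger0_norm ?cosbump_ge0 ?cosbump_le.
Qed.

(** Near [u] continuity suffices. Farther away, if [t] or [u] lies in the support [[- pi, pi]], then
    [s |t - u|] stays below [7 pi / 4], short of the next period, so [1 - cos] is bounded below; if
    neither does, both values of [h] vanish. *)
Lemma fejer_modulus (z : R) : 0 < z -> exists2 C, 0 <= C &
  forall t, `|t| <= L -> `|h t - h u| <= z + C * (1 - cos (s * (t - u))).
Proof.
move=> z0; have pi0 := @pi_gt0 R.
have [r r0 hr] : exists2 r, 0 < r & forall t, `|t - u| < r -> `|h t - h u| <= z.
  have /cvgrPdist_le /(_ z z0) := @continuous_h u.
  case/nbhs_ballP => r /= r0 hr; exists r => // t tu.
  by rewrite distrC; apply: hr; rewrite /ball /= distrC.
pose x0 := Num.min (s * r) (pi / 4).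
have x00 : 0 < x0 by rewrite lt_min mulr_gt0//= divr_gt0.
have x0r : x0 <= s * r by rewrite ge_min lexx.
have x0p : x0 <= pi / 4 by rewrite ge_min lexx orbT.
pose k := 1 - cos x0.
have k0 : 0 < k.
  by rewrite subr_gt0 -cos0 ltr_cos ?in_itv//=; apply/andP; split; lra.
exists (2 * 2 ^+ N.+1 / k) => [|t tL]; first by rewrite divr_ge0 ?mulr_ge0// ltW.
have cos1 := cos_le1 (s * (t - u)).
have C0 : 0 <= 2 * 2 ^+ N.+1 / k by rewrite divr_ge0 ?mulr_ge0// ltW.
have [tu|tu] := ltP `|t - u| r.
  by apply: le_trans (hr _ tu) _; rewrite lerDl mulr_ge0// subr_ge0.
have [|hout] := boolP ((`|t| <= pi) || (`|u| <= pi)); last first.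
  move: hout; rewrite negb_or -!ltNge => /andP[h1 h2].
  rewrite /h !cosbump_out -?ler_norml -?ltNge// !mul0r subrr normr0.
  by apply: addr_ge0; [exact: ltW|rewrite mulr_ge0// subr_ge0].
move=> hin.
have : s * `|t - u| <= 7 / 4 * pi.
  have sp : s * pi <= 4^-1 * pi by rewrite ler_wpM2r// ltW.
  have sL : s * L = pi by rewrite /L mulrC divfK// gt_eqF.
  have stL : s * `|t| <= pi by rewrite -[leRHS]sL ler_wpM2l// ltW.
  have := ler_wpM2l (ltW s0) (ler_normB t u); rewrite mulrDr => htu.
  move: su; rewrite mulrDr => su'.
  case/orP: hin => hh; have := ler_wpM2l (ltW s0) hh.
    by move=> *; lra.
  by move=> *; lra.
have : s * r <= s * `|t - u| by rewrite ler_pM2l.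
have -> : cos (s * (t - u)) = cos (s * `|t - u|).
  by rewrite -[LHS]cos_norm normrM (gtr0_norm s0).
set y := s * `|t - u| => yr y74.
have cy : cos y <= cos x0.
  have xp : 0 <= x0 <= pi by apply/andP; split; lra.
  have [yp|yp] := leP y pi.
    have x0y : x0 <= y by lra.
    have y0p : 0 <= y <= pi by apply/andP; split => //; lra.
    by rewrite leNgt ltr_cos ?in_itv//= -leNgt.
  have -> : cos y = cos (2 * pi - y).
    by rewrite cosB mulr_natl cos2pi sin2pi; ring.
  have x0y : x0 <= 2 * pi - y by lra.
  have y0p : 0 <= 2 * pi - y <= pi by apply/andP; split; lra.
  by rewrite leNgt ltr_cos ?in_itv//= -leNgt.
have hh : `|h t - h u| <= 2 * 2 ^+ N.+1.
  apply: le_trans (ler_normB _ _) _.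
  by have := h_le t; have := h_le u; lra.
apply: le_trans hh _; rewrite ler_wpDl ?(ltW z0)//.
by rewrite mulrAC ler_pdivlMr// ler_wpM2l ?mulr_ge0// lerB.
Qed.

Let ctF (i j : nat) b c :
  continuous (fun t => cos (b + c * t + (i%:R - j%:R) * (s * (t - u)))).
Proof.
have -> : (fun t => cos (b + c * t + (i%:R - j%:R) * (s * (t - u)))) =
    (fun t => cos ((c + (i%:R - j%:R) * s) * t + (b - (i%:R - j%:R) * (s * u)))).
  by apply/funext => t; congr cos; ring.
exact: continuous_cos_affine.
Qed.

Let continuous_fejer M b c : continuous (fun t => fejer M (b + c * t) (s * (t - u))).
Proof. by apply: continuous_bigsum => i; apply: continuous_bigsum => j; exact: ctF. Qed.

Let K M t := fejer M 0 (s * (t - u)).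

Let K_ge0 M t : 0 <= K M t.
Proof. by rewrite /K fejerE cos0 mul1r addr_ge0// sqr_ge0. Qed.

Let continuous_K M : continuous (K M).
Proof.
have -> : K M = (fun t => fejer M (0 + 0 * t) (s * (t - u))).
  by apply/funext => t; rewrite mul0r addr0.
exact: continuous_fejer.
Qed.

Let ctF0 (i j : nat) : continuous (fun t => cos (0 + (i%:R - j%:R) * (s * (t - u)))).
Proof.
have -> : (fun t => cos (0 + (i%:R - j%:R) * (s * (t - u)))) =
    (fun t => cos (0 + 0 * t + (i%:R - j%:R) * (s * (t - u)))).
  by apply/funext => t; rewrite mul0r addr0.
exact: ctF.
Qed.

(** The frequencies in [t] are [s (1 + i - j)], so only the pairs [j = i + 1] survive; there are
    [M - 1] of them. *)
Let itg_fejer M b : itg (- L) L (fun t => fejer M (b + s * t) (s * (t - u))) =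
  2 * pi / s * cos (b + s * u) * \sum_(i < M) (i.+1 < M)%:R.
Proof.
rewrite /fejer itg_sum => [|i]; last by apply: continuous_bigsum => j; exact: ctF.
rewrite mulr_sumr; apply: eq_bigr => i _.
rewrite itg_sum => [|j]; last exact: ctF.
rewrite (eq_bigr (fun j : 'I_M => if i.+1 == j then 2 * pi / s * cos (b + s * u) else 0)).
  rewrite -big_mkcond /=.
  have [iM|iM] := ltnP i.+1 M; last first.
    rewrite mulr0 big_pred0// => j; apply/eqP => ij.
    by move: (ltn_ord j); rewrite -ij ltnNge iM.
  by rewrite (big_pred1 (Ordinal iM)) ?mulr1// => j; rewrite eq_sym.
move=> j _.
have := itg_cos_period (b - (i%:R - j%:R) * (s * u)) i.+1 j s0.
rewrite -/L => e; transitivity (if i.+1 == j then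
    2 * pi / s * cos (b - (i%:R - j%:R) * (s * u)) else 0).
  by rewrite -e; apply: eq_itg => t _; congr cos; rewrite -natr1; ring.
case: eqP => // <-; congr (_ * cos _); rewrite -natr1; ring.
Qed.

Let itg_K M : itg (- L) L (K M) = 2 * pi / s * M%:R.
Proof.
rewrite /K /fejer itg_sum => [|i]; last by apply: continuous_bigsum => j; exact: ctF0.
have -> : M%:R = \sum_(i < M) 1 :> R by rewrite sumr_const card_ord.
rewrite mulr_sumr; apply: eq_bigr => i _.
rewrite itg_sum => [|j]; last exact: ctF0.
rewrite (bigD1 i)//= big1 ?addr0 => [|j ji].
  have := itg_cos_period 0 i i s0; rewrite eqxx cos0 => <-.
  by apply: eq_itg => t _; rewrite !subrr !mul0r addr0.
have := itg_cos_period (- (i%:R - j%:R) * (s * u)) i j s0.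
rewrite eq_sym (negPf ji : (j == i :> nat) = false) => e; rewrite -[RHS]e.
by apply: eq_itg => t _; congr cos; ring.
Qed.

Let fejerJ M : \sum_(i < M) \sum_(j < M)
    oscI N.+1 (w + (i%:R - j%:R) * s) (a - (i%:R - j%:R) * (s * u)) =
  itg (- L) L (fun t => h t * K M t).
Proof.
have pL : pi <= L.
  by rewrite /L ler_pdivlMr// ler_piMr ?pi_ge0// (le_trans s4)// invf_le1// ler1n.
have -> : (fun t => h t * K M t) = (fun t => \sum_(i < M) \sum_(j < M)
    cosbump N t * cos (a + w * t + (i%:R - j%:R) * (s * (t - u)))).
  apply/funext => t; rewrite /h /K -mulrA.
  have -> : cos (w * t + a) * fejer M 0 (s * (t - u)) =
      fejer M (a + w * t) (s * (t - u)).
    by rewrite !fejerE cos0 mul1r addrC.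
  by rewrite /fejer mulr_sumr; apply: eq_bigr => i _; rewrite mulr_sumr.
have cb (i j : nat) : continuous (fun t =>
    cosbump N t * cos (a + w * t + (i%:R - j%:R) * (s * (t - u)))).
  by move=> x; exact: (continuousM (@continuous_cosbump R N x) (@ctF i j a w x)).
rewrite itg_sum => [|i]; last by apply: continuous_bigsum => j; exact: cb.
apply: eq_bigr => i _; rewrite itg_sum => [|j]; last exact: cb.
apply: eq_bigr => j _; symmetry; apply: itg_support; rewrite ?lerN2//.
  by move=> t tin; rewrite cosbump_in// /osc; congr (_ * cos _); ring.
by move=> t tout; rewrite cosbump_out// mul0r.
Qed.

(** Korovkin's argument: the kernel is nonnegative, has normalized mass [1], and integrates
    [1 - cos (s (t - u))] to [1 / M]. Integrating [fejer_modulus] against it bounds the error by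
    [z / 2 + C / M], without pointwise estimates of the kernel. *)
Lemma fejer_cvg (z : R) : 0 < z -> exists M0 : nat, forall M : nat, (M0 < M)%N ->
  `|s / (2 * pi) / M%:R * (\sum_(i < M) \sum_(j < M)
      oscI N.+1 (w + (i%:R - j%:R) * s) (a - (i%:R - j%:R) * (s * u)))
    - cosbump N u * cos (w * u + a)| <= z.
Proof.
move=> z0; have z20 : 0 < z / 2 by lra.
have [C C0 hC] := fejer_modulus z20.
exists (Num.truncn (2 * C / z)).+1 => M hM.
have M0 : 0 < M%:R :> R by rewrite ltr0n; case: M hM.
have CM : C / M%:R <= z / 2.
  rewrite ler_pdivrMr//.
  have : 2 * C / z < M%:R by rewrite (lt_trans (truncnS_gt _))// ltr_nat.
  by rewrite ltr_pdivrMr//; lra.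
rewrite fejerJ -[cosbump N u * _]/(h u).
have pi0 := @pi_gt0 R; set c := s / (2 * pi) / M%:R.
have c0 : 0 < c by rewrite !divr_gt0// mulr_gt0.
have cK : c * itg (- L) L (K M) = 1.
  rewrite itg_K /c; move: pi0; generalize (@pi R) => p p0.
  by field; rewrite !gt_eqF.
have chK : continuous (fun t => (h t - h u) * K M t).
  move=> x; have cst : {for x, continuous (fun=> h u)} by exact: cst_continuous.
  exact: (continuousM (continuousB (@continuous_h x) cst) (@continuous_K M x)).
have E1 : (fun t => (1 - cos (s * (t - u))) * K M t) = (fun t => K M t
    + (- 1) * fejer M (- (s * u) + s * t) (s * (t - u))).
  apply/funext => t; rewrite /K !fejerE cos0.
  have -> : - (s * u) + s * t = s * (t - u) by ring.
  by ring.
have cst (r x : R) : {for x, continuous (fun=> r)} by exact: cst_continuous.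
have cF (x : R) : {for x, continuous (fun t => (- 1) * fejer M (- (s * u) + s * t) (s * (t - u)))}.
  exact: (continuousM (cst _ _) (@continuous_fejer M _ s x)).
have c1K : continuous (fun t => (1 - cos (s * (t - u))) * K M t).
  by rewrite E1 => x; exact: (continuousD (@continuous_K M x) (cF x)).
have i1K : c * itg (- L) L (fun t => (1 - cos (s * (t - u))) * K M t) = M%:R^-1.
  rewrite E1 itgD; [|exact: continuous_K|by move=> x; exact: cF].
  rewrite itgZ; last exact: continuous_fejer.
  rewrite itg_K itg_fejer addNr cos0 mulr1 mulN1r.
  have -> : \sum_(i < M) (i.+1 < M)%:R = M%:R - 1 :> R.
    case: M hM {M0 CM c c0 cK chK E1 cF c1K} => // M _.
    rewrite big_ord_recr /= ltnn addr0 -natr1 addrK -[RHS]mulr1.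
    rewrite (eq_bigr (fun=> 1)) => [|i _]; last by rewrite ltnS ltn_ord.
    by rewrite sumr_const card_ord mulr1.
  rewrite /c; move: pi0; generalize (@pi R) => p p0.
  by field; rewrite !gt_eqF.
have -> : c * itg (- L) L (fun t => h t * K M t) - h u =
    c * itg (- L) L (fun t => (h t - h u) * K M t).
  have -> : (fun t => h t * K M t) = (fun t => (h t - h u) * K M t + h u * K M t).
    by apply/funext => t; ring.
  rewrite itgD; [|exact: chK|by move=> x; exact: (continuousM (cst _ x) (@continuous_K M x))].
  rewrite itgZ; last exact: continuous_K.
  by rewrite mulrDr mulrCA cK mulr1 addrK.
rewrite normrM (gtr0_norm c0).
apply: le_trans (ler_wpM2l (ltW c0) (ler_norm_itg _ _ chK)) _.
have := le_itg (a := - L) (b := L)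
  (f := fun t => `|(h t - h u) * K M t|)
  (g := fun t => z / 2 * K M t + C * ((1 - cos (s * (t - u))) * K M t)).
have cg1 (x : R) : {for x, continuous (fun t => z / 2 * K M t)}.
  exact: (continuousM (cst _ _) (@continuous_K M x)).
have cg2 (x : R) : {for x, continuous (fun t => C * ((1 - cos (s * (t - u))) * K M t))}.
  exact: (continuousM (cst _ _) (c1K x)).
have cnorm : continuous (fun t => `|(h t - h u) * K M t|).
  by move=> x; exact: (continuous_comp (chK x) (@norm_continuous _ _ _)).
have cg : continuous (fun t => z / 2 * K M t + C * ((1 - cos (s * (t - u))) * K M t)).
  by move=> x; exact: (continuousD (cg1 x) (cg2 x)).
move=> /(_ cnorm cg) le1.
apply: le_trans (ler_wpM2l (ltW c0) (le1 _)) _.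
  move=> t tL; rewrite normrM (ger0_norm (K_ge0 M t)) mulrA -mulrDl.
  by rewrite ler_wpM2r// hC// ler_norml.
rewrite itgD; [|by move=> x; exact: cg1|by move=> x; exact: cg2].
rewrite !itgZ; [|exact: c1K|exact: continuous_K].
by rewrite mulrDr mulrCA cK mulrCA i1K mulr1; lra.
Qed.

End FejerConvergence.

(** * Character sums modulo [q] *)

Section CharacterSums.
Context {R : realType}.
Implicit Types (x y : R) (q m n i j : nat).

Lemma cos_lt1 x : 0 < x < 2 * pi -> cos x < 1.
Proof.
case/andP => x0 x2; rewrite -cos0; have pi0 := @pi_gt0 R.
have [xp|xp] := leP x pi.
  by rewrite ltr_cos ?in_itv//=; apply/andP; split; lra.
have -> : cos x = cos (2 * pi - x) by rewrite cosB mulr_natl cos2pi sin2pi; ring.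
by rewrite ltr_cos ?in_itv//= ?subr_gt0//; apply/andP; split; lra.
Qed.

Lemma cos_2pi_nat n : cos (2 * pi * n%:R : R) = 1.
Proof.
elim: n => [|n IH]; first by rewrite mulr0 cos0.
have c2 : cos (2 * pi : R) = 1 by rewrite mulr_natl cos2pi.
have s2 : sin (2 * pi : R) = 0 by rewrite mulr_natl sin2pi.
by rewrite -[n.+1%:R]natr1 mulrDr mulr1 cosD c2 s2 IH; ring.
Qed.

Lemma sin_2pi_nat n : sin (2 * pi * n%:R : R) = 0.
Proof. by have := @sin_natpi R (2 * n); rewrite natrM => <-; congr sin; ring. Qed.

Lemma cos_2pi_frac_lt1 q m : (0 < q)%N -> ~~ (q %| m)%N ->
  cos (2 * pi * m%:R / q%:R : R) < 1.
Proof.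
move=> q0 qm; have q0' : 0 < q%:R :> R by rewrite ltr0n.
have -> : cos (2 * pi * m%:R / q%:R : R) = cos (2 * pi * (m %% q)%:R / q%:R).
  rewrite {1}(divn_eq m q) natrD natrM.
  have -> : 2 * pi * ((m %/ q)%:R * q%:R + (m %% q)%:R) / q%:R
     = 2 * pi * (m %% q)%:R / q%:R + 2 * pi * (m %/ q)%:R :> R.
    by field; rewrite gt_eqF.
  by rewrite cosD cos_2pi_nat sin_2pi_nat mulr1 mulr0 subr0.
apply: cos_lt1; have pi0 := @pi_gt0 R; apply/andP; split.
  by rewrite divr_gt0// !mulr_gt0// ltr0n lt0n.
by rewrite ltr_pdivrMr// ltr_pM2l ?mulr_gt0// ltr_nat ltn_mod.
Qed.

(** Passing from [r] to [r + 1] permutes the terms, so the vector of the two sums is fixed by the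
    rotation of angle [y]; since [cos y < 1], that vector is [0]. *)
Lemma rotation_sum0 q y : cos y < 1 -> cos (q%:R * y) = 1 ->
  \sum_(r < q) cos (r%:R * y) = 0 /\ \sum_(r < q) sin (r%:R * y) = 0.
Proof.
move=> y1 qy; set P := \sum_(r < q) _; set T := \sum_(r < q) _.
have sqy : sin (q%:R * y) = 0 by apply: cos1sin0; rewrite qy normr1.
have shift (F : R -> R) : F (q%:R * y) = F 0 ->
    \sum_(r < q) F (r.+1%:R * y) = \sum_(r < q) F (r%:R * y).
  move=> Fq; apply: (addrI (F 0)).
  transitivity (\sum_(r < q.+1) F (r%:R * y)).
    by rewrite big_ord_recl mul0r.
  by rewrite big_ord_recr /= Fq addrC.
have eP : cos y * P - sin y * T = P.
  transitivity (\sum_(r < q) cos (r.+1%:R * y)); last by rewrite shift// qy cos0.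
  rewrite /P /T !mulr_sumr -sumrB; apply: eq_bigr => r _.
  by rewrite -[r.+1%:R]natr1 mulrDl mul1r cosD; ring.
have eT : sin y * P + cos y * T = T.
  transitivity (\sum_(r < q) sin (r.+1%:R * y)); last by rewrite shift// sqy sin0.
  rewrite /P /T !mulr_sumr -big_split /=; apply: eq_bigr => r _.
  by rewrite -[r.+1%:R]natr1 mulrDl mul1r sinD; ring.
have z : 2 * (1 - cos y) = (1 - cos y) ^+ 2 + sin y ^+ 2.
  by rewrite sin2cos2; ring.
have zn0 : 2 * (1 - cos y) != 0 by rewrite mulf_neq0// subr_eq0 gt_eqF.
split; apply: (mulfI zn0); rewrite mulr0 z.
  transitivity ((1 - cos y) * (P - (cos y * P - sin y * T))
     - sin y * (T - (sin y * P + cos y * T))); first by ring.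
  by rewrite eP eT !subrr !mulr0 subrr.
transitivity ((1 - cos y) * (T - (sin y * P + cos y * T))
     + sin y * (P - (cos y * P - sin y * T))); first by ring.
by rewrite eP eT !subrr !mulr0 addr0.
Qed.

Lemma character_sum q i j : (0 < q)%N ->
  \sum_(r < q) cos (r%:R * (2 * pi * (i%:R - j%:R) / q%:R)) =
    (if i == j %[mod q] then q%:R else 0) :> R /\
  \sum_(r < q) sin (r%:R * (2 * pi * (i%:R - j%:R) / q%:R)) = 0 :> R.
Proof.
move=> q0; have q0' : q%:R != 0 :> R by rewrite pnatr_eq0 -lt0n.
wlog ij : i j / (j <= i)%N => [hw|].
  have [/hw//|/ltnW/hw[]] := leqP j i; rewrite eq_sym => e1 e2.
  have E r : r%:R * (2 * pi * (i%:R - j%:R) / q%:R) =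
      - (r%:R * (2 * pi * (j%:R - i%:R) / q%:R)) :> R by ring.
  split; first by rewrite -e1; apply: eq_bigr => r _; rewrite [in LHS]E cosN.
  rewrite (eq_bigr (fun r : 'I_q => - sin (r%:R * (2 * pi * (j%:R - i%:R) / q%:R)))).
    by rewrite sumrN e2 oppr0.
  by move=> r _; rewrite E sinN.
rewrite -natrB// eqn_mod_dvd//; case: ifPn => [/dvdnP[k ->]|nd]; last first.
  apply: rotation_sum0; first exact: cos_2pi_frac_lt1.
  by rewrite mulrCA mulrV ?unitfE// mulr1 cos_2pi_nat.
have E (r : 'I_q) : r%:R * (2 * pi * (k * q)%:R / q%:R) = 2 * pi * (r * k)%:R :> R.
  by rewrite !natrM; field.
split.
  by rewrite (eq_bigr (fun=> 1)) => [|r _]; rewrite ?sumr_const ?card_ord// E cos_2pi_nat.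
by apply: big1 => r _; rewrite E sin_2pi_nat.
Qed.

End CharacterSums.

(** * Poisson summation on shifted grids *)

Section Poisson.
Context {R : realType}.
Implicit Types (L : seq (R * R)) (xi a b d x : R).

Definition trig L xi a : R := \sum_(p <- L) p.1 * cos (2 * pi * xi * p.2 + a).

Variable N : nat.

Definition dens d L x : R :=
  \sum_(p <- L) p.1 * (cosbump N ((x - p.2) / d) / (d * oscW N.+1)).

(** The Fourier transform of [dens d L] at [xi] with phase [a], written atom by atom after the
    substitution [x = p.2 + d t]. *)
Definition densT d L xi a : R :=
  (\sum_(p <- L) p.1 * oscI N.+1 (2 * pi * xi * d) (2 * pi * xi * p.2 + a)) / oscW N.+1.

Lemma densT_le d L xi a A :
  (forall b, `|trig L xi b| <= A) -> `|densT d L xi a| <= A.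
Proof.
move=> hA; rewrite normrM normfV (gtr0_norm (oscW_gt0 _)) ler_pdivrMr ?oscW_gt0//.
exact: oscI_sum_le.
Qed.

Lemma densT_addr d L xi a b :
  densT d L xi (a + b) = cos b * densT d L xi a + sin b * densT d L xi (a + pi / 2).
Proof.
rewrite /densT !mulrA -mulrDl; congr (_ / _).
rewrite !mulr_sumr -big_split /=; apply: eq_bigr => p _.
by rewrite addrA oscI_addr [in RHS]addrA; ring.
Qed.

Lemma cvg_sum_seq_in (T : Type) (F : set_system T) {FF : Filter F}
    (I : eqType) (r : seq I) (f : I -> T -> R) (l : I -> R) :
  (forall i, i \in r -> f i @ F --> l i) ->
  (fun z => \sum_(i <- r) f i z) @ F --> \sum_(i <- r) l i.
Proof.
elim: r => [|i r IH] Fl.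
  rewrite big_nil; under eq_fun do rewrite big_nil; exact: cvg_cst.
rewrite big_cons; under eq_fun do rewrite big_cons.
apply: cvgD; first by apply: Fl; rewrite mem_head.
by apply: IH => j jr; apply: Fl; rewrite inE jr orbT.
Qed.

(** Fejer summation of the Fourier series of the 1-periodization at [x]. As [|x - p.2| <= 3 / 4] and
    the bump has half-width [pi d <= 1 / 8], no translate by a nonzero integer contributes. In the
    variable [(x - p.2) / d] the period is [2 pi / s] with [s = 2 pi d]. *)
Lemma dens_cvg d L xi a x : 0 < d -> 8 * pi * d <= 1 ->
  (forall p, p \in L -> `|x - p.2| <= 3 / 4) ->
  (fun M : nat => M%:R^-1 * \sum_(i < M) \sum_(j < M)
     densT d L (xi + (i%:R - j%:R)) (a - 2 * pi * (i%:R - j%:R) * x)) @ \oo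
  --> dens d L x * cos (2 * pi * xi * x + a).
Proof.
move=> d0 d8 hL; have pi0 := @pi_gt0 R; have W0 := @oscW_gt0 R N.+1.
pose T (p : R * R) (M : nat) : R := p.1 / (d * oscW N.+1) *
   (2 * pi * d / (2 * pi) / M%:R * (\sum_(i < M) \sum_(j < M)
     oscI N.+1 (2 * pi * xi * d + (i%:R - j%:R) * (2 * pi * d))
       (2 * pi * xi * p.2 + a
         - (i%:R - j%:R) * (2 * pi * d * ((x - p.2) / d))))).
have -> : (fun M : nat => M%:R^-1 * \sum_(i < M) \sum_(j < M)
     densT d L (xi + (i%:R - j%:R)) (a - 2 * pi * (i%:R - j%:R) * x)) =
   (fun M => \sum_(p <- L) T p M).
  apply/funext => M; rewrite /T /densT.
  transitivity (\sum_(i < M) \sum_(j < M) \sum_(p <- L)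
     M%:R^-1 / oscW N.+1 * (p.1 * oscI N.+1 (2 * pi * (xi + (i%:R - j%:R)) * d)
      (2 * pi * (xi + (i%:R - j%:R)) * p.2 + (a - 2 * pi * (i%:R - j%:R) * x)))).
    rewrite mulr_sumr; apply: eq_bigr => i _.
    rewrite mulr_sumr; apply: eq_bigr => j _.
    by rewrite -mulr_sumr; ring.
  under eq_bigr do rewrite exchange_big /=.
  rewrite exchange_big /=; apply: eq_bigr => p _.
  rewrite !mulr_sumr; apply: eq_bigr => i _.
  rewrite !mulr_sumr; apply: eq_bigr => j _.
  have -> : 2 * pi * (xi + (i%:R - j%:R)) * d =
     2 * pi * xi * d + (i%:R - j%:R) * (2 * pi * d) by ring.
  have -> : 2 * pi * (xi + (i%:R - j%:R)) * p.2 + (a - 2 * pi * (i%:R - j%:R) * x) =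
    2 * pi * xi * p.2 + a - (i%:R - j%:R) * (2 * pi * d * ((x - p.2) / d)).
    by field; rewrite gt_eqF.
  set M' := M%:R^-1; set O := oscI _ _ _.
  have -> : 2 * pi * d / (2 * pi) = d by rewrite mulrAC divff ?mul1r// mulf_neq0 ?gt_eqF.
  by field; rewrite !gt_eqF.
rewrite /dens mulr_suml; apply: cvg_sum_seq_in => p pL.
have -> : p.1 * (cosbump N ((x - p.2) / d) / (d * oscW N.+1)) * cos (2 * pi * xi * x + a)
  = p.1 / (d * oscW N.+1) * (cosbump N ((x - p.2) / d) *
     cos (2 * pi * xi * d * ((x - p.2) / d) + (2 * pi * xi * p.2 + a))).
  have -> : 2 * pi * xi * d * ((x - p.2) / d) + (2 * pi * xi * p.2 + a) =
    2 * pi * xi * x + a by field; rewrite gt_eqF.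
  by ring.
apply: cvgMr; apply/cvgrPdist_le => z z0.
have s0 : 0 < 2 * pi * d by rewrite !mulr_gt0.
have s4 : 2 * pi * d <= 4^-1 by lra.
have su : 2 * pi * d * (`|(x - p.2) / d| + pi) <= 7 / 4 * pi.
  rewrite mulrDr normrM normfV (gtr0_norm d0).
  have -> : 2 * pi * d * (`|x - p.2| / d) = 2 * pi * `|x - p.2|.
    by field; rewrite gt_eqF.
  have := ler_wpM2r (ltW pi0) s4; have := ler_wpM2l (ltW pi0) (hL _ pL); lra.
have [M0 hM0] := fejer_cvg N (2 * pi * xi * d) (2 * pi * xi * p.2 + a) s0 s4 su z0.
by exists M0.+1 => // M /= hM; rewrite distrC; exact: hM0.
Qed.

Definition grid (theta : R) (q r : nat) : R := (r%:R - theta) / q%:R.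

(** Averaging over the grid turns the dependence on [r] into a character sum, which keeps only the
    pairs congruent modulo [q]; the shift [theta] survives as a phase. *)
Lemma grid_average d L xi a theta q : (0 < q)%N ->
  0 < d -> 8 * pi * d <= 1 ->
  (forall p r, p \in L -> (r < q)%N -> `|grid theta q r - p.2| <= 3 / 4) ->
  (fun M : nat => M%:R^-1 * \sum_(i < M) \sum_(j < M | i == j %[mod q])
     densT d L (xi + (i%:R - j%:R)) (a + 2 * pi * (i%:R - j%:R) * theta / q%:R)) @ \oo
  --> q%:R^-1 * \sum_(r < q) dens d L (grid theta q r)
                   * cos (2 * pi * xi * grid theta q r + a).
Proof.
move=> q0 d0 d8 hL; have q0' : q%:R != 0 :> R by rewrite pnatr_eq0 -lt0n.
have H : (fun M : nat => q%:R^-1 * \sum_(r < q) (M%:R^-1 * \sum_(i < M) \sum_(j < M)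
     densT d L (xi + (i%:R - j%:R)) (a - 2 * pi * (i%:R - j%:R) * grid theta q r))) @ \oo
  --> q%:R^-1 * \sum_(r < q) dens d L (grid theta q r)
                   * cos (2 * pi * xi * grid theta q r + a).
  apply: cvgMr; apply: cvg_sum_seq_in => r _; apply: dens_cvg => // p pL.
  by apply: hL => //; exact: ltn_ord.
apply: cvg_trans H; apply: near_eq_cvg; apply: nearW => M /=.
rewrite -mulr_sumr mulrCA; congr (_ * _).
rewrite exchange_big /= mulr_sumr; apply: eq_bigr => i _.
rewrite exchange_big /= mulr_sumr [RHS]big_mkcond /=; apply: eq_bigr => j _.
set b := a + 2 * pi * (i%:R - j%:R) * theta / q%:R; set eta := xi + _.
set y := 2 * pi * (i%:R - j%:R) / q%:R : R.
have E (r : 'I_q) : densT d L eta (a - 2 * pi * (i%:R - j%:R) * grid theta q r) =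
   cos (r%:R * y) * densT d L eta b - sin (r%:R * y) * densT d L eta (b + pi / 2).
  have -> : a - 2 * pi * (i%:R - j%:R) * grid theta q r = b + - (r%:R * y).
    by rewrite /b /y /grid; field.
  by rewrite densT_addr cosN sinN mulNr.
rewrite (eq_bigr _ (fun r _ => E r)) sumrB -!mulr_suml.
have [-> ->] := @character_sum R q i j q0.
by case: ifP => _; rewrite !mul0r subr0 ?mulr0// mulKf.
Qed.

(** The diagonal [i = j] contributes exactly [densT d L xi (phi q)]. The other terms are bounded in
    absolute value and exchanged with the sum over [Q], so a pair is weighted by the number of [q]
    dividing [i - j]. The bound [S] is uniform in [M] and in the row, hence survives the limit. *)
Lemma poisson_error (Q : seq nat) d L xi theta (phi : nat -> R) (g : R -> R) (S : R) :
  (forall q, q \in Q -> (0 < q)%N) -> 0 < d -> 8 * pi * d <= 1 ->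
  (forall q p r, q \in Q -> p \in L -> (r < q)%N ->
     `|grid theta q r - p.2| <= 3 / 4) ->
  (forall eta a, `|densT d L eta a| <= g eta) ->
  (forall M i : nat, (i < M)%N -> \sum_(j < M | j != i :> nat)
     (count (fun q => i == j %[mod q]) Q)%:R * g (xi + (i%:R - j%:R)) <= S) ->
  `|\sum_(q <- Q) (q%:R^-1 * (\sum_(r < q) dens d L (grid theta q r)
         * cos (2 * pi * xi * grid theta q r + phi q)) - densT d L xi (phi q))| <= S.
Proof.
move=> Q0 d0 d8 hL hg hS.
pose T q (M : nat) : R := M%:R^-1 * (\sum_(i < M) \sum_(j < M | i == j %[mod q])
  densT d L (xi + (i%:R - j%:R)) (phi q + 2 * pi * (i%:R - j%:R) * theta / q%:R))
  - densT d L xi (phi q).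
have H : (fun M => \sum_(q <- Q) T q M) @ \oo --> \sum_(q <- Q)
  (q%:R^-1 * (\sum_(r < q) dens d L (grid theta q r)
         * cos (2 * pi * xi * grid theta q r + phi q)) - densT d L xi (phi q)).
  apply: cvg_sum_seq_in => q qQ; apply: cvgB; last exact: cvg_cst.
  by apply: grid_average => // [|p r pL rq]; [exact: Q0|exact: hL].
have Hn : (fun M => `|\sum_(q <- Q) T q M|) @ \oo --> `|\sum_(q <- Q)
  (q%:R^-1 * (\sum_(r < q) dens d L (grid theta q r)
         * cos (2 * pi * xi * grid theta q r + phi q)) - densT d L xi (phi q))|.
  exact: cvg_norm H.
apply: (cvgr_to_le Hn); exists 1%N => // M /= M1.
have M0 : 0 < M%:R :> R by rewrite ltr0n.
have ET q : T q M = M%:R^-1 * \sum_(i < M)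
   \sum_(j < M | (i == j %[mod q]) && (j != i :> nat))
  densT d L (xi + (i%:R - j%:R)) (phi q + 2 * pi * (i%:R - j%:R) * theta / q%:R).
  rewrite /T; set D := densT d L xi (phi q).
  have -> : D = M%:R^-1 * \sum_(i < M) D.
    by rewrite sumr_const card_ord -[D *+ M]mulr_natl mulKf// gt_eqF.
  rewrite -mulrBr -sumrB; congr (_ * _); apply: eq_bigr => i _.
  rewrite (bigD1 i)//= subrr addr0 mulr0 !mul0r addr0 addrAC subrr add0r.
  by apply: eq_bigl => j.
have : `|\sum_(q <- Q) T q M| <= M%:R^-1 * \sum_(i < M) S; last first.
  by rewrite sumr_const card_ord -[S *+ M]mulr_natl mulKf// gt_eqF.
rewrite (eq_bigr _ (fun q _ => ET q)) -mulr_sumr normrM gtr0_norm ?invr_gt0//.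
rewrite ler_pM2l ?invr_gt0// exchange_big /=.
apply: le_trans (ler_norm_sum _ _ _) _; apply: ler_sum => i _.
apply: le_trans (hS M i (ltn_ord i)).
apply: le_trans (ler_norm_sum _ _ _) _.
apply: le_trans (_ : \sum_(q <- Q) \sum_(j < M | (i == j %[mod q]) && (j != i :> nat))
   g (xi + (i%:R - j%:R)) <= _).
  apply: ler_sum => q _; apply: le_trans (ler_norm_sum _ _ _) _.
  by apply: ler_sum => j _; exact: hg.
under eq_bigr do rewrite big_mkcondl /=.
rewrite exchange_big /=; apply: ler_sum => j _.
by rewrite -big_mkcond /= big_const_seq iter_addr_0 mulr_natl.
Qed.

End Poisson.

(** * Sums of decreasing functions over shifted integers *)

Section ShiftedSums.
Context {R : realType}.
Implicit Types (G : R -> R) (u x X sg : R) (M : nat).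

(* One of the two end points has absolute value at least [M / 2]: peel it off. *)
Lemma sum_shift_le G u M : (forall s t, 0 <= s -> s <= t -> G t <= G s) ->
  \sum_(j < M) G `|u - j%:R| <= \sum_(j < M) G (j%:R / 2).
Proof.
move=> Gni; elim: M u => [|M IH] u; first by rewrite !big_ord0.
rewrite [leRHS]big_ord_recr /=.
have M2 : 0 <= M%:R / 2 :> R by rewrite divr_ge0.
have [h|h] := leP (M%:R / 2) `|u - M%:R|.
  by rewrite big_ord_recr /= lerD// Gni.
rewrite big_ord_recl /= subr0 [leLHS]addrC lerD//; last first.
  apply: Gni => //; have := ler_normB u (u - M%:R).
  by rewrite opprB addrC subrK normr_nat; lra.
apply: le_trans (IH (u - 1)); apply: ler_sum => j _.
by rewrite /bump /= add1n -[j.+1%:R]natr1 opprD addrA addrAC.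
Qed.

Lemma powRD_gt0 x r s : 0 < x -> x `^ (r + s) = x `^ r * x `^ s.
Proof. by move=> x0; apply: powRD; rewrite lt0r_neq0// implybT. Qed.

(** Young's inequality for the product of [(1 + x) ^ sg] and [1], with conjugate exponents [1 / sg]
    and [1 / (1 - sg)]. *)
Lemma powR_bernoulli x sg : 0 <= x -> 0 < sg < 1 -> (1 + x) `^ sg <= 1 + sg * x.
Proof.
move=> x0 /andP[s0 s1].
have s1' : 0 < 1 - sg by rewrite subr_gt0.
have e : (sg^-1)^-1 + ((1 - sg)^-1)^-1 = 1 by rewrite !invrK addrC subrK.
have := @conjugate_powR R ((1 + x) `^ sg) 1 sg^-1 (1 - sg)^-1 (powR_ge0 _ _) ler01.
rewrite !invr_gt0 => /(_ s0 s1' e).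
by rewrite -powRrM mulfV ?gt_eqF// powRr1 ?addr_ge0// powR1 !invrK mulr1 mul1r; lra.
Qed.

(** Comparison with the integral of [t ^ (- sg)], by induction: the increment of the right side
    dominates the new term, by [powR_bernoulli] at [1 / m]. *)
Lemma sum_powR_le sg M : 0 < sg < 1 ->
  \sum_(j < M) (1 + j%:R) `^ (- sg) <= M%:R `^ (1 - sg) / (1 - sg) :> R.
Proof.
move=> sg01; have /andP[s0 s1] := sg01; have s1' : 0 < 1 - sg by rewrite subr_gt0.
elim: M => [|M IH]; first by rewrite big_ord0 divr_ge0 ?powR_ge0// ltW.
rewrite big_ord_recr /=; apply: le_trans (lerD IH (lexx _)) _.
rewrite ler_pdivlMr// mulrDl divfK ?gt_eqF//.
have M1 : 0 < 1 + M%:R :> R by rewrite ltr_pwDl.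
have -> : M.+1%:R = 1 + M%:R :> R by rewrite -natr1 addrC.
have -> : (1 + M%:R) `^ (1 - sg) = (1 + M%:R) * (1 + M%:R) `^ (- sg) :> R.
  by rewrite powRD_gt0// powRr1// ltW.
case: M {IH} M1 => [|M] M1.
  by rewrite powR0 ?gt_eqF// addr0 powR1 !mul1r; lra.
set m : R := M.+1%:R; have m0 : 0 < m by rewrite ltr0n.
have -> : m `^ (1 - sg) = m * m `^ (- sg).
  by rewrite powRD_gt0// powRr1// ltW.
suff : m * m `^ (- sg) <= (m + sg) * (1 + m) `^ (- sg) by lra.
have := @powR_bernoulli m^-1 sg; rewrite invr_ge0 (ltW m0) => /(_ isT sg01) h.
have -> : m `^ (- sg) = (1 + m^-1) `^ sg * (1 + m) `^ (- sg).
  have -> : 1 + m^-1 = (1 + m) / m by field; rewrite gt_eqF.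
  rewrite powRM ?invr_ge0 ?ltW// -powR_inv1 ?ltW// -powRrM mulN1r mulrAC -powRD_gt0//.
  by rewrite subrr powRr0 mul1r.
rewrite mulrA ler_wpM2r ?powR_ge0//.
apply: le_trans (ler_wpM2l (ltW m0) h) _.
by rewrite mulrDr mulr1 mulrCA mulfV ?gt_eqF// mulr1.
Qed.

Lemma sum_powR_cut_le sg X M : 0 < sg < 1 -> 0 <= X ->
  \sum_(j < M) (if j%:R <= X then (1 + j%:R) `^ (- sg) else 0)
    <= (1 + X) `^ (1 - sg) / (1 - sg) :> R.
Proof.
move=> sg01 X0; have /andP[s0 s1] := sg01; have s1' : 0 < 1 - sg by rewrite subr_gt0.
elim: M => [|M IH]; first by rewrite big_ord0 divr_ge0 ?powR_ge0// ltW.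
have [MX|XM] := leP M%:R X; last first.
  by rewrite big_ord_recr /= (lt_geF XM) addr0.
apply: le_trans (_ : \sum_(j < M.+1) (1 + j%:R) `^ (- sg) <= _).
  by apply: ler_sum => j _; case: ifP => // _; exact: powR_ge0.
apply: le_trans (sum_powR_le _ sg01) _.
rewrite ler_wpM2r ?invr_ge0 ?(ltW s1')// ge0_ler_powR ?nnegrE ?(ltW s1')//.
  by rewrite addr_ge0.
by rewrite -natr1 addrC lerD2l.
Qed.

Lemma sum_invsq_le M : \sum_(j < M) (1 + (j%:R / 2) ^+ 2)^-1 <= 9 :> R.
Proof.
(* The stronger bound telescopes: [4 / (m + 1 / 2) - 4 / (m + 3 / 2)] equals
   [4 / ((m + 1) ^ 2 - 1 / 4)] and exceeds the new term [4 / (4 + (m + 1) ^ 2)]. Equality for a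
   single term forces [9 = 1 + 8]. *)
have H : \sum_(j < M.+1) (1 + (j%:R / 2) ^+ 2)^-1 <= 9 - 4 / (M%:R + 1 / 2) :> R.
  elim: M => [|M IH]; first by rewrite big_ord1 mul0r expr0n addr0 invr1 add0r div1r invrK; lra.
  rewrite big_ord_recr /=; apply: le_trans (lerD IH (lexx _)) _.
  rewrite -[M.+1%:R]natr1; have := ler0n R M; set m : R := M%:R => m0.
  rewrite -subr_ge0.
  have -> : 9 - 4 / (m + 1 + 1 / 2) - (9 - 4 / (m + 1 / 2) + (1 + ((m + 1) / 2) ^+ 2)^-1)
    = 17 / ((m + 1 / 2) * (m + 1 + 1 / 2) * (4 + (m + 1) ^+ 2)).
    have h1 : m * 2 + 1 != 0 by rewrite gt_eqF//; lra.
    have h2 : (m + 1) * 2 + 1 != 0 by rewrite gt_eqF//; lra.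
    have h3 : 4 + (m + 1) ^+ 2 != 0 by rewrite gt_eqF// ltr_pwDl// sqr_ge0.
    by field; rewrite h1 h2 h3.
  by rewrite divr_ge0// !mulr_ge0 ?addr_ge0 ?sqr_ge0//; lra.
apply: le_trans (_ : \sum_(j < M.+1) (1 + (j%:R / 2) ^+ 2)^-1 <= _).
  by rewrite big_ord_recr /= lerDl invr_ge0 addr_ge0 ?sqr_ge0.
by apply: le_trans H _; rewrite gerBl divr_ge0// addr_ge0.
Qed.

End ShiftedSums.

(** * Large prime divisors of a bounded integer *)

Lemma prod_primes_dvd (s : seq nat) n : uniq s -> all prime s ->
  all (fun q => q %| n)%N s -> (\prod_(q <- s) q %| n)%N.
Proof.
elim: s => [|p s IH]; first by rewrite big_nil dvd1n.
move=> /= /andP[ps us] /andP[pp sp] /andP[pn sn].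
rewrite big_cons Gauss_dvd ?pn ?IH//.
rewrite big_seq; elim/big_ind: _ => [|x y cx cy|q qs]; first exact: coprimen1.
  by rewrite coprimeMr cx.
rewrite prime_coprime// dvdn_prime2//; last exact: (allP sp).
by apply: contraNneq ps => ->.
Qed.

(** The product of the distinct primes dividing [n] divides [n]; with [J + 1] of them, each at least
    [B], it would exceed [n]. *)
Lemma count_prime_divisors (Q : seq nat) B J n : uniq Q -> all prime Q ->
  all (leq B) Q -> (0 < n)%N -> (n < B ^ J.+1)%N ->
  (count (fun q => q %| n)%N Q <= J)%N.
Proof.
move=> uQ pQ BQ n0 nB; rewrite -size_filter; set s := [seq q <- Q | (q %| n)%N].
have sQ : {subset s <= Q} by move=> q; rewrite mem_filter => /andP[].
have := @prod_primes_dvd s n; rewrite filter_uniq// filter_all.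
have -> : all prime s by apply/allP => q /sQ; exact: (allP pQ).
move=> /(_ isT isT isT) /(dvdn_leq n0) pn.
have Bs : (B ^ size s <= \prod_(q <- s) q)%N.
  have : all (leq B) s by apply/allP => q /sQ; exact: (allP BQ).
  elim: (s) => [|q s' IH] /=; first by rewrite big_nil.
  by rewrite big_cons expnS => /andP[Bq /IH]; exact: leq_mul.
have B0 : (0 < B)%N by rewrite lt0n; apply: contraTneq nB => ->; rewrite exp0n.
rewrite leqNgt; apply/negP => Js.
move: nB; rewrite ltnNge => /negP; apply.
by apply: leq_trans pn; apply: leq_trans Bs; rewrite leq_pexp2l.
Qed.

(** * Chebyshev's lower bound for the number of primes *)

Section PrimeCounting.
Local Open Scope nat_scope.
Implicit Types (n p k : nat).

Lemma expn2_le_central_bin n : (2 ^ n <= 'C(n + n, n))%N.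
Proof.
rewrite -binomial.Vandermonde -[2%N]/(1 + 1)%N expnDn; apply: leq_sum => j _.
rewrite !exp1n !muln1 leq_pmulr// bin_gt0; exact: leq_subr.
Qed.

Lemma sum_leq_nat m T : (\sum_(1 <= k < m.+1) (k <= T) <= T)%N.
Proof.
suff : (\sum_(1 <= k < m.+1) (k <= T) <= minn m T)%N by lia.
elim: m => [|m IH]; first by rewrite big_geq.
by rewrite big_nat_recr //=; lia.
Qed.

(** Legendre's formula: the terms [(n + n) %/ p ^ k - 2 (n %/ p ^ k)] are at most [1], and vanish
    once [p ^ k > n + n]. Hence each prime power in the central binomial coefficient is at most
    [n + n]. *)
Lemma logn_central_bin n p : prime p ->
  (logn p 'C(n + n, n) <= trunc_log p (n + n))%N.
Proof.
move=> pp; have p1 := prime_gt1 pp.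
have := bin_fact (leq_addl n n); rewrite addnK => /(congr1 (logn p)).
rewrite !lognM ?muln_gt0 ?fact_gt0 ?bin_gt0 ?leq_addl// !logn_fact//.
have ext : \sum_(1 <= k < n.+1) n %/ p ^ k = \sum_(1 <= k < (n + n).+1) n %/ p ^ k.
  rewrite [RHS](@big_cat_nat _ _ _ n.+1) ?ltnS ?leq_addl//=.
  rewrite [X in (_ = _ + X)%N]big_nat [X in (_ = _ + X)%N]big1 ?addn0// => k /andP[nk _].
  by rewrite divn_small// (leq_trans nk)// ltnW// ltn_expl.
rewrite ext => e.
have le_k : (\sum_(1 <= k < (n + n).+1) (n + n) %/ p ^ k <=
   trunc_log p (n + n) + \sum_(1 <= k < (n + n).+1) n %/ p ^ k
   + \sum_(1 <= k < (n + n).+1) n %/ p ^ k)%N.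
  apply: leq_trans (_ : \sum_(1 <= k < (n + n).+1)
     ((k <= trunc_log p (n + n)) + n %/ p ^ k + n %/ p ^ k) <= _)%N; last first.
    by rewrite !big_split /= !leq_add2r sum_leq_nat.
  apply: leq_sum => k _.
  have [kT|Tk] := leqP k (trunc_log p (n + n)).
    by apply: leq_trans (leq_divDl _ _ _) _; rewrite addn1 add1n.
  by rewrite divn_small// (leq_trans (trunc_log_ltn _ p1))// leq_pexp2l// ltnW.
by move: le_k; rewrite -e; lia.
Qed.

Lemma expn2_le_primes n : (0 < n)%N ->
  (2 ^ n <= (n + n) ^ size [seq p <- iota 0 (n + n).+1 | prime p])%N.
Proof.
move=> n0; apply: leq_trans (expn2_le_central_bin n) _.
have C0 : (0 < 'C(n + n, n))%N by rewrite bin_gt0 leq_addl.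
have nn0 : (0 < n + n)%N by rewrite addn_gt0 n0.
apply: leq_trans (_ : (n + n) ^ size (primes 'C(n + n, n)) <= _)%N.
  rewrite {1}(prod_prime_decomp C0) prime_decompE big_map /=.
  have : all prime (primes 'C(n + n, n)).
    by apply/allP => p; rewrite mem_primes => /andP[].
  elim: (primes _) => [|p s IH]; first by rewrite big_nil.
  rewrite big_cons /= expnS => /andP[pp ps]; apply: leq_mul; last exact: IH.
  apply: leq_trans (_ : p ^ trunc_log p (n + n) <= _)%N.
    by rewrite leq_exp2l ?prime_gt1// logn_central_bin.
  by rewrite trunc_logP// prime_gt1.
rewrite leq_pexp2l// uniq_leq_size ?primes_uniq// => p.
rewrite mem_primes mem_filter mem_iota => /and3P[pp _ pC]; rewrite pp /= add0n ltnS.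
have : (p %| (n + n)`!)%N.
  have := bin_fact (leq_addl n n); rewrite addnK => <-.
  by rewrite dvdn_mulr.
rewrite -[p in (p %| _)%N]expn1 pfactor_dvdn ?fact_gt0// logn_fact//.
apply: contraTT; rewrite -ltnNge -leqNgt => np; rewrite leqn0.
rewrite big_nat big1// => k /andP[k1 _]; rewrite divn_small//.
by apply: leq_trans np _; rewrite -[X in (X <= _)%N]expn1 leq_pexp2l// prime_gt0.
Qed.

End PrimeCounting.

(** * Primes between [y ^ (1 - e)] and [y] *)

Section PrimeCountingReal.
Context {R : realType}.
Implicit Types (y e a C : R).

Lemma near_powR_ge a C : 0 < a -> \forall y \near +oo, C <= y `^ a.
Proof.
move=> a0; have C1 : 0 < Num.max C 1 by rewrite lt_max ltr01 orbT.
near=> y; apply: le_trans (_ : Num.max C 1 <= _); first by rewrite le_max lexx.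
have -> : Num.max C 1 = (Num.max C 1 `^ a^-1) `^ a.
  by rewrite -powRrM mulVf ?gt_eqF// powRr1// ltW.
have h : Num.max C 1 `^ a^-1 <= y by near: y; exact: nbhs_pinfty_ge.
have y0 : 0 <= y by apply: le_trans h; exact: powR_ge0.
by rewrite ge0_ler_powR ?nnegrE ?powR_ge0 ?(ltW a0).
Unshelve. all: by end_near. Qed.

Lemma ln_le_powR a y : 0 < a -> 0 < y -> ln y <= y `^ a / a.
Proof.
move=> a0 y0; rewrite ler_pdivlMr// mulrC -ln_powR.
exact/ltW/ln_sublinear/powR_gt0.
Qed.

Definition primes_in y e : seq nat :=
  [seq p <- iota 0 (Num.truncn y).+1 | prime p && (y `^ (1 - e) < p%:R)].

Lemma primes_inP y e p : 0 <= y -> p \in primes_in y e ->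
  [/\ prime p, y `^ (1 - e) < p%:R & p%:R <= y].
Proof.
move=> y0; rewrite mem_filter mem_iota add0n ltnS => /andP[/andP[pp yp] py].
by split=> //; apply: le_trans (_ : (Num.truncn y)%:R <= _);
  rewrite ?ler_nat// truncn_le.
Qed.

Lemma primes_in_uniq y e : uniq (primes_in y e).
Proof. by rewrite filter_uniq// iota_uniq. Qed.

(** By Chebyshev there are at least [(y / 4) ln 2 / ln y] primes up to [y], and at most
    [z = y ^ (1 - e)] of them are too small. Since [ln y <= y ^ (e / 2) / (e / 2)], the total is at
    least [z y ^ (e / 2) e ln 2 / 8], which the constant [16] turns into [2 z]. *)
Lemma size_primes_in_ge y e : 4 <= y -> 0 < e < 1 ->
  16 / (ln 2 * e) <= y `^ (e / 2) ->
  y `^ (1 - e) <= (size (primes_in y e))%:R.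
Proof.
move=> y4 /andP[e0 e1] ye; have y0 : 0 < y by lra.
set z := y `^ (1 - e); set S := (size _)%:R.
set m := Num.truncn y; set n := m./2.
have l2 : 0 < ln 2 :> R by rewrite ln_gt0// ltr1n.
have my : m%:R <= y by rewrite truncn_le ltW.
have ym : y < m.+1%:R by exact: truncnS_gt.
have nm : (n + n <= m)%N by rewrite addnn /n; lia.
have mn : (m <= n + n + 1)%N by rewrite addnn /n; lia.
have n0 : (0 < n)%N.
  have : 3%:R < m.+1%:R :> R by lra.
  by rewrite ltr_nat; lia.
set P := [seq p <- iota 0 m.+1 | prime p].
have PS : (size P)%:R <= S + z.
  have -> : size P = (size (primes_in y e) + size [seq p <- P | ~~ (z < p%:R)%R])%N.
    rewrite -(count_predC (fun p => z < p%:R) P) -size_filter /P -filter_predI.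
    congr (_ + _)%N; last by rewrite -size_filter.
    by congr size; apply: eq_filter => p /=; rewrite andbC.
  rewrite natrD lerD2l.
  have z0 : 0 <= z by exact: powR_ge0.
  apply: le_trans (_ : (Num.truncn z)%:R <= _); last by rewrite truncn_le.
  rewrite ler_nat -(size_iota 1 (Num.truncn z)) uniq_leq_size ?filter_uniq ?iota_uniq//.
  move=> p; rewrite !mem_filter -leNgt !mem_iota => /and3P[pz pp _].
  rewrite (prime_gt0 pp) add1n ltnS /=.
  have : p%:R < (Num.truncn z).+1%:R :> R by apply: le_lt_trans pz _; exact: truncnS_gt.
  by rewrite ltr_nat ltnS.
have key : (y / 4) * ln 2 <= (S + z) * ln y.
  have := expn2_le_primes n0.
  have sP : (size [seq p <- iota 0 (n + n).+1 | prime p] <= size P)%N.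
    apply: uniq_leq_size; first by rewrite filter_uniq// iota_uniq.
    move=> p; rewrite !mem_filter !mem_iota !add0n !ltnS => /andP[-> /=].
    by move=> /leq_trans; exact.
  move=> h; have {h} h : (2 ^ n <= m ^ size P)%N.
    apply: leq_trans h _; apply: leq_trans (_ : (n + n) ^ size P <= _)%N.
      by rewrite leq_pexp2l// addn_gt0 n0.
    have P0 : (0 < size P)%N.
      rewrite -has_predT; apply/hasP; exists 2; last by [].
      by rewrite mem_filter mem_iota /=; clear -n0 nm; lia.
    by rewrite leq_exp2r.
  have {h} h : n%:R * ln 2 <= (size P)%:R * ln y.
    rewrite !mulr_natl -!lnXn//.
    have mP : 0 < m%:R ^+ size P :> R by rewrite exprn_gt0// ltr0n; clear -n0 nm; lia.
    have hR : 2 ^+ n <= m%:R ^+ size P :> R by rewrite -!natrX ler_nat.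
    rewrite ler_ln ?posrE ?exprn_gt0//.
    by apply: le_trans hR _; rewrite lerXn2r ?nnegrE ?(ltW y0).
  apply: le_trans (le_trans h _); last first.
    by rewrite ler_wpM2r// ln_ge0//; lra.
  rewrite ler_wpM2r ?(ltW l2)//.
  have : m%:R <= (n + n + 1)%:R :> R by rewrite ler_nat.
  rewrite !natrD => mn'; move: ym; rewrite -natr1 => ym'; lra.
have key2 : (S + z) * ln y <= (S + z) * (y `^ (e / 2) / (e / 2)).
  rewrite ler_wpM2l ?addr_ge0 ?powR_ge0//; apply: ln_le_powR => //; lra.
have yE : y = y `^ (e / 2) * (y `^ (e / 2) * z).
  rewrite -!powRD_gt0//.
  have -> : e / 2 + (e / 2 + (1 - e)) = 1 by field.
  by rewrite powRr1// ltW.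
set w := y `^ (e / 2) in ye key2 yE.
have w0 : 0 < w by exact: powR_gt0.
have : w * (y `^ (e / 2) * z / 4 * ln 2) <= w * ((S + z) / (e / 2)).
  rewrite -/w; have := le_trans key key2; rewrite {1}yE; lra.
rewrite ler_pM2l// => h; move: ye.
rewrite -/w ler_pdivrMr ?mulr_gt0// => ye.
have z0 : 0 <= z by exact: powR_ge0.
have : w * z / 4 * ln 2 * (e / 2) <= S + z by rewrite -ler_pdivlMr// divr_gt0.
have := ler_wpM2r z0 ye; lra.
Qed.

End PrimeCountingReal.

(** * Limits along ultrafilters *)

Section UltraLimit.
Context {R : realType} (U : set_system nat) {UU : UltraFilter U}.

Lemma ultra_bounded_cvg (u : nat -> R) (B : R) :
  (forall k, `|u k| <= B) -> exists l : R, u @ U --> l.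
Proof.
move=> uB; have UP : ProperFilter U by exact: ultra_proper.
have [l [_ ul]] : `[- B, B] `&` cluster (u @ U) !=set0.
  apply: segment_compact; apply: nearW => k /=.
  by rewrite in_itv /= -ler_norml.
exists l => A Al; have [//|nA] := in_ultra_setVsetC (u @^-1` A) UU.
have [x [/= nAx Ax]] := ul (~` A) A nA Al.
by [].
Qed.

End UltraLimit.

(** * Riemann-Stieltjes sums and integrals *)

Section RiemannStieltjes.
Context {R : realType}.
Implicit Types (g H Phi : R -> R) (y : nat -> R).

(** Summation by parts moves the differences onto [g]. Here [Psi] will be the gap between a monotone
    function and its right-continuous version: possibly large at a jump, but summable, so the
    subdivision need not consist of continuity points. *)
Lemma abel_bound g y (Psi : nat -> R) (D : nat -> R) (e : R) n :
  Psi 0%N = 0 -> Psi n = 0 ->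
  (forall i, 0 <= Psi i <= D i.+1 - D i) ->
  (forall i, `|g (y i.+1) - g (y i)| <= e) ->
  `|\sum_(i < n) g (y i) * (Psi i.+1 - Psi i)| <= e * (D n - D 0%N).
Proof.
move=> P0 Pn hPsi hg.
have E m : \sum_(i < m) g (y i) * (Psi i.+1 - Psi i) =
    g (y m) * Psi m - \sum_(i < m) (g (y i.+1) - g (y i)) * Psi i.+1.
  elim: m => [|m IH]; first by rewrite !big_ord0 P0 mulr0 subrr.
  by rewrite !big_ord_recr /= IH; ring.
have e0 : 0 <= e by apply: le_trans (hg 0%N).
rewrite E Pn mulr0 sub0r normrN; case: n Pn => [|n] Pn.
  by rewrite big_ord0 normr0 subrr mulr0.
rewrite big_ord_recr /= Pn mulr0 addr0.
apply: le_trans (ler_norm_sum _ _ _) _.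
apply: le_trans (_ : \sum_(i < n) e * (D i.+2 - D i.+1) <= _).
  apply: ler_sum => i _; have /andP[p0 pD] := hPsi i.+1.
  by rewrite normrM ler_pM// ger0_norm.
rewrite -mulr_sumr ler_wpM2l//.
have -> : \sum_(i < n) (D i.+2 - D i.+1) = D n.+1 - D 1%N.
  elim: n {Pn} => [|n IH]; first by rewrite big_ord0 subrr.
  by rewrite big_ord_recr /= IH; ring.
by rewrite lerD2l lerN2; have /andP[p0 pD] := hPsi 0%N; lra.
Qed.

Lemma atom_stieltjes g y (e c : R) n :
  (forall i, y i <= y i.+1) ->
  (forall i x, y i < x <= y i.+1 -> `|g x - g (y i)| <= e) ->
  `|(if y 0%N < c <= y n then g c else 0)
    - \sum_(i < n) g (y i) * ((c <= y i.+1)%R%:R - (c <= y i)%R%:R)|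
   <= e * (y 0%N < c <= y n)%R%:R.
Proof.
move=> yi hg; elim: n => [|n IH].
  rewrite big_ord0 subr0; case: ifP => [/andP[h1 h2]|_].
    by move: (lt_le_trans h1 h2); rewrite ltxx.
  by rewrite normr0 mulr0.
have y0n : y 0%N <= y n by elim: n {IH} => // n; move/le_trans; exact.
rewrite big_ord_recr /=; move: IH; set S := \sum_(i < n) _.
have [h0|h0] := leP c (y 0%N); rewrite /= ?(le_gtF h0) ?h0 /=.
  have cn := le_trans h0 y0n; rewrite cn (le_trans cn (yi n)) subrr !mulr0 addr0.
  by [].
have [hn|hn] /= := leP c (y n).
  by rewrite (le_trans hn (yi n)) subrr mulr0 addr0.
rewrite mulr0 sub0r normrN normr_le0 => /eqP ->; rewrite add0r.
have [hn1|hn1] /= := leP c (y n.+1); last by rewrite subrr !mulr0 subrr normr0.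
by rewrite subr0 !mulr1; apply: hg; rewrite hn.
Qed.

End RiemannStieltjes.

Section StieltjesMeasure.
Context {R : realType}.
Implicit Types (H : cumulative R R) (g : R -> R) (y : nat -> R).
Local Notation lsm := lebesgue_stieltjes_measure.

Lemma stieltjes_itv H a b : a <= b -> lsm H `]a, b]%classic = (H b - H a)%:E.
Proof.
move=> ab; rewrite /lsm /measure_extension measurable_mu_extE/=; last exact: is_ocitv.
by rewrite wlength_itv_bnd.
Qed.

Lemma stieltjes_setT H (m a b : R) : a <= 0 -> 0 <= b ->
  (forall x, x <= a -> H x = 0) -> (forall x, b <= x -> H x = m) ->
  lsm H setT = m%:E.
Proof.
move=> a0 b0 H0 Hm; rewrite -(bigcup_itvT false false).
pose I n : set R := `]- (n%:R), n%:R]%classic.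
have h1 : (lsm H \o I) n @[n --> \oo] --> lsm H (\bigcup_n I n).
  apply: nondecreasing_cvg_mu; rewrite /I//; first exact: bigcup_measurable.
  by move=> *; apply/subsetPset/subset_itv; rewrite leBSide/= ?lerN2 ler_nat.
have h2 : (lsm H \o I) n @[n --> \oo] --> m%:E.
  apply: cvg_near_cst; exists (maxn (Num.truncn (- a)).+1 (Num.truncn b).+1) => // n /=.
  rewrite geq_max => /andP[na nb].
  have hb : b <= n%:R.
    by apply: ltW; apply: lt_le_trans (truncnS_gt _) _; rewrite ler_nat.
  have ha : - n%:R <= a.
    by rewrite lerNl; apply: ltW; apply: lt_le_trans (truncnS_gt _) _; rewrite ler_nat.
  rewrite /I stieltjes_itv ?(H0 _ ha) ?(Hm _ hb) ?subr0//.
  by rewrite (le_trans (le_trans ha a0))// (le_trans b0 hb).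
exact: cvg_unique h1 h2.
Qed.

Lemma Rintegral_stieltjes_le H g y (e : R) n :
  (lsm H).-integrable setT (EFin \o g) ->
  (forall i, y i <= y i.+1) ->
  (forall i x, y i < x <= y i.+1 -> `|g x - g (y i)| <= e) ->
  `|\int[lsm H]_(x in `]y 0%N, y n]) g x
    - \sum_(i < n) g (y i) * (H (y i.+1) - H (y i))| <= e * (H (y n) - H (y 0%N)).
Proof.
move=> ig yi hg.
have igS (D : set R) : measurable D -> (lsm H).-integrable D (EFin \o g).
  by move=> mD; apply: integrableS ig.
elim: n => [|n IH].
  by rewrite big_ord0 subr0 set_itvxx Rintegral_set0 normr0 subrr mulr0.
have y0n : y 0%N <= y n by elim: n {IH} => // n; move/le_trans; exact.
have -> : `]y 0%N, y n.+1]%classic = `]y 0%N, y n]%classic `|` `]y n, y n.+1]%classic.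
  by rewrite -itv_bndbnd_setU// bnd_simp.
have disj : [disjoint `]y 0%N, y n]%classic & `]y n, y n.+1]%classic].
  apply/disj_set2P; rewrite -subset0 => x /= []; rewrite !in_itv /=.
  by move=> /andP[_ xn] /andP[nx _]; move: (lt_le_trans nx xn); rewrite ltxx.
rewrite Rintegral_setU//; last exact: igS (measurableU _ _ _ _).
rewrite big_ord_recr /=.
have cell : `|\int[lsm H]_(x in `]y n, y n.+1]) g x - g (y n) * (H (y n.+1) - H (y n))|
   <= e * (H (y n.+1) - H (y n)).
  have mc : lsm H `]y n, y n.+1]%classic = (H (y n.+1) - H (y n))%:E by rewrite stieltjes_itv.
  have <- : \int[lsm H]_(x in `]y n, y n.+1]) (g (y n)) = g (y n) * (H (y n.+1) - H (y n)).
    by rewrite Rintegral_cst//; exact: (congr1 (fun z => g (y n) * fine z) mc).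
  have ic (c : R) : (lsm H).-integrable `]y n, y n.+1]%classic (EFin \o (fun=> c)).
    apply: measurable_bounded_integrable => //.
      by apply: le_lt_trans (_ : (H (y n.+1) - H (y n))%:E < +oo)%E;
        [rewrite -mc|exact: ltry].
    exact: bounded_cst.
  rewrite -RintegralB//; last exact: igS.
  have id : (lsm H).-integrable `]y n, y n.+1]%classic (EFin \o (fun x => g x - g (y n))).
    have mI : measurable (`]y n, y n.+1]%classic : set (measurableTypeR R)) by [].
    have h := integrableB mI (igS _ mI) (ic (g (y n))).
    by apply: eq_integrable h.
  apply: le_trans (le_normr_Rintegral _ id) _ => //.
  have <- : \int[lsm H]_(x in `]y n, y n.+1]) e = e * (H (y n.+1) - H (y n)).
    by rewrite Rintegral_cst//; exact: (congr1 (fun z => e * fine z) mc).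
  apply: le_Rintegral => //.
    exact: integrable_norm id.
  by move=> x /=; rewrite in_itv /= => xin; exact: hg.
rewrite (_ : e * _ = e * (H (y n) - H (y 0%N)) + e * (H (y n.+1) - H (y n))); last by ring.
rewrite opprD addrACA; apply: le_trans (ler_normD _ _) _; exact: lerD.
Qed.

End StieltjesMeasure.

(** * Helly's selection theorem *)

Section Helly.
Context {R : realType}.

(** For monotone [Phi] this is the right limit; a pointwise limit of distribution functions need not
    be right-continuous. *)
Definition stieltjes_reg (Phi : R -> R) (x : R) : R := inf [set Phi y | y in [set y | x < y]].

Section Regularization.
Variables (Phi : R -> R) (Phi_nd : nondecreasing Phi).

Let has_lb x : has_lbound [set Phi y | y in [set y | x < y]].
Proof. by exists (Phi x) => _ [y /= xy <-]; apply: Phi_nd; exact: ltW. Qed.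

Let nonempty_up x : [set Phi y | y in [set y | x < y]] !=set0.
Proof. by exists (Phi (x + 1)), (x + 1) => //=; rewrite ltrDl. Qed.

Lemma stieltjes_reg_ge x : Phi x <= stieltjes_reg Phi x.
Proof.
apply: lb_le_inf => // _ [y /= xy <-]; apply: Phi_nd; exact: ltW.
Qed.

Lemma stieltjes_reg_le x y : x < y -> stieltjes_reg Phi x <= Phi y.
Proof. by move=> xy; apply: ge_inf => //; exists y. Qed.

Lemma stieltjes_reg_nd : nondecreasing (stieltjes_reg Phi).
Proof.
move=> x y; rewrite le_eqVlt => /predU1P[->//|xy].
by apply: le_trans (stieltjes_reg_le xy) (stieltjes_reg_ge _).
Qed.

Lemma stieltjes_reg_rc : right_continuous (stieltjes_reg Phi).
Proof.
move=> x; apply/cvgrPdist_le => e e0.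
have [_ [y /= xy <-] hy] := inf_adherent e0 (conj (nonempty_up x) (has_lb x)).
near=> z.
have xz : x < z by near: z; exact: nbhs_right_gt.
have zy : z < y by near: z; exact: nbhs_right_lt.
have h1 := stieltjes_reg_le zy; have h2 := stieltjes_reg_nd (ltW xz).
rewrite distrC ger0_norm ?subr_ge0//.
by move: hy; rewrite -/(stieltjes_reg Phi x); lra.
Unshelve. all: by end_near. Qed.

End Regularization.

(* Limits along an ultrafilter replace the extraction of a convergent subsequence. *)
Lemma helly (nu : nat -> seq (R * R)) (C : R) :
  (forall k p, p \in nu k -> 0 <= p.1 /\ 0 <= p.2 <= 1) ->
  (forall k, \sum_(p <- nu k) p.1 <= C) ->
  exists (mu : {measure set (measurableTypeR R) -> \bar R}) (U : set_system nat),
    [/\ ProperFilter U, \oo `<=` U, (mu setT < +oo)%E &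
     forall (g : R -> R) (B L : R), (forall x, `|g x| <= B) ->
       (forall x y, `|g x - g y| <= L * `|x - y|) ->
       mu.-integrable setT (EFin \o g) /\
       (fun k => \sum_(p <- nu k) p.1 * g p.2) @ U
         --> (\int[mu]_(x in setT) g x)%R].
Proof.
move=> hnu hC.
have C0 : 0 <= C.
  by apply: le_trans (hC 0%N); rewrite big_seq sumr_ge0// => p /hnu[].
have [U [UU oU]] := @ultraFilterLemma nat \oo _.
have UP : ProperFilter U by exact: ultra_proper.
pose F k x : R := \sum_(p <- nu k) p.1 * (p.2 <= x)%R%:R.
have FC k x : `|F k x| <= C.
  rewrite ger0_norm; last first.
    by rewrite /F big_seq sumr_ge0// => p /hnu[p0 _]; rewrite mulr_ge0.
  apply: le_trans (hC k); rewrite /F big_seq [leRHS]big_seq; apply: ler_sum => p /hnu[p0 _].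
  by rewrite ler_piMr// (ler_nat _ _ 1) leq_b1.
have /choice[Phi hPhi] : forall x, exists l : R, (F ^~ x) @ U --> l.
  by move=> x; apply: (@ultra_bounded_cvg R U UU _ C) => k; exact: FC.
have Fnd k : nondecreasing (F k).
  move=> x y xy; rewrite /F big_seq [leRHS]big_seq; apply: ler_sum => p /hnu[p0 _].
  rewrite ler_wpM2l// ler_nat; case: (boolP (p.2 <= x)) => // px.
  by rewrite (le_trans px xy).
have Phi_nd : nondecreasing Phi.
  by move=> x y xy; apply: (ler_cvg_to (hPhi x) (hPhi y)); apply: nearW => k; exact: Fnd.
have Phi0 x : x < 0 -> Phi x = 0.
  move=> x0; apply: (cvg_unique _ (hPhi x)) => //.
  apply: cvg_near_cst; apply: nearW => k; rewrite /F big_seq big1// => p /hnu[_ /andP[p0 _]].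
  by rewrite leNgt (lt_le_trans x0 p0) mulr0.
have Phi1 x : 1 <= x -> Phi x = Phi 1.
  move=> x1; apply: (cvg_unique _ (hPhi x)) => //.
  suff -> : F ^~ x = F ^~ 1 by exact: hPhi.
  apply/funext => k; rewrite /F big_seq [RHS]big_seq; apply: eq_bigr => p.
  by move=> /hnu[_ /andP[_ p1]]; rewrite p1 (le_trans p1 x1).
pose H : cumulative R R := HB.pack (stieltjes_reg Phi)
  (isCumulative.Build R _ R (stieltjes_reg Phi) (stieltjes_reg_nd Phi_nd) (stieltjes_reg_rc Phi_nd)).
have H0 x : x <= - 1 -> H x = 0.
  move=> x1; apply/le_anti/andP; split.
    have xh : x < - (1 / 2) by lra.
    by apply: le_trans (stieltjes_reg_le Phi_nd xh) _; rewrite Phi0//; lra.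
  by apply: le_trans (stieltjes_reg_ge Phi_nd x); rewrite Phi0//; lra.
have H1 x : 1 <= x -> H x = Phi 1.
  move=> x1; apply/le_anti/andP; split.
    have xh : x < x + 1 by lra.
    by apply: le_trans (stieltjes_reg_le Phi_nd xh) _; rewrite Phi1//; lra.
  by apply: le_trans (stieltjes_reg_ge Phi_nd x); rewrite Phi1.
have muT : lebesgue_stieltjes_measure H setT = (Phi 1)%:E.
  by apply: (@stieltjes_setT _ H (Phi 1) (- 1) 1) => //; lra.
exists (lebesgue_stieltjes_measure H), U; split => //.
  by rewrite [X in (X < _)%E]muT ltry.
move=> g B L gB gL.
have L0 : 0 <= L.
  by have := gL 1 0; rewrite subr0 normr1 mulr1; exact: le_trans.
have cg : continuous g.
  move=> x; apply/cvgrPdist_le => e e0; near=> y.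
  apply: le_trans (gL _ _) _; apply: le_trans (_ : (L + 1) * `|x - y| <= _).
    by rewrite ler_wpM2r//; lra.
  rewrite -ler_pdivlMl; last lra.
  have : `|x - y| < (L + 1)^-1 * e; last exact: ltW.
  by near: y; apply: cvgr_dist_lt => //; rewrite mulr_gt0// invr_gt0; lra.
have ig : (lebesgue_stieltjes_measure H).-integrable setT (EFin \o g).
  apply: measurable_bounded_integrable => //.
  - by rewrite [X in (X < _)%E]muT ltry.
  - exact: measurable_realfun.continuous_measurable_fun.
  - by exists B; split; [exact: num_real|move=> b Bb x _; exact: le_trans (ltW Bb)].
split => //.
pose Lam k := \sum_(p <- nu k) p.1 * g p.2.
have LamB k : `|Lam k| <= C * B.
  have B0 : 0 <= B by exact: le_trans (gB 0).
  apply: le_trans (ler_norm_sum _ _ _) _.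
  apply: le_trans (_ : \sum_(p <- nu k) p.1 * B <= _); last first.
    by rewrite -mulr_suml ler_wpM2r.
  rewrite big_seq [leRHS]big_seq; apply: ler_sum => p /hnu[p0 _].
  by rewrite normrM ger0_norm// ler_wpM2l.
have [l hl] := @ultra_bounded_cvg R U UU Lam _ LamB.
suff -> : \int[lebesgue_stieltjes_measure H]_(x in setT) g x = l by exact: hl.
set I := (\int[_]_(x in _) _).
apply/eqP; rewrite -subr_eq0 -normr_le0; apply/ler_addgt0Pr => e e0; rewrite add0r.
(* The segment [[-1, 2]] is cut into [n] cells of length [3 / n]. The comparisons [s1], [s2], [s3]
   below each cost [L h C = 3 L C / n]. *)
pose n := (Num.truncn (9 * L * C / e)).+1.
have n0 : 0 < n%:R :> R by rewrite ltr0n.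
pose h : R := 3 / n%:R; have h0 : 0 < h by rewrite divr_gt0.
pose y i : R := - 1 + i%:R * h.
pose d := L * h.
have d3 : 3 * (d * C) <= e.
  have : 9 * L * C / e < n%:R by exact: truncnS_gt.
  rewrite ltr_pdivrMr// => hh.
  rewrite /d /h (_ : 3 * (L * (3 / n%:R) * C) = 9 * L * C / n%:R); last by ring.
  by rewrite ler_pdivrMr//; lra.
have yS i : y i.+1 = y i + h by rewrite /y -natr1; ring.
have ylt i : y i < y i.+1 by rewrite yS ltrDl.
have yi i : y i <= y i.+1 by exact: ltW.
have y0 : y 0%N = - 1 by rewrite /y mul0r addr0.
have yn : y n = 2 by rewrite /y /h; field; rewrite gt_eqF.
have gy i x : y i < x <= y i.+1 -> `|g x - g (y i)| <= d.
  case/andP => x1 x2; apply: le_trans (gL _ _) _; rewrite ler_wpM2l//.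
  by rewrite ger0_norm ?subr_ge0 ?(ltW x1)//; move: x2; rewrite yS; lra.
have d0 : 0 <= d by rewrite mulr_ge0// ltW.
have PhiC x : 0 <= Phi x <= C.
  apply/andP; split.
    apply: (cvgr_to_ge (hPhi x)); apply: nearW => k.
    by rewrite /F big_seq sumr_ge0// => p /hnu[p0 _]; rewrite mulr_ge0.
  by apply: (cvgr_to_le (hPhi x)); apply: nearW => k; apply: le_trans (FC k x); exact: ler_norm.
pose SP := \sum_(i < n) g (y i) * (Phi (y i.+1) - Phi (y i)).
pose SH := \sum_(i < n) g (y i) * (H (y i.+1) - H (y i)).
have s1 : `|I - SH| <= d * C.
  have := Rintegral_stieltjes_le n ig yi gy; rewrite y0 yn (H0 (- 1))// (H1 2) ?subr0; last lra.
  have -> : \int[lebesgue_stieltjes_measure H]_(x in `]-1, 2]) g x = I.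
    pose D := `]-1, 2]%classic : set (measurableTypeR R).
    have mD : measurable D by exact: measurable_itv.
    have muD : lebesgue_stieltjes_measure H (~` D) = 0%E.
      have fD : (lebesgue_stieltjes_measure H setT < +oo)%E.
        by rewrite [X in (X < _)%E]muT ltry.
      have := @measureD _ _ _ (lebesgue_stieltjes_measure H) _ _ measurableT mD fD.
      rewrite setTD setTI [X in (_ = X - _)%E]muT.
      rewrite [X in (_ = _ - X)%E]stieltjes_itv; last by lra.
      by rewrite (H1 2) ?(H0 (- 1)) ?subr0 -?EFinB ?subrr//; lra.
    rewrite /I /Rintegral (negligible_integral (measurableC mD) measurableT ig muD).
    by rewrite setTD setCK.
  move=> /le_trans; apply; rewrite ler_wpM2l//.
  by have /andP[] := PhiC 1.
have s2 : `|SH - SP| <= d * C.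
  pose Psi i := H (y i) - Phi (y i).
  have -> : SH - SP = \sum_(i < n) g (y i) * (Psi i.+1 - Psi i).
    by rewrite -sumrB; apply: eq_bigr => i _; rewrite /Psi; ring.
  apply: le_trans (@abel_bound R g y Psi (fun i => Phi (y i)) d n _ _ _ _) _.
  - by rewrite /Psi y0 H0// Phi0 ?subrr//; lra.
  - by rewrite /Psi yn H1 ?Phi1 ?subrr//; lra.
  - move=> i; rewrite /Psi subr_ge0 (stieltjes_reg_ge Phi_nd (y i)) lerD2r.
    exact: (stieltjes_reg_le Phi_nd (ylt i)).
  - by move=> i; apply: gy; rewrite ylt lexx.
  rewrite ler_wpM2l// yn y0 (Phi1 2) ?(Phi0 (- 1)) ?subr0; [|lra..].
  by have /andP[] := PhiC 1.
have s3 : `|l - SP| <= d * C.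
  pose SF k := \sum_(i < n) g (y i) * (F k (y i.+1) - F k (y i)).
  have hSF : SF @ U --> SP.
    by apply: cvg_sum_seq_in => i _; apply: cvgMr; apply: cvgB; exact: hPhi.
  have hn : (fun k => `|Lam k - SF k|) @ U --> `|l - SP|.
    by apply: cvg_norm; apply: cvgB.
  apply: (cvgr_to_le hn); apply: nearW => k.
  have -> : SF k = \sum_(p <- nu k) p.1 * \sum_(i < n) g (y i) *
      ((p.2 <= y i.+1)%R%:R - (p.2 <= y i)%R%:R).
    under [RHS]eq_bigr do rewrite mulr_sumr.
    rewrite exchange_big /=; apply: eq_bigr => i _.
    rewrite /F -sumrB mulr_sumr; apply: eq_bigr => p _; ring.
  rewrite /Lam -sumrB; apply: le_trans (ler_norm_sum _ _ _) _.
  apply: le_trans (_ : \sum_(p <- nu k) p.1 * d <= _); last first.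
    by rewrite -mulr_suml mulrC ler_wpM2l.
  rewrite big_seq [leRHS]big_seq; apply: ler_sum => p /hnu[p0 /andP[p20 p21]].
  rewrite -mulrBr normrM (ger0_norm p0) ler_wpM2l//.
  have := atom_stieltjes p.2 n yi gy; rewrite y0 yn.
  have -> : - 1 < p.2 <= 2 by apply/andP; split; lra.
  by rewrite mulr1.
have -> : I - l = (I - SH) + (SH - SP) - (l - SP) by ring.
apply: le_trans (ler_normB _ _) _; have := ler_normD (I - SH) (SH - SP); lra.
Unshelve. all: by end_near.
Qed.

End Helly.

(** * One step of the construction: effect on mass and transform *)

Section Step.
Context {R : realType}.
Implicit Types (L : seq (R * R)) (xi a d theta sg X D Z : R) (Q : seq nat).
Variable N : nat.

Definition mass L : R := \sum_(p <- L) p.1.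

(* Atoms of zero weight are dropped so that [next_atoms] stays close to the atoms of [L]. *)
Definition next_atoms d L theta Q (off : nat -> R) : seq (R * R) :=
  [seq p <- [seq (dens N d L (grid theta q r) / q%:R / (size Q)%:R,
                  grid theta q r + off q) | q <- Q, r <- iota 0 q] | p.1 != 0].

Lemma sum_next_atoms d L theta Q off (g : R -> R) :
  \sum_(p <- next_atoms d L theta Q off) p.1 * g p.2 =
  (size Q)%:R^-1 * \sum_(q <- Q) q%:R^-1 * \sum_(r < q)
     dens N d L (grid theta q r) * g (grid theta q r + off q).
Proof.
rewrite /next_atoms big_filter big_mkcond /=.
rewrite (eq_bigr (fun p => p.1 * g p.2)); last first.
  by move=> p _; case: ifPn => // /negbNE/eqP ->; rewrite mul0r.
rewrite big_allpairs_dep /= mulr_sumr; apply: eq_bigr => q _.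
have -> : iota 0 q = index_iota 0 q by rewrite /index_iota subn0.
rewrite big_mkord !mulr_sumr.
by apply: eq_bigr => r _; ring.
Qed.

Lemma trig_next d L theta Q off xi a :
  trig (next_atoms d L theta Q off) xi a =
  (size Q)%:R^-1 * \sum_(q <- Q) q%:R^-1 * \sum_(r < q)
     dens N d L (grid theta q r)
     * cos (2 * pi * xi * grid theta q r + (a + 2 * pi * xi * off q)).
Proof.
rewrite /trig (sum_next_atoms d L theta Q off (fun x => cos (2 * pi * xi * x + a))).
congr (_ * _); apply: eq_bigr => q _; congr (_ * _); apply: eq_bigr => r _.
by congr (_ * cos _); ring.
Qed.

Lemma mass_trig L : mass L = trig L 0 0.
Proof.
by apply: eq_bigr => p _; rewrite mulr0 mul0r addr0 cos0 mulr1.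
Qed.

Lemma densT_mass d L : densT N d L 0 0 = mass L.
Proof.
rewrite /densT /mass mulr0 mul0r (eq_bigr (fun p => p.1 * oscW N.+1)) => [|p _].
  by rewrite -mulr_suml mulfK// gt_eqF// oscW_gt0.
by rewrite mul0r addr0.
Qed.

Lemma powRN_le x y sg : 0 < x -> x <= y -> 0 <= sg -> y `^ (- sg) <= x `^ (- sg).
Proof.
move=> x0 xy sg0; have y0 := lt_le_trans x0 xy.
rewrite !powRN lef_pV2 ?posrE ?powR_gt0//.
by rewrite ge0_ler_powR ?nnegrE ?(ltW x0) ?(ltW y0).
Qed.

Lemma sum_cut_half_le sg X M : 0 < sg < 1 -> 0 <= X ->
  \sum_(j < M) (if j%:R / 2 <= X then (1 + j%:R / 2) `^ (- sg) else 0)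
    <= 2 * (1 + 2 * X) `^ (1 - sg) / (1 - sg) :> R.
Proof.
move=> sg01 X0; have /andP[s0 s1] := sg01.
have X20 : 0 <= 2 * X by rewrite mulr_ge0.
rewrite -mulrA; apply: le_trans (ler_wpM2l _ (sum_powR_cut_le M sg01 X20)) => //.
rewrite mulr_sumr; apply: ler_sum => j _.
rewrite ler_pdivrMr// [X * 2]mulrC; case: ifP => _; last by rewrite mulr0.
have j0 : 0 <= j%:R :> R by [].
apply: le_trans (_ : ((1 + j%:R) / 2) `^ (- sg) <= _).
  by apply: powRN_le; [lra|lra|exact: ltW].
rewrite powRM ?addr_ge0 ?invr_ge0// mulrC ler_wpM2r ?powR_ge0//.
rewrite -powR_inv1// -powRrM mulN1r opprK -[leRHS]powRr1//.
by rewrite ler_powR ?ler1n// ltW.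
Qed.

Lemma count_modn_eq Q (i j : nat) :
  count (fun q => i == j %[mod q]) Q = count (fun q => q %| (i - j) + (j - i))%N Q.
Proof.
apply: eq_count => q /=; have [ij|ij] := leqP i j.
  by rewrite (eqP ij) add0n eq_sym eqn_mod_dvd.
by rewrite (eqP (ltnW ij : j - i == 0)%N) addn0 eqn_mod_dvd// ltnW.
Qed.

(** The inherited decay stops at the cutoff [X]; the bump tail is added at every frequency. Both
    parts decrease with [|xi|], as [sum_shift_le] requires. *)
Definition decay_bound D sg X Z xi : R :=
  (if `|xi| <= X then D * (1 + `|xi|) `^ (- sg) else 0) + Z / (1 + `|xi| ^+ 2).

Definition step_error D sg X Z (J : nat) Q : R :=
  J%:R / (size Q)%:R * (D * (2 * (1 + 2 * X) `^ (1 - sg) / (1 - sg))) + 9 * Z.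

(** The part of the bound with constant [D] vanishes beyond [X], so it only meets differences
    [|i - j| <= X + X'], which have at most [J] divisors in [Q]. On the tail all of [Q] may divide
    [i - j]; there [sum_invsq_le] supplies the factor [9]. *)
Lemma decay_shift_sum_le D sg X X' Z Q (B J : nat) xi M (i : nat) :
  0 < sg < 1 -> 0 <= D -> 0 <= X -> 0 <= Z ->
  uniq Q -> all prime Q -> all (leq B) Q ->
  (forall n : nat, n%:R <= X + X' -> (n < B ^ J.+1)%N) ->
  `|xi| <= X' ->
  \sum_(j < M | j != i :> nat)
     (count (fun q => i == j %[mod q]) Q)%:R * decay_bound D sg X Z (xi + (i%:R - j%:R))
  <= (size Q)%:R * step_error D sg X Z J Q.
Proof.
move=> sg01 D0 X0 Z0 uQ pQ BQ hJ xiX; have /andP[s0 s1] := sg01.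
pose G1 (t : R) := if t <= X then (1 + t) `^ (- sg) else 0.
pose G2 (t : R) := (1 + t ^+ 2)^-1.
have G1ni s t : 0 <= s -> s <= t -> G1 t <= G1 s.
  move=> s_ge0 st; rewrite /G1; case: (leP t X) => tX.
    by rewrite (le_trans st tX); apply: powRN_le; [lra|lra|exact: ltW].
  by case: ifP => // _; exact: powR_ge0.
have G2ni s t : 0 <= s -> s <= t -> G2 t <= G2 s.
  move=> s_ge0 st; rewrite /G2 lef_pV2 ?posrE ?ltr_pwDl ?sqr_ge0//.
  by rewrite lerD2l lerXn2r ?nnegrE// (le_trans s_ge0 st).
have G10 t : 0 <= G1 t by rewrite /G1; case: ifP => // _; exact: powR_ge0.
have G20 t : 0 <= G2 t by rewrite invr_ge0 addr_ge0// sqr_ge0.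
case: (posnP (size Q)) => [/size0nil ->|Q0].
  by rewrite mul0r big1// => j _ /=; rewrite mul0r.
have Q0' : 0 < (size Q)%:R :> R by rewrite ltr0n.
rewrite /step_error; set K := 2 * _ / _.
have -> : (size Q)%:R * (J%:R / (size Q)%:R * (D * K) + 9 * Z) =
  J%:R * (D * K) + (size Q)%:R * (9 * Z) by field; rewrite gt_eqF.
apply: le_trans (_ : \sum_(j < M) (J%:R * (D * G1 `|xi + i%:R - j%:R|)
   + (size Q)%:R * (Z * G2 `|xi + i%:R - j%:R|)) <= _); last first.
  rewrite big_split /= -!mulr_sumr lerD//.
    do 2 rewrite ler_wpM2l//.
    apply: le_trans (sum_shift_le _ _ G1ni) _; exact: sum_cut_half_le.
  rewrite [9 * Z]mulrC; do 2 rewrite ler_wpM2l//.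
  by apply: le_trans (sum_shift_le _ _ G2ni) _; exact: sum_invsq_le.
rewrite big_mkcond /=; apply: ler_sum => j _; rewrite addrA.
set eta := xi + i%:R - j%:R.
case: ifPn => [ji|_]; last by rewrite addr_ge0 ?mulr_ge0.
rewrite /decay_bound mulrDr -/(G2 `|eta|) lerD//; last first.
  by rewrite ler_wpM2r ?mulr_ge0// ler_nat count_size.
rewrite /G1; case: (leP `|eta| X) => etaX; last by rewrite !mulr0.
rewrite ler_wpM2r ?mulr_ge0 ?powR_ge0// ler_nat count_modn_eq.
apply: (@count_prime_divisors Q B) => //; first by clear -ji; lia.
apply: hJ.
have -> : ((i - j) + (j - i))%:R = `|i%:R - j%:R| :> R.
  have [ij|ij] := leqP i j.
    rewrite (eqP ij) add0n natrB// distrC ger0_norm// subr_ge0 ler_nat//.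
  by rewrite (eqP (ltnW ij : j - i == 0)%N) addn0 natrB ?(ltnW ij)// ger0_norm// subr_ge0 ler_nat ltnW.
have -> : i%:R - j%:R = eta - xi by rewrite /eta; ring.
by apply: le_trans (ler_normB _ _) _; exact: lerD.
Qed.

(** Moving the atoms of denominator [q] by [off q] only changes a phase, absorbed by [phi] in
    [poisson_error]. At frequency and phase [0] the main term is exactly [mass L], so the mass
    changes by the error alone. *)
Lemma next_atoms_trig_le d L theta Q off D sg X X' Z (B J : nat) :
  0 < sg < 1 -> 0 <= D -> 0 <= X -> 0 <= X' -> 0 <= Z ->
  0 < d -> 8 * pi * d <= 1 ->
  (0 < size Q)%N -> uniq Q -> all prime Q -> all (leq B) Q ->
  (forall n : nat, n%:R <= X + X' -> (n < B ^ J.+1)%N) ->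
  (forall q p r, q \in Q -> p \in L -> (r < q)%N -> `|grid theta q r - p.2| <= 3 / 4) ->
  (forall xi a, `|xi| <= X -> `|trig L xi a| <= D * (1 + `|xi|) `^ (- sg)) ->
  (forall xi a, X < `|xi| -> `|densT N d L xi a| <= Z / (1 + `|xi| ^+ 2)) ->
  `|mass (next_atoms d L theta Q off) - mass L| <= step_error D sg X Z J Q /\
  forall xi a, `|xi| <= X' ->
    `|trig (next_atoms d L theta Q off) xi a|
      <= decay_bound D sg X Z xi + step_error D sg X Z J Q.
Proof.
move=> sg01 D0 X0 X'0 Z0 d0 d8 Q0 uQ pQ BQ hJ hL hT hdT.
have dT xi a : `|densT N d L xi a| <= decay_bound D sg X Z xi.
  rewrite /decay_bound; case: (leP `|xi| X) => xX; last by rewrite add0r hdT.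
  apply: le_trans (densT_le _ _ _ (fun b => hT _ b xX)) _.
  by rewrite lerDl divr_ge0// addr_ge0// sqr_ge0.
have Q0' : 0 < (size Q)%:R :> R by rewrite ltr0n.
have err xi a : `|xi| <= X' -> `|trig (next_atoms d L theta Q off) xi a
   - (size Q)%:R^-1 * \sum_(q <- Q) densT N d L xi (a + 2 * pi * xi * off q)|
   <= step_error D sg X Z J Q.
  move=> xX; rewrite trig_next -mulrBr -sumrB normrM normfV (gtr0_norm Q0').
  rewrite ler_pdivrMl//; apply: poisson_error => //.
  - by move=> q /(allP pQ)/prime_gt0.
  - by move=> M i iM; apply: (decay_shift_sum_le (X' := X') (B := B)).
split.
  have := err 0 0; rewrite normr0 => /(_ X'0).
  rewrite -mass_trig (eq_bigr (fun=> mass L)) => [|q _]; last first.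
    by rewrite mulr0 mul0r addr0 densT_mass.
  by rewrite big_const_seq count_predT iter_addr_0 -[mass L *+ _]mulr_natl mulKf// gt_eqF.
move=> xi a xX; have := err xi a xX; set A := trig _ _ _; set S := (_ * _).
move=> h; have -> : A = S + (A - S) by rewrite addrC subrK.
apply: le_trans (ler_normD _ _) _; apply: lerD => //.
rewrite normrM normfV (gtr0_norm Q0') ler_pdivrMl//.
apply: le_trans (ler_norm_sum _ _ _) _.
apply: le_trans (_ : \sum_(q <- Q) decay_bound D sg X Z xi <= _).
  by apply: ler_sum => q _; exact: dT.
by rewrite big_const_seq count_predT iter_addr_0 mulr_natl.
Qed.

End Step.

(** * Separation of shifted fractions *)

Section Separation.
Context {R : realType}.
Implicit Types (theta gamma kap : R).

(* [kap * max(q, q')^(1 - gamma) / (q q')] bounds from below the distance between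
   two distinct shifted fractions [(r - theta) / q] and [(r' - theta) / q']. *)
Definition separated theta gamma kap : Prop :=
  forall (r r' : int) (q q' : nat), (0 < q)%N -> (0 < q')%N ->
    coprime `|r|%N q -> coprime `|r'|%N q' -> (r, q) <> (r', q') ->
    kap * (maxn q q')%:R `^ (1 - gamma)
      <= `|(r%:~R - theta) / q%:R - (r'%:~R - theta) / q'%:R| * (q%:R * q'%:R).

Lemma fraction_gap theta (r r' : int) (q q' : nat) : (0 < q)%N -> (0 < q')%N ->
  `|(r%:~R - theta) / q%:R - (r'%:~R - theta) / q'%:R| * (q%:R * q'%:R)
  = `|(r * q' - r' * q)%:~R - theta * (q'%:R - q%:R)|.
Proof.
move=> q0 q'0; have Q0 : 0 < q%:R :> R by rewrite ltr0n.
have Q'0 : 0 < q'%:R :> R by rewrite ltr0n.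
have QQ : 0 <= q%:R * q'%:R :> R by rewrite mulr_ge0.
rewrite -{1}(ger0_norm QQ) -normrM; congr `|_|.
rewrite intrB !intrM -!pmulrn; field; by rewrite !gt_eqF.
Qed.

(** Distinct reduced pairs are distinct fractions, so [r q' - r' q] is a nonzero integer. *)
Lemma separated_rational gamma : 1 <= gamma -> separated 0 gamma 1.
Proof.
move=> g1 r r' q q' q0 q'0 cr cr' neq.
rewrite fraction_gap// mul0r subr0 mul1r.
apply: le_trans (_ : 1 <= _).
  have m1 : 1 <= (maxn q q')%:R :> R by rewrite ler1n leq_max q0.
  by rewrite -[leRHS](powRr0 (maxn q q')%:R) ler_powR// subr_le0.
rewrite -intr_norm ler1z -gtz0_ge1 normr_gt0 subr_eq0; apply/eqP => e.
apply: neq.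
have qq : q = q'.
  apply/eqP; rewrite eqn_dvd; apply/andP; split.
    have : (q %| absz (r * q')%R)%N by rewrite e abszM dvdn_mull.
    by rewrite abszM Gauss_dvdr// coprime_sym.
  have : (q' %| absz (r' * q)%R)%N by rewrite -e abszM dvdn_mull.
  by rewrite abszM Gauss_dvdr// coprime_sym.
rewrite -qq in e *; congr (_, _); apply: (mulIf _ e).
by case: (q) q0.
Qed.

Lemma finite_set_min_gt0 (T : choiceType) (S : set T) (f : T -> R) :
  finite_set S -> (forall s, S s -> 0 < f s) ->
  exists2 k : R, 0 < k <= 1 & forall s, S s -> k <= f s.
Proof.
move=> /finite_seqP[s ->] f0.
have : forall x, x \in s -> 0 < f x by move=> x xs; exact: f0.
elim: s {f0} => [|x s IH] f0.
  by exists 1 => //; rewrite ltr01 lexx.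
have [y ys|k /andP[k0 k1] hk] := IH; first by apply: f0; rewrite inE ys orbT.
have fx := f0 x (mem_head _ _).
exists (Num.min k (f x)) => [|y /=].
  by rewrite lt_min k0 fx ge_min k1.
rewrite inE => /predU1P[->|ys]; rewrite ge_min ?lexx ?orbT//.
by rewrite hk.
Qed.

(** For [g < 1] the numerator [floor (theta n)] works for every denominator [n], because
    [1 / n <= n ^ (- g)]. *)
Lemma dio_good_gt1 theta g : dio_good_exponents theta g -> 1 <= g.
Proof.
move=> fin; rewrite leNgt; apply/negP => g1.
have : finite_set [set n : nat | (0 < n)%N].
  apply: sub_finite_set (finite_image snd fin) => n /= n0.
  exists (Num.floor (theta * n%:R), n) => //=; split => //.
  have N0 : 0 < n%:R :> R by rewrite ltr0n.
  have N1 : 1 <= n%:R :> R by rewrite ler1n.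
  apply: le_trans (_ : n%:R^-1 <= _); last first.
    by rewrite -powR_inv1 ?(ltW N0)// ler_powR// lerN2 ltW.
  have -> : theta - (Num.floor (theta * n%:R))%:~R / n%:R =
      (theta * n%:R - (Num.floor (theta * n%:R))%:~R) / n%:R by field; rewrite gt_eqF.
  rewrite normrM normfV (gtr0_norm N0) ler_piMl ?invr_ge0 ?(ltW N0)//.
  have := floor_itv (theta * n%:R); rewrite intrD => /andP[h1 h2].
  by rewrite ger0_norm; lra.
move/finite_seqP => [s es].
have : [set n : nat | (0 < n)%N] (\max_(i <- s) i).+1 by [].
rewrite es /= => h; have := @leq_bigmax_seq _ s predT id _ h isT.
by rewrite ltnn.
Qed.

Lemma dio_exponent_ge1 theta gamma : dio_exponent theta = gamma%:E -> 1 <= gamma.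
Proof.
move=> e; rewrite -lee_fin -e; apply: le_ereal_inf_tmp => _ [g gg <-].
by rewrite lee_fin; exact: dio_good_gt1 gg.
Qed.

(** Some [g < gamma] leaves only finitely many exceptions. Irrationality makes each of these
    distances positive, and the least scaled one gives [kap]. *)
Lemma irrational_dio theta gamma : irrational theta ->
  (dio_exponent theta < gamma%:E)%E ->
  exists2 kap : R, 0 < kap <= 1 & forall (p : int) (n : nat), (0 < n)%N ->
    kap * n%:R `^ (- gamma) <= `|theta - p%:~R / n%:R|.
Proof.
move=> irr /ereal_inf_lt[_ [g fin <-]]; rewrite lte_fin => gg.
pose f (pn : int * nat) : R := `|theta - pn.1%:~R / pn.2%:R| / pn.2%:R `^ (- gamma).
have [[p n] [/= n0 _]|k k01 hk] := @finite_set_min_gt0 _ _ f fin.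
  rewrite divr_gt0 ?powR_gt0 ?ltr0n// normr_gt0 subr_eq0; apply/eqP => e; apply: irr.
  by exists (p%:~R / n%:R) => //; rewrite e fmorph_div /= ratr_int ratr_nat.
exists k => // p n n0; have /andP[k0 k1] := k01.
have N0 : 0 < n%:R :> R by rewrite ltr0n.
have [le|gt] := leP `|theta - p%:~R / n%:R| (n%:R `^ (- g)).
  have := hk (p, n) (conj n0 le).
  by rewrite /f /= ler_pdivlMr ?powR_gt0.
apply: le_trans (ltW gt); apply: le_trans (_ : n%:R `^ (- gamma) <= _).
  by rewrite ler_piMl ?powR_ge0.
by rewrite ler_powR ?ler1n// lerN2 ltW.
Qed.

(** For [q < q'] the cross-multiplied gap is [n |theta - p / n|] with [n = q' - q], a denominator
    below [max(q, q')]. For [q = q'] the shift cancels and a nonzero integer remains. *)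
Lemma separated_irrational theta gamma : irrational theta -> 1 <= gamma ->
  (dio_exponent theta < gamma%:E)%E ->
  exists2 kap : R, 0 < kap & separated theta gamma kap.
Proof.
move=> irr g1 /(irrational_dio irr)[k /andP[k0 k1] hk]; exists k => //.
move=> r r' q q' q0 q'0 _ _ neq; rewrite fraction_gap//.
have m1 : 1 <= (maxn q q')%:R :> R by rewrite ler1n leq_max q0.
have pm : (maxn q q')%:R `^ (1 - gamma) <= 1 :> R.
  by rewrite -[leRHS](powRr0 (maxn q q')%:R) ler_powR// subr_le0.
have [qq|qq] := eqVneq q q'.
  apply: le_trans (_ : 1 <= _).
    by rewrite -[leRHS]mulr1 ler_pM ?powR_ge0// ltW.
  rewrite qq subrr mulr0 subr0 -mulrBl -intr_norm ler1z -gtz0_ge1 normr_gt0.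
  rewrite mulf_neq0//; last by case: (q') q'0.
  by rewrite subr_eq0; apply/eqP => e; apply: neq; rewrite e qq.
wlog lt : r r' q q' q0 q'0 neq m1 pm qq / (q < q')%N => [hw|].
  move: (qq); rewrite neq_ltn => /orP[lt|lt]; first exact: hw.
  have -> : `|(r * q' - r' * q)%:~R - theta * (q'%:R - q%:R)| =
     `|(r' * q - r * q')%:~R - theta * (q%:R - q'%:R)|.
    by rewrite -normrN; congr `|_|; rewrite !intrB; ring.
  rewrite maxnC; apply: hw => //; last by rewrite eq_sym.
  - by move=> [e1 e2]; apply: neq; rewrite e1 e2.
  - by rewrite maxnC.
  - by rewrite maxnC.
have n0 : (0 < q' - q)%N by rewrite subn_gt0.
have N0 : 0 < (q' - q)%:R :> R by rewrite ltr0n.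
have := hk (r * q' - r' * q) (q' - q)%N n0.
move=> /(ler_wpM2l (ltW N0)).
have -> : (q' - q)%:R * `|theta - (r * q' - r' * q)%:~R / (q' - q)%:R| =
   `|(r * q' - r' * q)%:~R - theta * (q'%:R - q%:R)|.
  rewrite -[X in X * _](ger0_norm (ltW N0)) -normrM -[LHS]normrN -(natrB _ (ltnW lt)).
  by congr `|_|; field; rewrite gt_eqF.
apply: le_trans.
rewrite mulrCA ler_wpM2l ?(ltW k0)//.
rewrite -[X in X * _]powRr1 ?(ltW N0)// -powRD_gt0//.
rewrite -[1 - gamma]opprB !powRN lef_pV2 ?posrE ?powR_gt0//; last by lra.
rewrite ge0_ler_powR ?nnegrE ?subr_ge0// ler_nat.
by apply: leq_trans (leq_subr _ _) _; rewrite leq_maxr.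
Qed.

End Separation.

(** * Excluded denominators and exact approximation *)

Section Exactness.
Context {R : realType}.

Lemma finite_pairs (T K : nat) (S : set (int * nat)) :
  (forall rq, S rq -> (absz rq.1 <= T)%N /\ (rq.2 <= K)%N) -> finite_set S.
Proof.
move=> hS; pose ints := [seq Posz n | n <- iota 0 T.+1] ++ [seq - Posz n | n <- iota 0 T.+1].
apply: (@sub_finite_set _ S [set` [seq (i, n) | i <- ints, n <- iota 0 K.+1]]); last first.
  exact: finite_seq.
move=> [r q] /hS[rT qK]; rewrite /mkset; apply/allpairsPdep; exists r, q; split => //.
  move: rT; rewrite mem_cat; case: r {qK} => n nT.
    by apply/orP; left; apply/mapP; exists n; rewrite ?mem_iota.
  by apply/orP; right; apply/mapP; exists n.+1; rewrite ?mem_iota// NegzE.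
by rewrite mem_iota.
Qed.

Variables (psi : nat -> R) (theta gam kap tau e b aL bR : R) (q0 : nat).
Hypotheses (psi_gt0 : forall n : nat, (0 < n)%N -> 0 < psi n)
  (psi_ni : forall m n : nat, (0 < m)%N -> (m <= n)%N -> psi n <= psi m)
  (psi_le : forall q : nat, (q0 <= q)%N -> psi q <= q%:R `^ (- (tau - e))).
Hypotheses (sep : separated theta gam kap) (kap0 : 0 < kap) (gam1 : 1 <= gam)
  (e01 : 0 < e < 1) (aL0 : 0 < aL) (tau_gt : 1 < tau - e)
  (hL : gam < aL * (tau - e - 1)) (hR : bR * gam < (1 - e) * (tau - e - 1))
  (hb : b * aL <= bR).

(** Two distinct fractions would be closer than twice the value of [psi] at the smaller denominator
    [m]. With [M] the larger one, separation then gives [kap m ^ (tau - e - 1) <= 2 M ^ gam], which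
    contradicts [hL] if [m] is [q'] and [hR] if [M] is [q']. *)
Lemma window_excluded (c x : R) : 0 < c -> \forall y \near +oo,
  forall (q : nat) (r : int) (q' : nat) (r' : int),
   (0 < q)%N -> coprime `|r|%N q -> y `^ (1 - e) <= q%:R -> q%:R <= y ->
   (1 - 2 * y `^ (- e)) * psi q <= `|x - (r%:~R - theta) / q%:R| <= psi q ->
   (0 < q')%N -> coprime `|r'|%N q' -> y `^ aL <= q'%:R -> q'%:R <= y `^ bR ->
   ~ (`|x - (r'%:~R - theta) / q'%:R| <= (1 - c) * psi q').
Proof.
move=> c0; have /andP[e0 e1] := e01.
have tau_gt' := tau_gt; have gam1' := gam1; have hL' := hL; have hR' := hR.
near=> y.
move=> q r q' r' q_gt0 cr yq qy /andP[xq1 xq2] q'0 cr' yq' q'y xq'.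
have y1 : 1 <= y by near: y; exact: nbhs_pinfty_ge.
have y0 : 0 < y by lra.
have Q0 : 0 < q%:R :> R by rewrite ltr0n.
have Q'0 : 0 < q'%:R :> R by rewrite ltr0n.
have ps := psi_gt0 q_gt0; have ps' := psi_gt0 q'0.
(* For one and the same fraction the inner edge of the annulus decides: [2 y ^ (- e) < c] for large
   [y]. *)
have [[er eq]|neq] := EM ((r, q) = (r', q')).
  rewrite -er -eq in xq'; have := le_trans xq1 xq'; rewrite ler_pM2r//.
  have : 2 / c < y `^ e.
    apply: lt_le_trans (_ : 2 / c + 1 <= _); first by rewrite ltrDl.
    near: y; exact: near_powR_ge.
  by rewrite powRN ltr_pdivrMr// -ltr_pdivrMl ?powR_gt0// mulrC; lra.
have xq'1 : `|x - (r'%:~R - theta) / q'%:R| <= psi q'.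
  by apply: le_trans xq' _; rewrite ler_piMl ?ltW//; lra.
have dist : `|(r%:~R - theta) / q%:R - (r'%:~R - theta) / q'%:R| <= psi q + psi q'.
  apply: le_trans (ler_distD x _ _) _; rewrite distrC; exact: lerD.
have := sep q_gt0 q'0 cr cr' neq.
move=> /le_trans /(_ (ler_wpM2r (mulr_ge0 (ltW Q0) (ltW Q'0)) dist)).
have [q'q|qq'] := leqP q' q.
  (* here [q'] is below [q]: the separation contradicts [psi q' <= q'^(-tau+e)] *)
  move=> h.
  have pp := psi_ni q'0 q'q.
  have qq0 : (q0 <= q')%N.
    by rewrite -(ler_nat R); apply: le_trans yq'; near: y; exact: near_powR_ge.
  have pl := psi_le qq0.
  have h2 : kap * q%:R `^ (1 - gam) <= 2 * q'%:R `^ (- (tau - e)) * (q%:R * q'%:R).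
    apply: le_trans h _; rewrite ler_wpM2r ?mulr_ge0//; lra.
  have h3 : kap * q'%:R `^ (tau - e - 1) <= 2 * q%:R `^ gam.
    have P1 : 0 < q%:R `^ (gam - 1) * q'%:R `^ (tau - e - 1) :> R.
      by rewrite mulr_gt0 ?powR_gt0.
    have := ler_wpM2r (ltW P1) h2.
    have -> : kap * q%:R `^ (1 - gam) * (q%:R `^ (gam - 1) * q'%:R `^ (tau - e - 1))
       = kap * q'%:R `^ (tau - e - 1).
      rewrite mulrA -[kap * _ * _]mulrA -powRD_gt0//.
      have -> : 1 - gam + (gam - 1) = 0 by ring.
      by rewrite powRr0 mulr1.
    have -> : 2 * q'%:R `^ (- (tau - e)) * (q%:R * q'%:R) *
      (q%:R `^ (gam - 1) * q'%:R `^ (tau - e - 1)) =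
      2 * (q%:R * q%:R `^ (gam - 1)) *
        (q'%:R `^ (- (tau - e)) * (q'%:R * q'%:R `^ (tau - e - 1))) by ring.
    rewrite !mulr_powRB1//; [|exact: lt_trans tau_gt|exact: lt_le_trans gam1].
    by rewrite powRN mulVf ?mulr1// gt_eqF// powR_gt0.
  have h4 : kap * y `^ (aL * (tau - e - 1)) <= 2 * y `^ gam.
    apply: le_trans (le_trans h3 _).
      rewrite ler_wpM2l ?(ltW kap0)// powRrM ge0_ler_powR ?nnegrE ?powR_ge0//; lra.
    by rewrite ler_wpM2l// ge0_ler_powR ?nnegrE ?(ltW y0)//; lra.
  have : 2 / kap < y `^ (aL * (tau - e - 1) - gam).
    apply: lt_le_trans (_ : 2 / kap + 1 <= _); first by rewrite ltrDl.
    by near: y; apply: near_powR_ge; lra.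
  rewrite ltr_pdivrMr// => h5.
  have := ler_wpM2r (powR_ge0 y (- gam)) h4.
  rewrite -!mulrA -!powRD_gt0// subrr powRr0; lra.
move=> h.
have pp := psi_ni q_gt0 (ltnW qq').
have qq0 : (q0 <= q)%N.
  rewrite -(ler_nat R); apply: le_trans yq; near: y; apply: near_powR_ge; lra.
have pl := psi_le qq0.
have h2 : kap * q'%:R `^ (1 - gam) <= 2 * q%:R `^ (- (tau - e)) * (q%:R * q'%:R).
  apply: le_trans h _; rewrite ler_wpM2r ?mulr_ge0//; lra.
have h3 : kap * q%:R `^ (tau - e - 1) <= 2 * q'%:R `^ gam.
  have P1 : 0 < q'%:R `^ (gam - 1) * q%:R `^ (tau - e - 1) :> R.
    by rewrite mulr_gt0 ?powR_gt0.
  have := ler_wpM2r (ltW P1) h2.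
  have -> : kap * q'%:R `^ (1 - gam) * (q'%:R `^ (gam - 1) * q%:R `^ (tau - e - 1))
     = kap * q%:R `^ (tau - e - 1).
    rewrite mulrA -[kap * _ * _]mulrA -powRD_gt0//.
    have -> : 1 - gam + (gam - 1) = 0 by ring.
    by rewrite powRr0 mulr1.
  have -> : 2 * q%:R `^ (- (tau - e)) * (q%:R * q'%:R) *
    (q'%:R `^ (gam - 1) * q%:R `^ (tau - e - 1)) =
    2 * (q'%:R * q'%:R `^ (gam - 1)) *
      (q%:R `^ (- (tau - e)) * (q%:R * q%:R `^ (tau - e - 1))) by ring.
  rewrite !mulr_powRB1//; [|exact: lt_trans tau_gt|exact: lt_le_trans gam1].
  by rewrite powRN mulVf ?mulr1// gt_eqF// powR_gt0.
have h4 : kap * y `^ ((1 - e) * (tau - e - 1)) <= 2 * y `^ (bR * gam).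
  apply: le_trans (le_trans h3 _).
    rewrite ler_wpM2l ?(ltW kap0)// powRrM ge0_ler_powR ?nnegrE ?powR_ge0//; lra.
  rewrite ler_wpM2l// powRrM ge0_ler_powR ?nnegrE ?powR_ge0//; lra.
have : 2 / kap < y `^ ((1 - e) * (tau - e - 1) - bR * gam).
  apply: lt_le_trans (_ : 2 / kap + 1 <= _); first by rewrite ltrDl.
  by near: y; apply: near_powR_ge; lra.
rewrite ltr_pdivrMr// => h5.
have := ler_wpM2r (powR_ge0 y (- (bR * gam))) h4.
rewrite -!mulrA -!powRD_gt0// subrr powRr0; lra.
Unshelve. all: by end_near. Qed.

Variables (Y : nat -> R) (x : R).
Hypotheses (Y_cvg : Y @ \oo --> +oo) (Y_succ : forall k, Y k.+1 = Y k `^ b)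
  (approx : forall k, (0 < k)%N -> exists q (r : int),
     [/\ (0 < q)%N, coprime `|r|%N q, Y k `^ (1 - e) <= q%:R, q%:R <= Y k &
      (1 - 2 * Y k `^ (- e)) * psi q <= `|x - (r%:~R - theta) / q%:R| <= psi q]).

(** Since [b aL <= bR], the window of [Y k] reaches up to [Y k.+1 ^ aL], where the next one begins;
    together they cover all large denominators. The small ones allow only finitely many
    numerators. *)
Lemma exact_approximable : Exact psi theta x.
Proof.
have /andP[e0 e1] := e01; have kap0' := kap0; have aL0' := aL0.
have nearY (P : R -> Prop) : (\forall y \near +oo, P y) ->
    exists k0 : nat, forall k, (k0 <= k)%N -> P (Y k).
  move=> hP; have [k0 _ hk0] : \forall k \near \oo, P (Y k) by exact: Y_cvg.
  by exists k0 => k kk; exact: hk0.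
split.
  move=> /(finite_image snd)/finite_seqP[s es].
  pose m := \max_(i <- s) i.
  have e10 : 0 < 1 - e by lra.
  have [k0 hk0] := nearY _ (near_powR_ge m.+1%:R e10).
  have := hk0 k0.+1 (leqnSn _); have [//|q [r [q_gt0 cr yq qy /andP[_ xq]]]] := @approx k0.+1.
  move=> /le_trans/(_ yq); rewrite ler_nat => mq.
  have qs : q \in s.
    have : [set` s] q by rewrite -es; exists (r, q) => //; split=> //; split=> //=; rewrite mul1r.
    by [].
  by have := @leq_bigmax_seq _ s predT id q qs isT; rewrite leqNgt mq.
move=> c c0.
have [k0 hk0] := nearY _ (window_excluded x c0).
have [k1 hk1] := nearY _ (nbhs_pinfty_ge (num_real (1 : R))).
pose k2 := (k0 + k1).+1.
have k02 k : (k2 <= k)%N -> (k0 <= k)%N by move=> /ltnW; apply: leq_trans; exact: leq_addr.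
have k12 k : (k2 <= k)%N -> (k1 <= k)%N by move=> /ltnW; apply: leq_trans; exact: leq_addl.
have small r' q' : approx_pairs psi theta (1 - c) x (r', q') -> q'%:R <= Y k2 `^ aL.
  move=> [/= q'0 [cr' xq']]; rewrite leNgt; apply/negP => q'big.
  (* The least such [k] is not [k2], and the window of its predecessor contains [q']. *)
  have ex : exists k, (k2 <= k)%N && (q'%:R < Y k `^ aL).
    have [k3 hk3] := nearY _ (near_powR_ge (q'%:R + 1) aL0').
    exists (k2 + k3)%N; rewrite leq_addr /=.
    by apply: lt_le_trans (hk3 _ (leq_addl _ _)); rewrite ltrDl.
  case: (ex_minnP ex) => k /andP[k2k qk] kmin.
  case: k k2k qk kmin => [|k]; first by rewrite /k2.
  rewrite leq_eqVlt => /predU1P[<-|k2k] qk kmin.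
    by move: (lt_trans qk q'big); rewrite ltxx.
  rewrite ltnS in k2k.
  have kq : Y k `^ aL <= q'%:R.
    by rewrite leNgt; apply/negP => h; have := kmin k; rewrite k2k h ltnn => /(_ isT).
  have [|q [r [q_gt0 cr yq qy xq]]] := @approx k; first exact: leq_trans (ltn0Sn _) k2k.
  apply: (hk0 k (k02 _ k2k) q r q' r') => //.
  apply: ltW; apply: lt_le_trans qk _; rewrite Y_succ -powRrM ler_powR//.
  exact: hk1 (k12 _ k2k).
pose T := Y k2 `^ aL * (`|x| + psi 1%N) + `|theta|.
apply: (@finite_pairs (Num.truncn T) (Num.truncn (Y k2 `^ aL))) => -[r' q'] h /=.
have hq := small _ _ h; case: h => [/= q'0 [_ xq']].
have Q0 : 0 < q'%:R :> R by rewrite ltr0n.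
split; last by rewrite -ltnS -(ltr_nat R) (le_lt_trans hq)// truncnS_gt.
rewrite -ltnS -(ltr_nat R); apply: le_lt_trans (truncnS_gt T).
have p1 : psi q' <= psi 1%N by exact: psi_ni.
have p0 := psi_gt0 q'0.
have xq'1 : `|x - (r'%:~R - theta) / q'%:R| <= psi 1%N.
  apply: le_trans xq' _; apply: le_trans p1; rewrite ler_piMl ?(ltW p0)//; lra.
rewrite natr_absz intr_norm.
have -> : r'%:~R = q'%:R * (x - (x - (r'%:~R - theta) / q'%:R)) + theta :> R.
  by field; rewrite gt_eqF.
apply: le_trans (ler_normD _ _) _; rewrite lerD2r normrM (gtr0_norm Q0).
apply: ler_pM => //; apply: le_trans (ler_normB _ _) _; exact: lerD.
Qed.

End Exactness.

(** * Decay of the smoothed transform and location of the new atoms *)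

Section Atoms.
Context {R : realType}.
Implicit Types (L : seq (R * R)) (d theta xi a : R) (Q : seq nat).

Lemma densT_decay (N : nat) : exists2 C : R, 0 < C &
  forall d L xi a, 0 < d -> (forall p, p \in L -> 0 <= p.1) ->
    2 * N.+1%:R <= `|xi| * d ->
    `|densT N d L xi a| * ((xi * d) ^+ 2) ^+ N.+1 <= mass L * C.
Proof.
have [C C0 hC] := @oscI_decay R N.+1.
have W0 := @oscW_gt0 R N.+1; have pi2 := @pi_ge2 R.
exists (C / oscW N.+1) => [|d L xi a d0 L0 hxi]; first by rewrite divr_gt0.
have hw : 2 * N.+1%:R <= `|2 * pi * xi * d|.
  rewrite !normrM (gtr0_norm d0) (@ger0_norm _ 2)// (gtr0_norm (pi_gt0 R)).
  apply: le_trans hxi _; rewrite -mulrA ler_peMl ?mulr_ge0 ?(ltW d0)//; lra.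
have osc_le p : `|oscI N.+1 (2 * pi * xi * d) p| * ((xi * d) ^+ 2) ^+ N.+1 <= C.
  apply: le_trans (hC _ p hw); rewrite ler_wpM2l// lerXn2r ?nnegrE ?sqr_ge0//.
  have -> : (2 * pi * xi * d) ^+ 2 = (2 * pi) ^+ 2 * (xi * d) ^+ 2 by ring.
  rewrite ler_peMl ?sqr_ge0// exprn_ege1//; lra.
have X0 : 0 <= ((xi * d) ^+ 2) ^+ N.+1 by rewrite exprn_ge0// sqr_ge0.
rewrite /densT normrM normfV (gtr0_norm W0) mulrAC mulrA.
rewrite ler_wpM2r ?invr_ge0 ?(ltW W0)//.
apply: le_trans (ler_wpM2r X0 (ler_norm_sum _ _ _)) _.
rewrite /mass !mulr_suml big_seq [leRHS]big_seq; apply: ler_sum => p pL.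
by rewrite normrM (ger0_norm (L0 _ pL)) -mulrA ler_wpM2l// L0.
Qed.

Lemma dens_ge0 N d L x : 0 < d -> (forall p, p \in L -> 0 <= p.1) -> 0 <= dens N d L x.
Proof.
move=> d0 L0; rewrite /dens big_seq sumr_ge0// => p /L0 p0.
by rewrite mulr_ge0// divr_ge0 ?cosbump_ge0// mulr_ge0 ?(ltW d0) ?(ltW (oscW_gt0 _)).
Qed.

Lemma next_atoms_ge0 N d L theta Q off : 0 < d ->
  (forall p, p \in L -> 0 <= p.1) ->
  forall p, p \in next_atoms N d L theta Q off -> 0 <= p.1.
Proof.
move=> d0 L0 p; rewrite mem_filter => /andP[_ /allpairsPdep[q [r [qQ rq ->]]]] /=.
by rewrite !divr_ge0// dens_ge0.
Qed.

Lemma next_atoms_near N d L theta Q off p : 0 < d ->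
  p \in next_atoms N d L theta Q off ->
  exists q r p', [/\ q \in Q, (r < q)%N, p' \in L, p.2 = grid theta q r + off q &
    `|grid theta q r - p'.2| <= pi * d].
Proof.
move=> d0; rewrite mem_filter => /andP[+ /allpairsPdep[q [r [qQ rq pE]]]].
rewrite pE /= => nz; rewrite mem_iota add0n in rq.
have : dens N d L (grid theta q r) != 0.
  by apply: contraNneq nz => ->; rewrite !mul0r.
have [[p' p'L near]|nex] := pselect (exists2 p', p' \in L & `|grid theta q r - p'.2| <= pi * d).
  by move=> _; exists q, r, p'.
rewrite /dens big_seq big1 ?eqxx// => p' p'L.
rewrite cosbump_out ?mul0r ?mulr0//.
rewrite -ler_norml normrM normfV (gtr0_norm d0) ler_pdivrMr//.
by apply/negP => h; apply: nex; exists p'.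
Qed.

End Atoms.

(** * The iterated construction *)

Section Construction.
Context {R : realType}.
Variables (psi : nat -> R) (theta tau e b sg H : R) (N J : nat).
Implicit Types (y xi a : R).

(** The multiples of [e] are margins. Where [psi q >= y ^ (- (tau + e))], the annulus thickness
    [y ^ (- e) * psi q] exceeds [width] by a factor [y ^ e]; and [cutoff y * width y = y ^ e], so
    beyond the cutoff a high enough power of the bump gains any power of [y]. *)
Definition width y : R := y `^ (- (tau + 3 * e)).
Definition cutoff y : R := y `^ (tau + 4 * e).
Definition offset y (q : nat) : R := (1 - y `^ (- e)) * psi q.

(** All size conditions on a scale, which frees the induction from asymptotics. In [gs_nested], [4]
    bounds [pi], the half-width of the bump in units of [width]; [psi q] bounds the offset;
    [8 * width] is the radius of the nested balls. In [gs_error] the right side is the decay wanted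
    at the top frequency of the next scale. *)
Record good_scale y : Prop := GoodScale {
  gs_ge1 : 1 <= y;
  gs_width : 64 * width y <= 1;
  gs_nested : forall q, q \in primes_in (y `^ b) e ->
    4 * width y + psi q + 8 * width (y `^ b) <= 8 * width y;
  gs_annulus : forall q, q \in primes_in y e -> 8 * width y <= y `^ (- e) * psi q;
  gs_primes : (0 < size (primes_in (y `^ b) e))%N;
  gs_prime_ge8 : forall q, q \in primes_in (y `^ b) e -> (8 <= q)%N;
  gs_decay : forall (L : seq (R * R)) xi a, (forall p, p \in L -> 0 <= p.1) ->
    mass L <= 2 -> cutoff y < `|xi| ->
    `|densT N (width y) L xi a| <= y `^ (- H) / (1 + `|xi| ^+ 2);
  gs_divisors : forall n : nat, n%:R <= cutoff y + cutoff (y `^ b) ->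
    (n < (Num.truncn ((y `^ b) `^ (1 - e))).+1 ^ J.+1)%N;
  gs_error : y `^ (- H) +
      step_error 2 sg (cutoff y) (y `^ (- H)) J (primes_in (y `^ b) e)
    <= y `^ (- e) * (1 + cutoff (y `^ b)) `^ (- sg) }.

Fixpoint scale y (k : nat) : R := if k is k'.+1 then scale y k' `^ b else y.

Fixpoint atoms y (k : nat) : seq (R * R) :=
  if k is k'.+1 then next_atoms N (width (scale y k')) (atoms y k') theta
    (primes_in (scale y k) e) (offset (scale y k)) else [:: (1, 1 / 2)].

Variable y0 : R.
Local Notation Y := (scale y0).
Local Notation nu := (atoms y0).

Hypotheses (psi_gt0 : forall n : nat, (0 < n)%N -> 0 < psi n)
  (theta01 : 0 <= theta < 1) (e0 : 0 < e) (tau0 : 0 < tau) (sg01 : 0 < sg < 1)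
  (b1 : 1 <= b) (good : forall k, good_scale (Y k))
  (small : forall k, Y k `^ (- e) <= 2^-1 ^+ k.+2).

Let Y1 k : 1 <= Y k. Proof. exact: gs_ge1 (good k). Qed.
Let Y0 k : 0 < Y k. Proof. exact: lt_le_trans (Y1 k). Qed.

Let width0 k : 0 < width (Y k). Proof. exact: powR_gt0. Qed.

Lemma atoms_ge0 k p : p \in nu k -> 0 <= p.1.
Proof.
elim: k p => [|k IH] p; first by rewrite inE => /eqP ->.
by apply: next_atoms_ge0 => //; exact: width0.
Qed.

Lemma pi_le4 : pi <= 4 :> R.
Proof. by have := @pihalf_lt2 R; lra. Qed.

Lemma atoms_succ k p : p \in nu k.+1 -> exists q r p',
  [/\ q \in primes_in (Y k.+1) e, (r < q)%N, p' \in nu k,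
      p.2 = grid theta q r + offset (Y k.+1) q &
      `|p.2 - p'.2| + 8 * width (Y k.+1) <= 8 * width (Y k)].
Proof.
case/(next_atoms_near (width0 k)) => q [r [p' [qQ rq p'L pE near]]].
exists q, r, p'; split => //.
have [pq _ _] := primes_inP (ltW (Y0 k.+1)) qQ.
have ps := psi_gt0 (prime_gt0 pq).
have ye : Y k.+1 `^ (- e) <= 1.
  by rewrite -[leRHS](powRr0 (Y k.+1)) ler_powR// oppr_le0 ltW.
have off0 : 0 <= offset (Y k.+1) q <= psi q.
  by rewrite mulr_ge0 ?subr_ge0 ?(ltW ps)//= ler_piMl ?(ltW ps)// gerBl powR_ge0.
have := gs_nested (good k) qQ => h; apply: le_trans h; rewrite lerD2r pE.
rewrite addrAC; apply: le_trans (ler_normD _ _) _; apply: lerD.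
  by apply: le_trans near _; rewrite ler_wpM2r ?(ltW (width0 k))// pi_le4.
by have /andP[f1 f2] := off0; rewrite ger0_norm.
Qed.

(** Including the radius of the descendant in the estimate makes the induction telescope: its ball
    lies inside that of the ancestor. *)
Lemma atoms_near j k p : p \in nu (j + k)%N -> exists2 p', p' \in nu k &
  `|p.2 - p'.2| + 8 * width (Y (j + k)%N) <= 8 * width (Y k).
Proof.
elim: j p => [|j IH] p; first by exists p => //; rewrite subrr normr0 add0r.
rewrite addSn => /atoms_succ[q [r [p1 [_ _ /IH[p' p'k h1] _ h2]]]].
exists p' => //; have := ler_distD p1.2 p.2 p'.2; lra.
Qed.

Lemma atoms_itv k p : p \in nu k -> 3 / 8 <= p.2 <= 5 / 8.
Proof.
rewrite -[k]addn0 => /atoms_near[p']; rewrite inE => /eqP -> /= h.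
have w0 : 0 <= width (Y (k + 0)%N) by exact: powR_ge0.
have w1 := gs_width (good 0).
have : `|p.2 - 1 / 2| <= 1 / 8.
  move: h w0 w1; rewrite /scale -/scale; set w := width _; set w' := width _; lra.
by rewrite ler_distl => /andP[h1 h2]; apply/andP; split; lra.
Qed.

(** As [8 <= q], the grid lies in [[- 1 / 8, 1]], and the atoms lie in [[3 / 8, 5 / 8]]; the worst
    distance is the [3 / 4] that Poisson summation tolerates. *)
Lemma grid_close k (q r : nat) p : q \in primes_in (Y k.+1) e -> (r < q)%N ->
  p \in nu k -> `|grid theta q r - p.2| <= 3 / 4.
Proof.
move=> qQ rq /atoms_itv/andP[p1 p2]; have q8 := gs_prime_ge8 (good k) qQ.
have /andP[t0 t1] := theta01.
have q8' : 8%:R <= q%:R :> R by rewrite ler_nat.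
have Q0 : 0 < q%:R :> R by lra.
have r0 : 0 <= r%:R :> R by [].
have rq' : r%:R <= q%:R :> R by rewrite ler_nat ltnW.
have g1 : - (1 / 8) <= grid theta q r by rewrite /grid ler_pdivlMr//; lra.
have g2 : grid theta q r <= 1 by rewrite /grid ler_pdivrMr//; lra.
by rewrite ler_distl; apply/andP; split; lra.
Qed.

Lemma step_error_le (D D0 X Z : R) Q : 1 <= D0 -> D <= 2 * D0 -> 0 <= X -> 0 <= Z ->
  step_error D sg X Z J Q <= D0 * step_error 2 sg X Z J Q.
Proof.
move=> D01 DD X0 Z0; have /andP[s0 s1] := sg01; rewrite /step_error mulrDr lerD//.
  rewrite [leRHS]mulrCA ler_wpM2l ?divr_ge0// [leRHS]mulrA ler_wpM2r ?[D0 * 2]mulrC//.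
  by rewrite divr_ge0 ?subr_ge0 ?(ltW s1)// mulr_ge0 ?powR_ge0.
by rewrite ler_peMl// mulr_ge0.
Qed.

Lemma powR_mulN_le1 (u v s : R) : 0 < u -> u <= v -> 0 <= s -> u `^ s * v `^ (- s) <= 1.
Proof.
move=> u0 uv s0; have v0 : 0 < v by exact: lt_le_trans uv.
have vs : 0 < v `^ s by exact: powR_gt0.
rewrite powRN ler_pdivrMr; last exact: vs.
rewrite mul1r; apply: ge0_ler_powR => //; rewrite nnegrE; exact: ltW.
Qed.

Lemma scaled_error_le (D E S W v h : R) : 0 <= D -> 0 <= W -> E <= S ->
  S <= v * W -> v <= h -> D * E <= h * (D * W).
Proof.
move=> D_ge0 W0 ES SW vh; rewrite [leRHS]mulrCA; apply: ler_wpM2l D_ge0 _ _ _.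
by apply: le_trans ES _; apply: le_trans SW _; exact: ler_wpM2r.
Qed.

Lemma scale_le j k : (j <= k)%N -> Y j <= Y k.
Proof.
move=> /subnK <-; elim: (k - j)%N => [|n IH]; first by rewrite add0n.
by apply: le_trans IH _; rewrite addSn /=; exact: le1r_powR.
Qed.

(** With this constant the initial unit atom satisfies the decay bound on its whole frequency
    range. *)
Let D0 := (1 + cutoff (Y 0)) `^ sg.

(** Step [k] adds at most [2^-1 ^+ k.+2] times [D0 * (1 + cutoff (Y k.+1)) ^ (- sg)]. This factor is
    at most [1], which serves the mass, and at most [D0 * (1 + |xi|) ^ (- sg)] in the frequency
    range, which serves the transform; the geometric allowances absorb the sum. *)
Lemma atoms_bounds k :
  `|mass (nu k) - 1| <= 1 / 2 - 2^-1 ^+ k.+1 /\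
  forall xi a, `|xi| <= cutoff (Y k) ->
    `|trig (nu k) xi a| <= D0 * (2 - 2^-1 ^+ k) * (1 + `|xi|) `^ (- sg).
Proof.
have /andP[s0 s1] := sg01.
have e0' := e0; have tau0' := tau0.
have X0 m : 0 <= cutoff (Y m) by exact: powR_ge0.
have c0 m : 0 < 1 + cutoff (Y m) by rewrite ltr_wpDr ?X0.
have D01 : 1 <= D0.
  by rewrite /D0 -[leLHS](powRr0 (1 + cutoff (Y 0))) ler_powR ?lerDl ?X0// ltW.
elim: k => [|k [IHm IHt]].
  split.
    rewrite /= /mass big_seq1 /= subrr normr0 expr1; lra.
  move=> xi a xiX; rewrite /= /trig big_seq1 /= mul1r expr0.
  apply: le_trans (cos_max _) _.
  have -> : 2 - 1 = 1 :> R by ring.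
  rewrite mulr1 powRN ler_pdivlMr ?powR_gt0 ?mul1r ?ltr_pwDl//.
  by rewrite ge0_ler_powR ?nnegrE ?(ltW s0) ?addr_ge0 ?X0// lerD2l.
set y := Y k; set Z := y `^ (- H); set Q := primes_in (Y k.+1) e.
set h := 2^-1 ^+ k : R; have h0 : 0 < h by rewrite exprn_gt0// invr_gt0.
have hS : 2^-1 ^+ k.+1 = h / 2 :> R by rewrite exprS mulrC.
have hSS : 2^-1 ^+ k.+2 = h / 4 :> R by rewrite 2!exprS -/h; field.
have h1 : h <= 1 by rewrite exprn_ile1 ?invr_ge0// invf_le1// ler1n.
have Z0 : 0 <= Z by exact: powR_ge0.
set D := D0 * (2 - h).
have D_ge0 : 0 <= D by rewrite mulr_ge0//; lra.
have D_le : D <= 2 * D0 by rewrite mulrC /D ler_wpM2l//; lra.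
have m2 : mass (nu k) <= 2.
  by have := ler_normr (mass (nu k) - 1) (mass (nu k) - 1); rewrite lexx /= => _;
     move: IHm; rewrite hS ler_norml => /andP[_]; lra.
have [hm ht] : `|mass (nu k.+1) - mass (nu k)| <= step_error D sg (cutoff y) Z J Q /\
   forall xi a, `|xi| <= cutoff (Y k.+1) -> `|trig (nu k.+1) xi a|
      <= decay_bound D sg (cutoff y) Z xi + step_error D sg (cutoff y) Z J Q.
  apply: (@next_atoms_trig_le R N (width y) (nu k) theta Q (offset (Y k.+1)) D sg
    (cutoff y) (cutoff (Y k.+1)) Z (Num.truncn (Y k.+1 `^ (1 - e))).+1 J) => //;
    rewrite ?X0//.
  - exact: width0.
  - have := gs_width (good k); have := pi_le4; have := width0 k; rewrite -/y => w0 p4 w64.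
    apply: le_trans (_ : 8 * 4 * width y <= _); last by lra.
    by rewrite ler_wpM2r ?(ltW w0)// ler_wpM2l.
  - exact: gs_primes (good k).
  - exact: primes_in_uniq.
  - by apply/allP => q /(primes_inP (ltW (Y0 k.+1)))[].
  - apply/allP => q /(primes_inP (ltW (Y0 k.+1)))[_ yq _].
    rewrite -(ltr_nat R); apply: le_lt_trans yq.
    by rewrite truncn_le powR_ge0.
  - exact: gs_divisors (good k).
  - by move=> q p r qQ pL rq; exact: (@grid_close k).
  - by move=> xi a xX; apply: (gs_decay (good k)) => //; exact: atoms_ge0.
have err := gs_error (good k); rewrite -/y -/Z -/(Y k.+1) -/Q in err.
have small_k := small k; rewrite hSS -/y in small_k.
have XX : cutoff (Y 0) <= cutoff (Y k.+1).
  rewrite /cutoff ge0_ler_powR ?nnegrE ?(ltW (Y0 _)) ?scale_le//; lra.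
have D0w : D0 * (1 + cutoff (Y k.+1)) `^ (- sg) <= 1.
  by apply: powR_mulN_le1; rewrite ?lerD2l ?(ltW s0).
have se := step_error_le Q D01 D_le (X0 k) Z0; rewrite -/y in se.
have seZ : step_error 2 sg (cutoff y) Z J Q <= Z + step_error 2 sg (cutoff y) Z J Q.
  by rewrite lerDr.
have D0_ge0 : 0 <= D0 by exact: le_trans D01.
have W0 : 0 <= (1 + cutoff (Y k.+1)) `^ (- sg) by exact: powR_ge0.
have E0 := scaled_error_le D0_ge0 W0 (lexx _) err small_k.
have E1 := scaled_error_le D0_ge0 W0 seZ err small_k.
have h40 : 0 <= h / 4 by rewrite divr_ge0 // ltW.
have E2 := le_trans E1 (ler_wpM2l h40 D0w); rewrite mulr1 in E2.
split.
  have -> : mass (nu k.+1) - 1 = (mass (nu k.+1) - mass (nu k)) + (mass (nu k) - 1) by ring.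
  apply: le_trans (ler_normD _ _) _.
  have := lerD (le_trans (le_trans hm se) E2) IHm.
  move/le_trans; apply; rewrite hS hSS.
  by have -> : h / 4 + (1 / 2 - h / 2) = 1 / 2 - h / 4 by field.
move=> xi a xX; apply: le_trans (ht xi a xX) _.
set w := (1 + `|xi|) `^ (- sg).
have ww : (1 + cutoff (Y k.+1)) `^ (- sg) <= w.
  by apply: powRN_le; [rewrite ltr_pwDl|rewrite lerD2l|exact: ltW].
have w0 : 0 <= w by exact: powR_ge0.
have db : decay_bound D sg (cutoff y) Z xi <= D * w + Z.
  apply: lerD.
    by case: ifP => [_|_]; [exact: lexx|exact: mulr_ge0].
  have q0 : 0 < 1 + `|xi| ^+ 2 by rewrite ltr_pwDl// sqr_ge0.
  rewrite ler_pdivrMr; last exact: q0.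
  by apply: ler_peMr Z0 _; rewrite lerDl sqr_ge0.
have E3 : h / 4 * (D0 * (1 + cutoff (Y k.+1)) `^ (- sg)) <= h / 2 * (D0 * w).
  apply: le_trans (ler_wpM2l h40 (ler_wpM2l D0_ge0 ww)) _.
  apply: ler_wpM2r (mulr_ge0 D0_ge0 w0) _ _ _.
  by rewrite ler_wpM2l ?(ltW h0)// lef_pV2 ?posrE// ler_nat.
apply: le_trans (lerD db se) _.
have alg (A u v : R) : A * (2 - u / 2) * v = A * (2 - u) * v + u / 2 * (A * v) by field.
rewrite hS alg -/D.
rewrite -addrA lerD2l; apply: le_trans E3; apply: le_trans E0.
by rewrite [leRHS]mulrDr lerD2r; exact: ler_peMl Z0 D01.
Qed.

End Construction.

(** * Every large scale is good *)

Section GoodScales.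
Context {R : realType}.
Variables (psi : nat -> R) (theta tau e b sg H : R) (N J q0 : nat).
Implicit Types (y xi a : R).
Hypotheses (psi_ge : forall q : nat, (q0 <= q)%N -> q%:R `^ (- (tau + e)) <= psi q)
  (psi_le : forall q : nat, (q0 <= q)%N -> psi q <= q%:R `^ (- (tau - e))).
Hypotheses (e01 : 0 < e < 1) (sg01 : 0 < sg < 1) (tau_e : e < tau) (b1 : 1 < b)
  (exp_nested : tau + 3 * e < b * (1 - e) * (tau - e))
  (exp_divisors : tau + 4 * e < (1 - e) * J.+1%:R)
  (exp_tail : e + b * sg * (tau + 4 * e) < H)
  (exp_error : e + b * sg * (tau + 4 * e) + (tau + 4 * e) * (1 - sg) < b * (1 - e))
  (exp_decay : 2 * (tau + 3 * e) + H < 2 * e * N%:R).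

Let e_gt0 : 0 < e. Proof. by case/andP: e01. Qed.
Let e_lt1 : 0 < 1 - e. Proof. by rewrite subr_gt0; case/andP: e01. Qed.
Let tau_gt0 : 0 < tau. Proof. exact: lt_trans tau_e. Qed.
Let b_gt0 : 0 < b. Proof. exact: lt_trans b1. Qed.
Let w_gt0 : 0 < tau + 3 * e. Proof. by rewrite addr_gt0// mulr_gt0. Qed.
Let c_gt0 : 0 < tau + 4 * e. Proof. by rewrite addr_gt0// mulr_gt0. Qed.

Let prime_large_y c : \forall y \near +oo, forall q : nat,
  q \in primes_in y e -> (c <= q)%N.
Proof.
near=> y => q; have y0 : 0 <= y by near: y; exact: nbhs_pinfty_ge.
case/(primes_inP y0) => _ yq _; rewrite -(ler_nat R); apply: le_trans (ltW yq).
by near: y; exact: near_powR_ge.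
Unshelve. all: by end_near. Qed.

Let near_powR_cvg (P : R -> Prop) : (\forall y \near +oo, P y) ->
  \forall y \near +oo, P (y `^ b).
Proof.
case=> M [_ hM]; near=> y; apply: hM.
apply: lt_le_trans (_ : M + 1 <= _); first by rewrite ltrDl.
by near: y; exact: near_powR_ge.
Unshelve. all: by end_near. Qed.

Let near_width : \forall y \near +oo, 64 * width tau e y <= 1.
Proof.
near=> y; have y0 : 0 < y by near: y; exact: nbhs_pinfty_gt.
rewrite /width powRN ler_pdivrMr ?powR_gt0// mul1r.
by near: y; exact: near_powR_ge.
Unshelve. all: by end_near. Qed.

Let near_nested : \forall y \near +oo, forall q, q \in primes_in (y `^ b) e ->
  4 * width tau e y + psi q + 8 * width tau e (y `^ b) <= 8 * width tau e y.
Proof.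
have h1 := near_powR_cvg (prime_large_y q0).
near=> y => q qQ; have y1 : 1 <= y by near: y; exact: nbhs_pinfty_ge.
have y0 : 0 < y by exact: lt_le_trans y1.
have qq0 : (q0 <= q)%N by move: q qQ; near: y.
have [pq yq _] := primes_inP (powR_ge0 y b) qQ.
have p1 : psi q <= width tau e y.
  apply: le_trans (psi_le qq0) _.
  apply: le_trans (_ : ((y `^ b) `^ (1 - e)) `^ (- (tau - e)) <= _).
    by apply: powRN_le; rewrite ?powR_gt0 ?(ltW yq)// subr_ge0 ltW.
  rewrite /width -!powRrM; have -> : b * ((1 - e) * - (tau - e)) =
    - (b * (1 - e) * (tau - e)) by ring.
  by rewrite ler_powR// lerN2 ltW.
have p2 : 8 * width tau e (y `^ b) <= 3 * width tau e y.
  have h3 : 3 <= y `^ ((b - 1) * (tau + 3 * e)).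
    by near: y; apply: near_powR_ge; rewrite mulr_gt0 ?subr_gt0.
  have -> : width tau e y = y `^ ((b - 1) * (tau + 3 * e)) * width tau e (y `^ b).
    by rewrite /width -powRrM -powRD_gt0//; congr (_ `^ _); ring.
  rewrite mulrA ler_wpM2r ?powR_ge0//; lra.
lra.
Unshelve. all: by end_near. Qed.

Let near_annulus : \forall y \near +oo, forall q, q \in primes_in y e ->
  8 * width tau e y <= y `^ (- e) * psi q.
Proof.
have h1 := prime_large_y q0.
near=> y => q qQ; have y0 : 0 < y by near: y; exact: nbhs_pinfty_gt.
have qq0 : (q0 <= q)%N by move: q qQ; near: y.
have [pq yq qy] := primes_inP (ltW y0) qQ.
have p1 : y `^ (- (tau + e)) <= psi q.
  apply: le_trans (psi_ge qq0).
  by apply: powRN_le; rewrite ?ltr0n ?prime_gt0// addr_ge0// ltW.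
apply: le_trans (ler_wpM2l (powR_ge0 y (- e)) p1).
have h8 : 8 <= y `^ e by near: y; exact: near_powR_ge.
have -> : y `^ (- e) * y `^ (- (tau + e)) = y `^ e * width tau e y.
  by rewrite /width -!powRD_gt0//; congr (_ `^ _); ring.
by rewrite ler_wpM2r// powR_ge0.
Unshelve. all: by end_near. Qed.

Let near_size : \forall y \near +oo,
  (y `^ b) `^ (1 - e) <= (size (primes_in (y `^ b) e))%:R.
Proof.
apply: (near_powR_cvg (P := fun y => y `^ (1 - e) <= (size (primes_in y e))%:R)).
near=> y; apply: size_primes_in_ge => //.
by near: y; apply: near_powR_ge; rewrite divr_gt0.
Unshelve. all: by end_near. Qed.

(** Of the [N + 1] factors [(xi w) ^ 2] from [densT_decay], one is kept for the denominator
    [1 + |xi| ^ 2] and costs [w ^ 2]; the others are at least [y ^ (2 e)] each and pay for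
    [y ^ (- H)] through [exp_decay]. *)
Let near_decay : \forall y \near +oo,
  forall (L : seq (R * R)) xi a, (forall p, p \in L -> 0 <= p.1) ->
    mass L <= 2 -> cutoff tau e y < `|xi| ->
    `|densT N (width tau e y) L xi a| <= y `^ (- H) / (1 + `|xi| ^+ 2).
Proof.
have [C C0 hC] := @densT_decay R N.
near=> y => L xi a L0 m2 xiX; have y1 : 1 <= y by near: y; exact: nbhs_pinfty_ge.
have y0 : 0 < y by exact: lt_le_trans y1.
set w := width tau e y; have w0 : 0 < w by exact: powR_gt0.
have X1 : 1 <= cutoff tau e y.
  by rewrite /cutoff -[leLHS](powRr0 y) ler_powR// ltW.
have ye : y `^ e <= `|xi| * w.
  have -> : y `^ e = cutoff tau e y * w.
    by rewrite /cutoff /w /width -powRD_gt0//; congr (_ `^ _); ring.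
  by rewrite ler_wpM2r ?(ltW w0)// ltW.
have big : 2 * N.+1%:R <= y `^ e by near: y; exact: near_powR_ge.
have := hC w L xi a w0 L0 (le_trans big ye).
set A := `|densT _ _ _ _ _|; have A0 : 0 <= A by exact: normr_ge0.
have tE : (xi * w) ^+ 2 = `|xi| ^+ 2 * w ^+ 2 by rewrite exprMn real_normK ?num_real.
have te : (y `^ e) ^+ 2 <= (xi * w) ^+ 2.
  by rewrite tE -exprMn lerXn2r ?nnegrE ?powR_ge0// mulr_ge0// ltW.
have teN : ((y `^ e) ^+ 2) ^+ N <= ((xi * w) ^+ 2) ^+ N.
  by rewrite lerXn2r ?nnegrE ?sqr_ge0.
rewrite exprS => hA.
have hA2 : A * (`|xi| ^+ 2 * w ^+ 2 * ((y `^ e) ^+ 2) ^+ N) <= 2 * C.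
  apply: le_trans (le_trans hA _); last by rewrite ler_wpM2r// ltW.
  by rewrite ler_wpM2l// -tE ler_wpM2l// sqr_ge0.
have x1 : 1 <= `|xi| ^+ 2 by rewrite exprn_ege1// (le_trans X1)// ltW.
set W := w ^+ 2 * ((y `^ e) ^+ 2) ^+ N.
have W0 : 0 < W by rewrite mulr_gt0 ?exprn_gt0 ?powR_gt0.
have WE : W = y `^ (2 * e * N%:R - 2 * (tau + 3 * e)).
  rewrite /W /w /width -!powR_mulrn ?powR_ge0// -!powRrM -powRD_gt0//.
  by congr (_ `^ _); ring.
have WH : 4 * C <= W * y `^ (- H).
  rewrite WE -powRD_gt0//; near: y; apply: near_powR_ge.
  by have := exp_decay; lra.
have q1 : 0 < 1 + `|xi| ^+ 2 by rewrite ltr_pwDl// sqr_ge0.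
rewrite ler_pdivlMr; last exact: q1.
rewrite -(ler_pM2l W0); apply: le_trans WH.
have e1 : A * (`|xi| ^+ 2 * w ^+ 2 * ((y `^ e) ^+ 2) ^+ N) = `|xi| ^+ 2 * (A * W).
  by rewrite /W; ring.
have e2 : W * (A * (1 + `|xi| ^+ 2)) = A * W + `|xi| ^+ 2 * (A * W) by ring.
have AW : 0 <= A * W by rewrite mulr_ge0// ltW.
rewrite e1 in hA2; rewrite e2; have := ler_wpM2r AW x1; rewrite mul1r => hh.
apply: le_trans (lerD (le_trans hh hA2) hA2) _.
by rewrite -mulrDl; have -> : 2 + 2 = 4 :> R by ring.
Unshelve. all: by end_near. Qed.

Let near_divisors : \forall y \near +oo, forall n : nat,
  n%:R <= cutoff tau e y + cutoff tau e (y `^ b) ->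
  (n < (Num.truncn ((y `^ b) `^ (1 - e))).+1 ^ J.+1)%N.
Proof.
have d0 : 0 < (1 - e) * J.+1%:R - (tau + 4 * e) by rewrite subr_gt0.
have near3 := near_powR_cvg (near_powR_ge 3 d0).
near=> y => n hn; have y1 : 1 <= y by near: y; exact: nbhs_pinfty_ge.
have y0 : 0 < y by exact: lt_le_trans y1.
set z := y `^ b; have z1 : 1 <= z by rewrite /z -[leLHS](powRr0 y) ler_powR// ltW.
have z0 : 0 < z by exact: lt_le_trans z1.
have yz : y <= z by apply: le1r_powR => //; exact: ltW.
have XX : cutoff tau e y <= cutoff tau e z.
  by apply: ge0_ler_powR; rewrite ?nnegrE ?(ltW c_gt0) ?(ltW y0) ?(ltW z0).
have h3 : 3 <= z `^ ((1 - e) * J.+1%:R - (tau + 4 * e)).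
  by rewrite /z; near: y.
have c0 : 0 < cutoff tau e z by exact: powR_gt0.
rewrite -(ltr_nat R) natrX.
apply: lt_le_trans (_ : (z `^ (1 - e)) ^+ J.+1 <= _); last first.
  by rewrite lerXn2r ?nnegrE ?powR_ge0// ltW// truncnS_gt.
have -> : (z `^ (1 - e)) ^+ J.+1 =
    z `^ ((1 - e) * J.+1%:R - (tau + 4 * e)) * cutoff tau e z.
  by rewrite -powR_mulrn ?powR_ge0// -powRrM /cutoff -powRD_gt0// subrK.
have := ler_wpM2r (ltW c0) h3; lra.
Unshelve. all: by end_near. Qed.

(** The right side is of order [y ^ (- E)]. The tail is smaller by [E < H]; the main error has order
    [y ^ (- F)], from about [y ^ (b (1 - e))] primes against a sum of order [cutoff ^ (1 - sg)], and
    [exp_error] says [E < F]. *)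
Let near_error : \forall y \near +oo, y `^ (- H) +
    step_error 2 sg (cutoff tau e y) (y `^ (- H)) J (primes_in (y `^ b) e)
  <= y `^ (- e) * (1 + cutoff tau e (y `^ b)) `^ (- sg).
Proof.
have /andP[s0 s1] := sg01; have s1' : 0 < 1 - sg by rewrite subr_gt0.
near=> y; have y1 : 1 <= y by near: y; exact: nbhs_pinfty_ge.
have y0 : 0 < y by exact: lt_le_trans y1.
have size_ge : (y `^ b) `^ (1 - e) <= (size (primes_in (y `^ b) e))%:R.
  by near: y; exact: near_size.
set E := e + b * sg * (tau + 4 * e).
have X1 : 1 <= cutoff tau e y by rewrite /cutoff -[leLHS](powRr0 y) ler_powR// ltW.
have X'1 : 1 <= cutoff tau e (y `^ b).
  by rewrite /cutoff -powRrM -[leLHS](powRr0 y) ler_powR// mulr_ge0 ?ltW.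
have rhs : 2^-1 * y `^ (- E) <= y `^ (- e) * (1 + cutoff tau e (y `^ b)) `^ (- sg).
  have c2 : 0 < 2 * cutoff tau e (y `^ b) by rewrite mulr_gt0// powR_gt0// powR_gt0.
  apply: le_trans (_ : y `^ (- e) * (2 * cutoff tau e (y `^ b)) `^ (- sg) <= _).
    rewrite powRM ?powR_ge0// /cutoff -!powRrM mulrCA -powRD_gt0//.
    have -> : - e + b * ((tau + 4 * e) * - sg) = - E by rewrite /E; ring.
    rewrite ler_wpM2r ?powR_ge0// -[leLHS]powR_inv1// ler_powR ?ler1n// lerN2 ltW//.
  rewrite ler_wpM2l ?powR_ge0//; apply: powRN_le; rewrite ?(ltW s0)//.
    by apply: lt_le_trans ltr01 _; rewrite lerDl powR_ge0.
  by rewrite mulr_natl mulr2n lerD2r.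
have t1 : 10 * y `^ (- H) <= 4^-1 * y `^ (- E).
  have h40 : 40 <= y `^ (H - E) by near: y; apply: near_powR_ge; rewrite subr_gt0.
  have -> : y `^ (- E) = y `^ (H - E) * y `^ (- H) by rewrite -powRD_gt0//; congr (_ `^ _); ring.
  rewrite mulrA ler_wpM2r ?powR_ge0//; lra.
have t2 : J%:R / (size (primes_in (y `^ b) e))%:R *
   (2 * (2 * (1 + 2 * cutoff tau e y) `^ (1 - sg) / (1 - sg))) <= 4^-1 * y `^ (- E).
  have P0 : 0 < (y `^ b) `^ (1 - e) by rewrite !powR_gt0.
  have S0 : 0 < (size (primes_in (y `^ b) e))%:R :> R by exact: lt_le_trans P0 _.
  have k1 : (1 + 2 * cutoff tau e y) `^ (1 - sg) <= 3 * y `^ ((tau + 4 * e) * (1 - sg)).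
    apply: le_trans (_ : (3 * cutoff tau e y) `^ (1 - sg) <= _).
      by apply: ge0_ler_powR; rewrite ?nnegrE ?(ltW s1') //; lra.
    rewrite powRM ?powR_ge0// /cutoff -powRrM ler_wpM2r ?powR_ge0//.
    by rewrite -[leRHS]powRr1// ler_powR ?ler1n// gerBl ltW.
  set F := b * (1 - e) - (tau + 4 * e) * (1 - sg).
  have k2 : 48 * J%:R / (1 - sg) <= y `^ (F - E).
    near: y; apply: near_powR_ge; have := exp_error; rewrite /F /E; lra.
  rewrite mulrAC ler_pdivrMr; last exact: S0.
  apply: le_trans (_ : J%:R * (2 * (2 * (3 * y `^ ((tau + 4 * e) * (1 - sg))) / (1 - sg))) <= _).
    rewrite ler_wpM2l// ler_wpM2l// ler_wpM2r ?invr_ge0 ?(ltW s1')//.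
    by rewrite ler_wpM2l.
  apply: le_trans (_ : 4^-1 * y `^ (- E) * (y `^ b) `^ (1 - e) <= _); last first.
    by rewrite ler_wpM2l// mulr_ge0 ?powR_ge0.
  have -> : 4^-1 * y `^ (- E) * (y `^ b) `^ (1 - e) =
      4^-1 * (y `^ (F - E) * y `^ ((tau + 4 * e) * (1 - sg))).
    rewrite -mulrA -powRrM -!powRD_gt0//; congr (_ * _ `^ _); rewrite /F; ring.
  have := ler_wpM2r (powR_ge0 y ((tau + 4 * e) * (1 - sg))) k2.
  lra.
rewrite /step_error; apply: le_trans rhs; lra.
Unshelve. all: by end_near. Qed.

Lemma good_scale_near : \forall y \near +oo, good_scale psi tau e b sg H N J y.
Proof.
have h8 := near_powR_cvg (prime_large_y 8).
near=> y; have y1 : 1 <= y by near: y; exact: nbhs_pinfty_ge.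
have y0 : 0 < y by exact: lt_le_trans y1.
split => //.
- by near: y; exact: near_width.
- by near: y; exact: near_nested.
- by near: y; exact: near_annulus.
- rewrite -(ltr_nat R); apply: lt_le_trans (_ : (y `^ b) `^ (1 - e) <= _).
    by rewrite !powR_gt0.
  by near: y; exact: near_size.
- by near: y.
- by near: y; exact: near_decay.
- by near: y; exact: near_divisors.
- by near: y; exact: near_error.
Unshelve. all: by end_near. Qed.

End GoodScales.

(** * Choice of the exponents and growth of the scales *)

Section ParameterChoice.
Context {R : realType}.

Lemma psi_power_bounds (psi : nat -> R) (tau e : R) :
  (forall n : nat, (0 < n)%N -> 0 < psi n) ->
  (fun q : nat => - ln (psi q) / ln (q%:R : R)) @ \oo --> tau -> 0 < e ->
  exists q0 : nat, forall q : nat, (q0 <= q)%N ->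
    q%:R `^ (- (tau + e)) <= psi q /\ psi q <= q%:R `^ (- (tau - e)).
Proof.
move=> psi0 /cvgrPdist_le/(_ e)h e0; have [k _ hk] := h e0.
exists (maxn k 2) => q; rewrite geq_max => /andP[kq q2].
have ps := psi0 q (ltnW q2).
have Q1 : 1 < q%:R :> R by rewrite ltr1n.
have Q0 : 0 < q%:R :> R by exact: lt_trans Q1.
have L0 : 0 < ln q%:R :> R by exact: ln_gt0.
have := hk q kq; rewrite /= ler_distlC => /andP[h1 h2].
rewrite ler_pdivlMr// in h1; rewrite ler_pdivrMr// in h2.
have pE : psi q = expR (ln (psi q)) by rewrite lnK.
have powE s : q%:R `^ s = expR (s * ln q%:R) :> R by rewrite /powR gt_eqF.
by rewrite !powE [in X in _ <= X]pE [in X in _ /\ X <= _]pE !ler_expR; split; lra.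
Qed.

(** Serves to choose [e]: the requirements are strict inequalities between polynomials in [e] that
    hold at [e = 0], so they persist for small [e]. *)
Lemma near_gt0_derivable (P : R -> R) :
  derivable P 0 1 -> 0 < P 0 -> \forall e \near (0 : R)^'+, 0 < P e.
Proof.
move=> /derivable1_diffP/differentiable_continuous cP P0.
exact: (cvgr_gt _ (cvg_at_right_filter cP)).
Qed.

(** As a quadratic in [tau], [(tau - 1) ^ 2 - tau * gam ^ 2] has the threshold as its larger root.
    The bound [2 < tau] follows from [3 <= c] and [2 <= S]. *)
Lemma threshold_gt (gam tau : R) : 1 <= gam ->
  (2 + gam ^+ 2 + Num.sqrt ((2 + gam ^+ 2) ^+ 2 - 4)) / 2 < tau ->
  2 < tau /\ tau < (tau - 1) ^+ 2 / gam ^+ 2.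
Proof.
move=> g1 h; have g2 : 1 <= gam ^+ 2 by rewrite exprn_ege1.
move: h; set c := 2 + gam ^+ 2; set S := Num.sqrt _ => h.
have c3 : 3 <= c by rewrite /c; lra.
have c9 : 9 <= c ^+ 2 by have := @lerXn2r R 2 3 c; rewrite !nnegrE => /(_ _ _ c3); lra.
have S0 : 0 <= S by exact: sqrtr_ge0.
have S2 : S ^+ 2 = c ^+ 2 - 4 by rewrite sqr_sqrtr//; lra.
have S1 : 2 <= S.
  rewrite leNgt; apply/negP => S2'.
  have : S ^+ 2 < 2 ^+ 2 by rewrite ltrXn2r// nnegrE.
  by rewrite S2; lra.
split; first by lra.
rewrite ltr_pdivlMr ?(lt_le_trans ltr01)//.
have k1 : 0 < 2 * tau - c - S by lra.
have k2 : 0 < 2 * tau - c + S by lra.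
have : 0 < (2 * tau - c - S) * (2 * tau - c + S) by exact: mulr_gt0.
have -> : (2 * tau - c - S) * (2 * tau - c + S) = 4 * ((tau - 1) ^+ 2 - tau * gam ^+ 2).
  have -> : gam ^+ 2 = c - 2 by rewrite /c; ring.
  transitivity ((2 * tau - c) ^+ 2 - S ^+ 2); first by ring.
  by rewrite S2; ring.
by lra.
Qed.

Lemma parameters (gam tau sg : R) : 1 <= gam -> 2 < tau ->
  let beta := (tau - 1) ^+ 2 / gam ^+ 2 in
  tau < beta -> 0 < sg -> sg < (beta - tau) / (tau * (beta - 1)) ->
  exists b bR e : R, [/\ tau < b, 0 < bR, 0 < e < 1 & 1 < tau - e] /\
    [/\ gam + e < bR / b * (tau - e - 1), bR * (gam + e) < (1 - e) * (tau - e - 1),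
        tau + 3 * e < b * (1 - e) * (tau - e) &
        e + b * sg * (tau + 4 * e) + (tau + 4 * e) * (1 - sg) < b * (1 - e)].
Proof.
move=> g1 t2 beta tb sg0; have tau0 : 0 < tau by lra.
have b10 : 0 < beta - 1 by lra.
rewrite ltr_pdivlMr ?mulr_gt0// => sgb.
have g0 : 0 < gam by lra.
have st1 : sg * tau < 1.
  have : sg * tau * (beta - 1) < 1 * (beta - 1) by lra.
  by rewrite ltr_pM2r.
have st0 : 0 < 1 - sg * tau by lra.
(* [bs] solves [sg = (b - tau) / (tau (b - 1))] for [b]; the right side increases with [b], so every
   [b] between [bs] and [beta] suits the decay. *)
pose bs := (tau - sg * tau) / (1 - sg * tau).
have bsb : bs < beta by rewrite ltr_pdivrMr//; lra.
have tbs : tau < bs.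
  rewrite ltr_pdivlMr//.
  have : 0 < sg * tau * (tau - 1) by rewrite !mulr_gt0//; lra.
  lra.
pose b := (beta + bs) / 2.
have bb : b < beta by rewrite /b; lra.
have bsb' : bs < b by rewrite /b; lra.
have tb' : tau < b by lra.
have b0 : 0 < b by lra.
have fb : 0 < b - tau - sg * tau * (b - 1).
  by move: bsb'; rewrite /bs ltr_pdivrMr//; lra.
(* With [aL = bR / b] the two window conditions at [e = 0] read [b / t < bR < t], solvable because
   [b < beta = t ^ 2]. *)
pose t := (tau - 1) / gam.
have t0 : 0 < t by rewrite divr_gt0//; lra.
have tE : t ^+ 2 = beta by rewrite /t expr_div_n.
have btt : b / t < t by rewrite ltr_pdivrMr// -expr2 tE.
pose bR := (b / t + t) / 2.
have r1 : b / t < bR by rewrite /bR; lra.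
have r2 : bR < t by rewrite /bR; lra.
have bR0 : 0 < bR by apply: lt_trans r1; rewrite divr_gt0.
(* The zeros are kept so that each statement is literally a value at [e = 0]. *)
have p1 : 0 < bR / b * (tau - 0 - 1) - (gam + 0).
  rewrite subr0 addr0 subr_gt0 -ltr_pdivrMr; last by lra.
  rewrite ltr_pdivlMr//; move: r1; rewrite /t invf_div mulrA.
  by rewrite [gam / _ * b]mulrAC [gam * b]mulrC.
have p2 : 0 < (1 - 0) * (tau - 0 - 1) - bR * (gam + 0).
  by rewrite !subr0 addr0 mul1r subr_gt0 -ltr_pdivlMr.
have p3 : 0 < b * (1 - 0) * (tau - 0) - (tau + 3 * 0).
  rewrite !subr0 mulr0 addr0 mulr1 subr_gt0 ltr_pMl//; lra.
have p4 : 0 < b * (1 - 0) - (0 + b * sg * (tau + 4 * 0) + (tau + 4 * 0) * (1 - sg)) by lra.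
have [e [[[[e0 e1] te] [q1 q2]] [q3 q4]]] : exists e : R,
   ((((0 < e) * (e < 1)) * (1 < tau - e)) *
   ((0 < bR / b * (tau - e - 1) - (gam + e)) *
    (0 < (1 - e) * (tau - e - 1) - bR * (gam + e))) *
   ((0 < b * (1 - e) * (tau - e) - (tau + 3 * e)) *
    (0 < b * (1 - e) - (e + b * sg * (tau + 4 * e) + (tau + 4 * e) * (1 - sg)))))%type.
  apply: (@filter_ex _ ((0 : R)^'+)); near=> e.
  split; [split; [split; [split|]|split]|split].
  - by near: e; exact: nbhs_right_gt.
  - by near: e; exact: nbhs_right_lt.
  - have : e < 1 by near: e; exact: nbhs_right_lt.
    lra.
  - near: e; apply: (@near_gt0_derivable (fun e => bR / b * (tau - e - 1) - (gam + e))) => //.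
  - near: e; apply: (@near_gt0_derivable (fun e => (1 - e) * (tau - e - 1) - bR * (gam + e))) => //.
  - near: e; apply: (@near_gt0_derivable (fun e => b * (1 - e) * (tau - e) - (tau + 3 * e))) => //.
  - near: e; apply: (@near_gt0_derivable (fun e => b * (1 - e) -
       (e + b * sg * (tau + 4 * e) + (tau + 4 * e) * (1 - sg)))) => //.
exists b, bR, e; split; split => //; try by rewrite -subr_gt0.
by rewrite e0 e1.
Unshelve. all: by end_near. Qed.

Lemma scale_ge (b A : R) k : 2 <= b -> 1 <= A -> A ^+ k.+1 <= scale b A k.
Proof.
move=> b2 A1; elim: k => [|k IH] /=; first by rewrite expr1.
have Ak : 1 <= A ^+ k.+1 by exact: exprn_ege1.
have s1 : 1 <= scale b A k by exact: le_trans IH.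
apply: le_trans (_ : scale b A k `^ 2 <= _); last by rewrite ler_powR.
rewrite (powR_mulrn 2) ?(le_trans ler01)// expr2 exprS.
apply: ler_pM => //; [exact: le_trans A1|exact: le_trans Ak|].
by apply: le_trans IH; rewrite exprS ler_peMr ?(le_trans ler01 A1)// exprn_ege1.
Qed.

Lemma scale_powRN_le (b A e : R) k : 2 <= b -> 1 <= A -> 0 <= e -> 4 <= A `^ e ->
  scale b A k `^ (- e) <= 2^-1 ^+ k.+2.
Proof.
move=> b2 A1 e0 A4; have A0 : 0 < A by exact: lt_le_trans A1.
apply: le_trans (_ : (A ^+ k.+1) `^ (- e) <= _).
  by apply: powRN_le; rewrite ?exprn_gt0 ?scale_ge.
have -> : (A ^+ k.+1) `^ (- e) = (A `^ e)^-1 ^+ k.+1.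
  by rewrite -powR_mulrn ?(ltW A0)// -powRrM mulrN mulrC powRN powRrM
     powR_mulrn ?powR_ge0// exprVn.
apply: le_trans (_ : (2^-1 ^+ 2) ^+ k.+1 <= _).
  rewrite lerXn2r ?nnegrE ?invr_ge0 ?powR_ge0 ?sqr_ge0//.
  rewrite exprVn lef_pV2 ?posrE ?exprn_gt0 ?powR_gt0//.
  by apply: le_trans A4; rewrite -natrX ler_nat.
rewrite -exprM ler_wiXn2l ?invr_ge0 ?invf_le1 ?ler1n//.
by rewrite mul2n -addnn addSn addnS !ltnS leq_addr.
Qed.

Lemma scale_cvg (b A : R) : 2 <= b -> 2 <= A -> scale b A @ \oo --> +oo.
Proof.
move=> b2 A2; have A0 : 0 <= A by exact: le_trans A2.
apply/cvgryPge => T; near=> k; apply: le_trans (scale_ge _ _ _) => //; last first.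
  by apply: le_trans A2; rewrite ler1n.
apply: le_trans (_ : k%:R <= _).
  by near: k; exact: nbhs_infty_ger.
apply: le_trans (_ : 2 ^+ k.+1 <= _); last by rewrite lerXn2r ?nnegrE.
by rewrite -natrX ler_nat ltnW// (leq_trans (ltn_expl k (ltnSn 1)))// leq_exp2l.
Unshelve. all: by end_near. Qed.

End ParameterChoice.

(** * The limit measure: support, transform and mass *)

Section GapFunctions.
Context {R : realType}.
Implicit Types (L : seq (R * R)) (r x y : R).

(** For [r >= 0] this is the distance to the union of the balls of radius [r] around the atoms,
    truncated at [1]: a bounded Lipschitz test function that vanishes exactly on this union. *)
Definition gap r L x : R :=
  foldr (fun p acc => Num.min (Num.max 0 (`|x - p.2| - r)) acc) 1 L.

Lemma gap_itv r L x : 0 <= gap r L x <= 1.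
Proof.
elim: L => [|p L /andP[h0 h1]] /=; first by rewrite ler01 lexx.
by rewrite le_min le_max lexx h0/= ge_min h1 orbT.
Qed.

Lemma min_lipschitz (a a' b b' K : R) : `|a - a'| <= K -> `|b - b'| <= K ->
  `|Num.min a b - Num.min a' b'| <= K.
Proof.
rewrite !ler_norml => /andP[h1 h2] /andP[h3 h4].
by case: (leP a b) => ab; case: (leP a' b') => ab'; apply/andP; split; lra.
Qed.

Lemma gap_lipschitz r L x y : `|gap r L x - gap r L y| <= 1 * `|x - y|.
Proof.
rewrite mul1r; elim: L => [|p L IH] /=; first by rewrite subrr normr0.
apply: min_lipschitz IH.
have : `| (`|x - p.2| - `|y - p.2|) | <= `|x - y|.
  by apply: le_trans (ler_dist_dist _ _) _; have -> : x - p.2 - (y - p.2) = x - y by ring.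
rewrite ler_norml => /andP[h1 h2].
have n0 : 0 <= `|x - y| by [].
rewrite ler_norml; case: (leP 0 (`|x - p.2| - r)) => h;
  case: (leP 0 (`|y - p.2| - r)) => h'; apply/andP; split; lra.
Qed.

Lemma gap_eq0 r L x : gap r L x = 0 <-> exists2 p, p \in L & `|x - p.2| <= r.
Proof.
elim: L => [|p L IH] /=.
  by split=> [/eqP|[]//]; rewrite oner_eq0.
have /andP[g0 _] := gap_itv r L x.
split.
  case: (leP (Num.max 0 (`|x - p.2| - r)) (gap r L x)) => _ h.
    exists p; rewrite ?mem_head//.
    by have := le_max (`|x - p.2| - r) 0 (`|x - p.2| - r); rewrite lexx orbT h subr_le0.
  by have [p' p'L h'] := IH.1 h; exists p' => //; rewrite inE p'L orbT.
case=> p'; rewrite inE => /predU1P[->|p'L] h'.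
  rewrite (max_idPl _) ?subr_le0//; exact: (min_idPl _).
have -> : gap r L x = 0 by apply: IH.2; exists p'.
by apply: (min_idPr _); rewrite le_max lexx.
Qed.

Variables (mu : {measure set (measurableTypeR R) -> \bar R}) (U : set_system nat)
  (nu : nat -> seq (R * R)).
Hypotheses (UP : ProperFilter U) (Uoo : \oo `<=` U).
Hypothesis mu_limit : forall (g : R -> R) (B L : R), (forall x, `|g x| <= B) ->
  (forall x y, `|g x - g y| <= L * `|x - y|) ->
  mu.-integrable setT (EFin \o g) /\
  (fun k => \sum_(p <- nu k) p.1 * g p.2) @ U --> (\int[mu]_(x in setT) g x)%R.

Lemma gap_negligible r L (m : nat) :
  (forall k p, (m <= k)%N -> p \in nu k -> gap r L p.2 = 0) ->
  mu.-negligible [set x | gap r L x != 0].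
Proof.
move=> h0.
have b x : `|gap r L x| <= 1 by have /andP[g0 g1] := gap_itv r L x; rewrite ger0_norm.
have [gi gl] := mu_limit b (gap_lipschitz r L).
have z : (\int[mu]_(x in setT) gap r L x)%R = 0.
  apply: (cvg_unique _ gl) => //; apply: (@cvg_near_cst); apply: Uoo.
  exists m => // k mk /=; rewrite big_seq big1// => p pk.
  by rewrite (h0 _ _ mk pk) mulr0.
have {z} z : (\int[mu]_(x in setT) `|(gap r L x)%:E| = 0)%E.
  transitivity (\int[mu]_(x in setT) (gap r L x)%:E)%E.
    by apply: eq_integral => x _ /=; rewrite ger0_norm//; case/andP: (gap_itv r L x).
  by rewrite -(fineK (integrable_fin_num measurableT gi)) -[fine _]/(Rintegral _ _ _) z.
have [N [mN N0 hN]] : ae_eq mu setT (EFin \o gap r L) (cst 0%E).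
  by apply/ae_eq_integral_abs => //; exact: measurable_int gi.
exists N; split => // x /= /eqP gx; apply: hN => /= h.
by apply: gx; have [] := h I.
Qed.

(** [K] is the intersection over [k] of the unions of balls at level [k]. All later atoms lie in
    these balls, so the gap function of level [k] integrates to [0] in the limit, and the complement
    of each union is negligible. *)
Lemma limit_support (r : nat -> R) (x1 x2 : R) :
  (forall j k p, p \in nu (j + k)%N -> exists2 p', p' \in nu k & `|p.2 - p'.2| <= r k) ->
  (forall p, p \in nu 0%N -> x1 <= p.2 - r 0%N /\ p.2 + r 0%N <= x2) ->
  exists K : set R, [/\ compact K, mu (~` K) = 0%E &
    forall x, K x -> forall k, exists2 p, p \in nu k & `|x - p.2| <= r k].
Proof.
move=> near bnd; pose K := \bigcap_k [set x | gap (r k) (nu k) x = 0].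
have hK x : K x -> forall k, exists2 p, p \in nu k & `|x - p.2| <= r k.
  by move=> Kx k; apply/gap_eq0; exact: Kx.
have clK : closed K.
  apply: closed_bigI => k _; apply: (@preimage_closed _ _ (gap (r k) (nu k)) [set 0]).
    move=> x _; apply/cvgrPdist_le => e e0; near=> y.
    apply: le_trans (gap_lipschitz _ _ _ _) _; rewrite mul1r.
    by near: y; exact: cvgr_dist_le.
  exact: closed_eq.
exists K; split => //.
  apply: (subclosed_compact clK (@segment_compact _ x1 x2)) => x /hK/(_ 0%N)[p /bnd[b1 b2]].
  rewrite ler_distl => /andP[l1 l2] /=; rewrite in_itv/=; apply/andP; split; lra.
have mK : measurable (~` K : set (measurableTypeR R)).
  by apply: measurable_realfun.open_measurable; exact: closed_openC.
apply: measure_negligible => //.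
rewrite /K setC_bigcap; apply: negligible_bigcup => k.
apply: negligibleS (_ : mu.-negligible [set x | gap (r k) (nu k) x != 0]).
  by move=> x /= /eqP.
apply: (@gap_negligible _ _ k) => n p kn; rewrite -(subnK kn) => /near[p' p'k h].
by apply/gap_eq0; exists p'.
Unshelve. all: by end_near. Qed.

Lemma cos_lipschitz (x y : R) : `|cos x - cos y| <= `|x - y|.
Proof.
wlog xy : x y / x <= y.
  by move=> h; have [/h//|/ltW/h] := leP x y; rewrite distrC [`|y - x|]distrC.
have [z _ h] := @MVT_segment R cos (fun z => - sin z) x y xy
  (fun z _ => is_derive_cos z) (continuous_subspaceT (@continuous_cos R)).
rewrite distrC h [`|x - y|]distrC normrM normrN ler_piMl//.
by rewrite ler_norml sin_geN1 sin_le1.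
Qed.

Lemma trig_lipschitz (xi a x y : R) :
  `|cos (2 * pi * xi * x + a) - cos (2 * pi * xi * y + a)| <= `|2 * pi * xi| * `|x - y|.
Proof.
apply: le_trans (cos_lipschitz _ _) _; rewrite -normrM.
by have -> : 2 * pi * xi * x + a - (2 * pi * xi * y + a) = 2 * pi * xi * (x - y) by ring.
Qed.

Lemma limit_trig_le (xi a B : R) :
  (\forall k \near \oo, `|trig (nu k) xi a| <= B) ->
  `|\int[mu]_(x in setT) cos (2 * pi * xi * x + a)| <= B.
Proof.
move=> h; have [_ /cvg_norm] := mu_limit (fun x => cos_max _) (trig_lipschitz xi a).
by move/(@cvgr_to_le _ _ _ _ _ _ _); apply; apply: Uoo.
Qed.

Lemma FTabs_le (xi B : R) :
  (forall a, \forall k \near \oo, `|trig (nu k) xi a| <= B) -> FTabs mu xi <= 2 * B.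
Proof.
move=> h.
have reB : `|FTre mu xi| <= B.
  have -> : FTre mu xi = (\int[mu]_(x in setT) cos (2 * pi * xi * x + 0))%R.
    by apply: eq_Rintegral => x _; congr cos; ring.
  exact: limit_trig_le.
have imB : `|FTim mu xi| <= B.
  have -> : FTim mu xi = (\int[mu]_(x in setT) cos (2 * pi * xi * x + - (pi / 2)))%R.
    by apply: eq_Rintegral => x _; rewrite cosBpihalf; congr sin; ring.
  exact: limit_trig_le.
have B0 : 0 <= B by exact: le_trans imB.
rewrite /FTabs -(ler_pXn2r (n := 2)) ?nnegrE ?sqrtr_ge0 ?mulr_ge0//.
rewrite sqr_sqrtr ?addr_ge0 ?sqr_ge0//.
have sq (u : R) : `|u| <= B -> u ^+ 2 <= B ^+ 2.
  by move=> uB; rewrite -real_normK ?num_real// lerXn2r ?nnegrE.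
have := sq _ reB; have := sq _ imB; have := sqr_ge0 B; lra.
Qed.

Lemma limit_mass_gt0 (m : R) : 0 < m -> (forall k, m <= mass (nu k)) -> (0 < mu setT)%E.
Proof.
move=> m0 hm; rewrite lt0e measure_ge0 andbT; apply/eqP => mu0.
have [] := @mu_limit (fun=> 1) 1 0.
- by move=> x; rewrite normr1.
- by move=> x y; rewrite subrr normr0 mul0r.
move=> _; rewrite Rintegral_cst// mu0 mulr0 => h.
have : m <= 0.
  apply: (cvgr_to_ge h); apply: nearW => k; apply: le_trans (hm k) _.
  by rewrite /mass; under eq_bigr do rewrite -[_.1]mulr1.
by rewrite leNgt m0.
Qed.

End GapFunctions.

(** * Fourier exponents of the exact set *)

Section FourierExponents.
Context {R : realType}.

Lemma atoms_exact (psi : nat -> R) (theta gam kap tau e b aL bR sg H y0 : R) (N J q0 : nat) :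
  (forall n : nat, (0 < n)%N -> 0 < psi n) ->
  (forall m n : nat, (0 < m)%N -> (m <= n)%N -> psi n <= psi m) ->
  (forall q : nat, (q0 <= q)%N -> psi q <= q%:R `^ (- (tau - e))) ->
  separated theta gam kap -> 0 < kap -> 1 <= gam -> 0 <= theta < 1 ->
  0 < e < 1 -> 0 < aL -> 1 < tau - e -> gam < aL * (tau - e - 1) ->
  bR * gam < (1 - e) * (tau - e - 1) -> b * aL <= bR ->
  scale b y0 @ \oo --> +oo ->
  (forall k, good_scale psi tau e b sg H N J (scale b y0 k)) ->
  (forall k, scale b y0 k `^ (- e) <= 2^-1) ->
  forall x, (forall k, exists2 p, p \in atoms psi theta tau e b N y0 k &
     `|x - p.2| <= 8 * width tau e (scale b y0 k)) ->
  Exact psi theta x.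
Proof.
move=> psi0 psini psile sep kap0 gam1 /[dup] th01 /andP[th0 th1] /[dup] e01 /andP[e0 e1].
move=> aL0 te hL hR hb Ycv good Yle x hx.
apply: (exact_approximable psi0 psini psile sep kap0 gam1 e01 aL0 te hL hR hb Ycv) => //.
case=> [//|k _]; have [p pk xp] := hx k.+1.
have [q [r [p' [qQ rq p'k pE _]]]] := atoms_succ psi0 e0 good pk.
have Y0 : 0 <= scale b y0 k.+1 by exact: le_trans ler01 (gs_ge1 (good k.+1)).
have [pq yq qy] := primes_inP Y0 qQ.
have ps := psi0 q (prime_gt0 pq).
have an := le_trans xp (gs_annulus (good k.+1) qQ).
have nest := gs_nested (good k) qQ.
have w1 := gs_width (good k).
have [w0 w0'] : 0 <= width tau e (scale b y0 k) /\ 0 <= width tau e (scale b y0 k `^ b).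
  by split; exact: powR_ge0.
have /andP[p38 _] := atoms_itv psi0 e0 good pk.
set z := scale b y0 k.+1 `^ (- e) in an; have z0 : 0 <= z by exact: powR_ge0.
have z1 : z <= 2^-1 by exact: Yle.
have zp : z * psi q <= 2^-1 * psi q by rewrite ler_wpM2r// ltW.
have zp0 : 0 <= z * psi q by rewrite mulr_ge0// ltW.
rewrite /offset -/z in pE.
exists q, (Posz r); split => //; first by rewrite prime_gt0.
(* A numerator [r = 0] would give a grid point at most [0] and an atom at most [psi q <= 1 / 8],
   below [3 / 8]. So [0 < r < q], and primality of [q] gives coprimality. *)
- rewrite /= coprime_sym prime_coprime// gtnNdvd//.
  rewrite lt0n; apply: contraPneq p38 => r0; apply/negP; rewrite -ltNge pE r0 /grid.
  have : (0 - theta) / q%:R <= 0 by rewrite sub0r mulNr oppr_le0 divr_ge0.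
  lra.
- exact: ltW.
rewrite -/(grid theta q r) pmulrn -/(grid theta q r).
move: an; rewrite -/z pE !ler_norml => /andP[u1 u2].
(* The point is within [z * psi q] of an atom placed at [(1 - z) * psi q] from the grid point, hence
   the factors [1 - 2 z] and [1]. *)
have uE : x - grid theta q r = x - (grid theta q r + (1 - z) * psi q) + (1 - z) * psi q by ring.
have l : (1 - 2 * z) * psi q <= x - grid theta q r by rewrite uE; lra.
have u : x - grid theta q r <= psi q by rewrite uE; lra.
rewrite (le_trans l (ler_norm _)) /=; apply/andP; split => //; lra.
Qed.

Lemma fourier_exponent_mem (psi : nat -> R) (theta gamma tau sg : R) :
  0 <= theta < 1 -> 1 <= gamma ->
  (forall g, gamma < g -> exists2 kap : R, 0 < kap & separated theta g kap) ->
  (forall n : nat, (0 < n)%N -> 0 < psi n) ->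
  (forall m n : nat, (0 < m)%N -> (m <= n)%N -> psi n <= psi m) ->
  (fun q : nat => - ln (psi q) / ln (q%:R : R)) @ \oo --> tau -> 2 < tau ->
  let beta := (tau - 1) ^+ 2 / gamma ^+ 2 in
  tau < beta -> 0 < sg -> sg < (beta - tau) / (tau * (beta - 1)) ->
  fourier_exponents (Exact psi theta) (2 * sg).
Proof.
move=> th01 g1 hsep psi0 psini psicv t2 beta tb sg0 sgb.
have [b [bR [e [[tb' bR0 /[dup] e01 /andP[e0 e1] te] [h1 h2 h3 h4]]]]] :=
  parameters g1 t2 tb sg0 sgb.
have tau0 : 0 < tau by lra.
have b2 : 2 <= b by lra.
have b0 : 0 < b by lra.
have sg2 : 2 * sg < 1.
  have bt0 : 0 < beta - 1 by lra.
  move: sgb; rewrite ltr_pdivlMr ?mulr_gt0// => sgb.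
  have : sg * tau * (beta - 1) < 1 * (beta - 1) by lra.
  rewrite ltr_pM2r// => sgt.
  have : sg * 2 < sg * tau by rewrite ltr_pM2l.
  by lra.
have sg01 : 0 < sg < 1 by rewrite sg0 /=; lra.
have [|kap kap0 sep] := hsep (gamma + e); first by rewrite ltrDl.
have [q0 hq0] := psi_power_bounds psi0 psicv e0.
have psige q : (q0 <= q)%N -> q%:R `^ (- (tau + e)) <= psi q by case/hq0.
have psile q : (q0 <= q)%N -> psi q <= q%:R `^ (- (tau - e)) by case/hq0.
have [J hJ] : exists J, tau + 4 * e < (1 - e) * J.+1%:R.
  exists (Num.truncn ((tau + 4 * e) / (1 - e))).
  by rewrite -ltr_pdivrMl ?subr_gt0// mulrC; exact: truncnS_gt.
(* [H] exceeds the exponent required of the tail; the power [N] of the bump is then taken large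
   enough to reach it. *)
pose H := e + b * sg * (tau + 4 * e) + 1.
have [N hN] : exists N : nat, 2 * (tau + 3 * e) + H < 2 * e * N%:R.
  exists (Num.truncn ((2 * (tau + 3 * e) + H) / (2 * e))).+1.
  by rewrite -ltr_pdivrMl ?mulr_gt0// mulrC; exact: truncnS_gt.
have hH : e + b * sg * (tau + 4 * e) < H by rewrite /H ltrDl.
have te' : e < tau by lra.
have b1 : 1 < b by lra.
have [M [_ hM]] := good_scale_near psige psile e01 sg01 te' b1 h3 hJ hH h4 hN.
have [A [[MA A2] A4]] : exists A : R, ((M < A) * (2 <= A) * (4 <= A `^ e))%type.
  apply: (@filter_ex _ (+oo : set_system R)); near=> A; split; [split|].
  - by near: A; apply: nbhs_pinfty_gt; exact: num_real.
  - by near: A; apply: nbhs_pinfty_ge; exact: num_real.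
  - by near: A; exact: near_powR_ge.
have A1 : 1 <= A by lra.
have A0 : 0 < A by lra.
set Y := scale b A; set nu := atoms psi theta tau e b N A.
have YA k : A ^+ k.+1 <= Y k by exact: scale_ge.
have Y1 k : 1 <= Y k by apply: le_trans (YA k); exact: exprn_ege1.
have Y0 k : 0 < Y k by exact: lt_le_trans (Y1 k).
have good k : good_scale psi tau e b sg H N J (Y k).
  apply: hM; apply: lt_le_trans MA _; apply: le_trans (YA k).
  by rewrite exprS ler_peMr ?(ltW A0)// exprn_ege1.
have small k : Y k `^ (- e) <= 2^-1 ^+ k.+2 by exact: (scale_powRN_le k b2 A1 (ltW e0) A4).
have Ycv : Y @ \oo --> +oo by exact: (scale_cvg b2 A2).
have b1' := ltW b1.
have bounds k := atoms_bounds psi0 th01 e0 tau0 sg01 b1' good small k.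
have nu_ge0 k p : p \in nu k -> 0 <= p.1 by exact: (atoms_ge0 good).
have hpow k : 0 <= 2^-1 ^+ k :> R by rewrite exprn_ge0// invr_ge0.
have mass_itv k : 2^-1 <= mass (nu k) <= 2.
  have [+ _] := bounds k; rewrite ler_norml -/nu => /andP[m1 m2].
  by have pk := hpow k.+1; clear -m1 m2 pk; apply/andP; split; lra.
have [||mu [U [UP Uoo mufin lim]]] := @helly R nu 2.
- move=> k p pk; split; first exact: nu_ge0 pk.
  by have /andP[p1 p2] := atoms_itv psi0 e0 good pk; apply/andP; clear -p1 p2; split; lra.
- by move=> k; case/andP: (mass_itv k).
have [||K [cK K0 hK]] := @limit_support _ mu U nu UP Uoo lim
   (fun k => 8 * width tau e (Y k)) 0 1.
- move=> j k p /(atoms_near psi0 e0 good)[p' p'k h]; exists p' => //.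
  have w0 : 0 <= width tau e (Y (j + k)%N) by exact: powR_ge0.
  by move: h; rewrite -/Y => h; clear -h w0; lra.
- move=> p; rewrite inE => /eqP -> /=; have := gs_width (good 0%N); rewrite /Y/=; lra.
split; first by apply/andP; split; [rewrite mulr_ge0 ?ltW|exact: ltW].
exists mu; split.
  by apply: (limit_mass_gt0 UP lim (m := 2^-1)); rewrite ?invr_gt0// => k;
     case/andP: (mass_itv k).
split => //; split.
  exists K; split => //; split => // x /hK xK.
  apply: (atoms_exact (aL := bR / b) psi0 psini psile sep kap0 _ th01 e01 _ te h1 h2 _
     Ycv good _ xK).
  - lra.
  - exact: divr_gt0.
  - by rewrite mulrC divfK// gt_eqF.
  - move=> k; apply: le_trans (small k) _.
    by rewrite exprS ler_piMr ?invr_ge0// exprn_ile1 ?invr_ge0// invf_le1 ?ler1n.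
set D0 := (1 + cutoff tau e (Y 0%N)) `^ sg.
(* The inner [2] bounds every [2 - 2^-1 ^+ k]; the outer one joins real and imaginary parts. A fixed
   frequency lies below the cutoff from some level on, which is enough for the limit. *)
exists (2 * (D0 * 2)) => xi; have -> : 2 * sg / 2 = sg by field.
rewrite -mulrA; apply: (FTabs_le UP Uoo lim) => a.
have : \forall y \near +oo, `|xi| <= cutoff tau e y.
  by apply: near_powR_ge; lra.
move=> /Ycv[k0 _ hk0]; exists k0 => // k /= /hk0 xk.
have [_ h] := bounds k; apply: le_trans (h xi a xk) _.
rewrite ler_wpM2r ?powR_ge0// ler_wpM2l ?powR_ge0//.
by have := hpow k; lra.
Unshelve. all: by end_near. Qed.

End FourierExponents.

Theorem theorem1 (R : realType) (theta gamma tau : R) (psi : nat -> R) :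
  0 <= theta < 1 ->
  (theta = 0 /\ gamma = 1) \/ (irrational theta /\ dio_exponent theta = gamma%:E) ->
  (forall n : nat, (0 < n)%N -> 0 < psi n) ->
  (forall m n : nat, (0 < m)%N -> (m <= n)%N -> psi n <= psi m) ->
  (fun q : nat => - ln (psi q) / ln (q%:R : R)) @ \oo --> tau ->
  (2 + gamma ^+ 2 + Num.sqrt ((2 + gamma ^+ 2) ^+ 2 - 4)) / 2 < tau ->
  let beta := (tau - 1) ^+ 2 / gamma ^+ 2 in
  0 < fourier_dim (Exact psi theta) /\
  2 * (beta - tau) / (tau * (beta - 1)) <= fourier_dim (Exact psi theta).
Proof.
move=> th01 hth psi0 psini psicv htau beta.
have [g1 hsep] : 1 <= gamma /\
    forall g, gamma < g -> exists2 kap : R, 0 < kap & separated theta g kap.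
  case: hth => [[-> ->]|[irr dio]].
    by split => // g g1; exists 1 => //; apply: separated_rational; exact: ltW.
  have g1 := dio_exponent_ge1 dio; split => // g gg.
  by apply: separated_irrational; rewrite ?dio ?lte_fin// (le_trans g1)// ltW.
have [t2 tb] := threshold_gt g1 htau.
have mem sg := @fourier_exponent_mem R psi theta gamma tau sg th01 g1 hsep psi0 psini psicv t2 tb.
set s0 := (beta - tau) / (tau * (beta - 1)).
have -> : 2 * (beta - tau) / (tau * (beta - 1)) = 2 * s0 by rewrite mulrA.
have s00 : 0 < s0.
  by rewrite divr_gt0 ?mulr_gt0//; rewrite -/beta in tb; lra.
have le_dim sg : 0 < sg -> sg < s0 -> 2 * sg <= fourier_dim (Exact psi theta).
  move=> sg0 sgs; apply: ub_le_sup; last exact: mem.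
  by exists 1 => s [/andP[]].
split.
  have h0 : 0 < s0 / 2 by rewrite divr_gt0.
  apply: lt_le_trans (le_dim _ h0 _); first by rewrite mulr_gt0.
  lra.
(* If the supremum [d] were below [2 * s0], the midpoint of [d / 2] and [s0] would be an admissible
   [sg] with [2 * sg > d]; [d0] ensures that it is positive. *)
rewrite leNgt; apply/negP => dlt.
have d0 : 2 * (s0 / 2) <= fourier_dim (Exact psi theta) by apply: le_dim; lra.
move: dlt d0; set d := fourier_dim _ => dlt d0.
have : 2 * ((d / 2 + s0) / 2) <= d by apply: le_dim; lra.
lra.
Qed.
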